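(* Let $1<q\leq\alpha\leq p\leq\infty$. For $g\in(L^q,\ell^p)^\alpha(\mathbb R^d)$ let $T_g$ be the linear functional on $\mathcal H(q,p,\alpha)$ given by $$\langle T_g,f\rangle=\int_{\mathbb R^d}f(x)g(x)\,dx,\qquad f\in\mathcal H(q,p,\alpha).$$ Then the operator $g\mapsto T_g$ is an isometric isomorphism of $(L^q,\ell^p)^\alpha(\mathbb R^d)$ (with norm $\|\cdot\|_{q,p,\alpha}$) onto the topological dual space $\mathcal H(q,p,\alpha)^{\ast}$ (with the operator norm).
   Context: $d$ is a fixed positive integer, $\mathbb R^d$ carries Lebesgue measure $dx$, and functions are complex-valued and identified when equal almost everywhere. $\|\cdot\|_q$ is the usual norm of $L^q(\mathbb R^d)$, $\chi_E$ the characteristic function of $E$. For $1\le r\le\infty$, $r'$ is the conjugate exponent, $\frac1r+\frac1{r'}=1$, with $\frac1\infty=0$. Amalgam spaces: for $k\in\mathbb Z^d$ let $I_k=k+[0,1)^d$. For $1\le q,p\le\infty$, $(L^q,\ell^p)(\mathbb R^d)$ is the space of (locally $L^q$) functions $f$ with $\|f\|_{q,p}:=\big\|\{\|f\chi_{I_k}\|_q\}_{k\in\mathbb Z^d}\big\|_{\ell^p(\mathbb Z^d)}<\infty$. Dilations: for $1\le\alpha\le\infty$, $\rho>0$ and $f\in L^1_{loc}(\mathbb R^d)$, $(St^{(\alpha)}_\rho f)(x)=\rho^{-d/\alpha}f(\rho^{-1}x)$. Fofana spaces: $(L^q,\ell^p)^\alpha(\mathbb R^d)=\{f\in L^1_{loc}(\mathbb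 R^d) : \|f\|_{q,p,\alpha}<\infty\}$, where $\|f\|_{q,p,\alpha}:=\sup_{\rho>0}\|St^{(\alpha)}_\rho f\|_{q,p}$. The space $\mathcal H(q,p,\alpha)$: for $1\le q\le\alpha\le p\le\infty$, it is the set of all $f\in L^1_{loc}(\mathbb R^d)$ for which there is a sequence $\{(c_n,\rho_n,f_n)\}_{n\ge1}$ in $\mathbb C\times(0,\infty)\times(L^{q'},\ell^{p'})(\mathbb R^d)$ such that $\sum_{n\ge1}|c_n|<\infty$, $\|f_n\|_{q',p'}\le1$ for all $n\ge1$, and $f=\sum_{n\ge1}c_nSt^{(\alpha')}_{\rho_n}f_n$ in the sense of $L^1_{loc}(\mathbb R^d)$. Such a sequence is called an $\mathfrak h$-decomposition of $f$. The norm is $\|f\|_{\mathcal H(q,p,\alpha)}:=\inf\sum_{n\ge1}|c_n|$, the infimum being taken over all $\mathfrak h$-decompositions of $f$; $\mathcal H(q,p,\alpha)$ is a Banach space with this norm. For $f\in\mathcal H(q,p,\alpha)$ and $g\in(L^q,\ell^p)^\alpha(\mathbb R^d)$ the product $fg$ is integrable, so $T_g$ is well defined. *)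

(* Defs.v *)
From HB Require Import structures.
From mathcomp Require Import all_boot all_order all_algebra.
From mathcomp Require Import all_classical all_reals all_analysis.
From mathcomp Require Import complex.

Set Implicit Arguments.
Unset Strict Implicit.
Unset Printing Implicit Defensive.
Import Order.TTheory GRing.Theory Num.Theory.
Import numFieldNormedType.Exports.
Local Open Scope classical_set_scope.
Local Open Scope ring_scope.

(* The sigma-algebra on 'rV[T]_n is generated by the coordinate maps; for
   T = R this is the Borel sigma-algebra of R^n. *)
Definition rV_display : measure_display -> measure_display.
Proof. exact. Qed.

Section measurable_rV.
Context {disp : measure_display} {T : measurableType disp} (n : nat).

Let coord : 'I_n -> 'rV[T]_n -> T := fun i x => x ord0 i.

Let rV_set0 : g_sigma_preimage coord set0.
Proof. exact: sigma_algebra0. Qed.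

Let rV_setC A : g_sigma_preimage coord A -> g_sigma_preimage coord (~` A).
Proof. exact: sigma_algebraC. Qed.

Let rV_bigcup (F : _^nat) : (forall i, g_sigma_preimage coord (F i)) ->
  g_sigma_preimage coord (\bigcup_i (F i)).
Proof. exact: sigma_algebra_bigcup. Qed.

HB.instance Definition _ := @isMeasurable.Build (rV_display disp)
  'rV[T]_n (g_sigma_preimage coord) rV_set0 rV_setC rV_bigcup.

End measurable_rV.


Section measurable_rV_lemmas.
Context {d1 : measure_display} {T1 : measurableType d1}.
Context {d2 : measure_display} {T2 : measurableType d2}.

Lemma measurable_rV_coord n (i : 'I_n) :
  measurable_fun [set: 'rV[T2]_n] (fun x : 'rV[T2]_n => x ord0 i).
Proof.
move=> _ Y mY; rewrite setTI; apply: sub_sigma_algebra => /=.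
rewrite -bigcup_seq/=; exists i => /=; first by rewrite mem_index_enum.
by exists Y => //; rewrite setTI.
Qed.

Lemma measurable_fun_rVP n (f : T1 -> 'rV[T2]_n) :
  (forall i, measurable_fun [set: T1] (fun x => f x ord0 i)) ->
  measurable_fun [set: T1] f.
Proof.
move=> mf; apply: (@measurability _ _ _ _ _ _
  (\big[setU/set0]_(i < n) preimage_set_system [set: 'rV[T2]_n]
     (fun x : 'rV[T2]_n => x ord0 i) measurable)) => //.
move=> _ [B + <-]; rewrite -bigcup_seq => -[i _ [A mA <-]].
by rewrite setTI; exact: mf.
Qed.

End measurable_rV_lemmas.

Section lebesgue_rV.
Context {R : realType}.
Local Open Scope ereal_scope.

Definition cons_rV n (xy : measurableTypeR R * 'rV[R]_n) : 'rV[R]_n.+1 :=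
  row_mx (const_mx xy.1 : 'rV[R]_1) xy.2.

Definition uncons_rV n (x : 'rV[R]_n.+1) : measurableTypeR R * 'rV[R]_n :=
  (x ord0 ord0, \row_i x ord0 (lift ord0 i)).

Lemma cons_rV0 n (xy : measurableTypeR R * 'rV[R]_n) : cons_rV xy ord0 ord0 = xy.1.
Proof.
transitivity ((const_mx xy.1 : 'rV[R]_1) ord0 ord0); last by rewrite mxE.
rewrite -(row_mxEl (const_mx xy.1 : 'rV[R]_1) xy.2).
by congr (row_mx _ _ _ _); exact/val_inj.
Qed.

Lemma cons_rVS n (xy : measurableTypeR R * 'rV[R]_n) i :
  cons_rV xy ord0 (lift ord0 i) = xy.2 ord0 i.
Proof.
rewrite -(row_mxEr (const_mx xy.1 : 'rV[R]_1) xy.2 ord0 i).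
by congr (row_mx _ _ _ _); exact/val_inj.
Qed.

Lemma cons_rVK n : cancel (@cons_rV n) (@uncons_rV n).
Proof.
move=> [x y]; rewrite /uncons_rV cons_rV0; congr pair.
by apply/rowP => i; rewrite mxE cons_rVS.
Qed.

Lemma uncons_rVK n : cancel (@uncons_rV n) (@cons_rV n).
Proof.
move=> x; apply/rowP => i; case: (unliftP ord0 i) => [j|] ->.
  by rewrite cons_rVS mxE.
by rewrite cons_rV0.
Qed.

Lemma measurable_cons_rV n : measurable_fun [set: measurableTypeR R * 'rV[R]_n] (@cons_rV n).
Proof.
apply: measurable_fun_rVP => i; case: (unliftP ord0 i) => [j|] ->.
  under eq_fun do rewrite cons_rVS.
  exact: measurableT_comp (measurable_rV_coord j) measurable_snd.
under eq_fun do rewrite cons_rV0.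
exact: measurable_fst.
Qed.

Lemma measurable_uncons_rV n : measurable_fun [set: 'rV[R]_n.+1] (@uncons_rV n).
Proof.
apply: measurable_fun_pair; first exact: measurable_rV_coord.
apply: measurable_fun_rVP => i.
under eq_fun do rewrite mxE.
exact: measurable_rV_coord.
Qed.


Section step.
Variables (n : nat) (m : {sigma_finite_measure set 'rV[R]_n -> \bar R}).

Definition lebesgue_rV_step : set 'rV[R]_n.+1 -> \bar R :=
  pushforward (@lebesgue_measure R \x m) (@cons_rV n).

HB.instance Definition _ := Measure.copy lebesgue_rV_step
  (measure_function_pushforward__canonical__measure_function_Measure 
  (@lebesgue_measure R \x m) (@measurable_cons_rV n)).

Let step_sigma_finite : sigma_finite setT lebesgue_rV_step.
Proof.
have /sigma_finiteP[F [TF ndF Foo]] := sigma_finiteT (@lebesgue_measure R).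
have /sigma_finiteP[G [TG ndG Goo]] := sigma_finiteT m.
exists (fun k => @uncons_rV n @^-1` (F k `*` G k)).
  rewrite -preimage_bigcup (_ : \bigcup_k _ = setT) ?preimage_setT//.
  apply/seteqP; split=> // -[x y] _.
  have [k _ Fkx] : (\bigcup_k F k) x by rewrite -TF.
  have [l _ Gly] : (\bigcup_k G k) y by rewrite -TG.
  exists (maxn k l) => //; split => /=.
  - by move: x Fkx; exact/subsetPset/ndF/leq_maxl.
  - by move: y Gly; exact/subsetPset/ndG/leq_maxr.
move=> k; have [mF Fk] := Foo k; have [mG Gk] := Goo k; split.
  rewrite -[X in measurable X]setTI; apply: measurable_uncons_rV => //.
  exact: measurableX.
rewrite /lebesgue_rV_step /pushforward -comp_preimage.
rewrite (_ : _ \o _ = id) ?preimage_id; last first.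
  by apply/funext => x /=; rewrite cons_rVK.
by rewrite product_measure1E// lte_mul_pinfty// ge0_fin_numE.
Qed.

HB.instance Definition _ := @Measure_isSigmaFinite.Build _ _ _
  lebesgue_rV_step step_sigma_finite.

End step.

Fixpoint lebesgue_rV n : {sigma_finite_measure set 'rV[R]_n -> \bar R} :=
  match n with
  | 0 => @dirac _ 'rV[R]_0 0%R R
  | n'.+1 => lebesgue_rV_step (lebesgue_rV n')
  end.

Lemma lebesgue_rV_box n (A : 'I_n -> set R) :
  (forall i, measurable (A i)) ->
  lebesgue_rV n [set x | forall i, A i (x ord0 i)] =
  \prod_(i < n) lebesgue_measure (A i).
Proof.
elim: n A => [|n IH] A mA.
  by rewrite big_ord0 /= diracE mem_set//= => -[].
rewrite big_ord_recl -IH//= /lebesgue_rV_step /pushforward.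
set B := (X in _ = _ * lebesgue_rV n X).
have mB : measurable B.
  have -> : B = \bigcap_(i in [set: 'I_n])
      ((fun x : 'rV[R]_n => x ord0 i) @^-1` A (lift ord0 i)).
    by apply/seteqP; split=> x /= h i => [_|]; exact: h.
  apply: fin_bigcap_measurable => // i _.
  by rewrite -[X in measurable X]setTI; exact: measurable_rV_coord.
rewrite -product_measure1E//; last exact: mA.
congr (_ _); apply/seteqP; split => -[x y] /=.
  move=> h; split; first by have := h ord0; rewrite cons_rV0.
  by move=> i; have := h (lift ord0 i); rewrite cons_rVS.
move=> [Ax Ay] i; case: (unliftP ord0 i) => [j|] ->.
  by rewrite cons_rVS; exact: Ay.
by rewrite cons_rV0.
Qed.

End lebesgue_rV.

Section complex_functions.
Context {R : realType} {d : nat}.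
Local Notation mu := (@lebesgue_rV R d).
Implicit Types (f g : 'rV[R]_d -> R[i]) (u : nat -> 'rV[R]_d -> R[i]).

Definition cmeasurable f :=
  measurable_fun [set: 'rV[R]_d] (fun x => complex.Re (f x)) /\
  measurable_fun [set: 'rV[R]_d] (fun x => complex.Im (f x)).

Definition cintegrable f :=
  mu.-integrable [set: 'rV[R]_d] (fun x => (complex.Re (f x))%:E) /\
  mu.-integrable [set: 'rV[R]_d] (fun x => (complex.Im (f x))%:E).

Definition cintegral f : R[i] :=
  (Rintegral mu [set: 'rV[R]_d] (fun x => complex.Re (f x)) +i*
   Rintegral mu [set: 'rV[R]_d] (fun x => complex.Im (f x)))%C.

(* The modulus is taken in R by normc: `|z| has type R[i]. *)
Definition cLnorm (q : \bar R) f : \bar R :=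
  Lnorm mu q (fun x => (Normc.normc (f x))%:E).

Definition L1loc f :=
  cmeasurable f /\
  forall K : set 'rV[R]_d, compact K ->
    (\int[mu]_(x in K) (Normc.normc (f x))%:E < +oo)%E.

Definition L1loc_cvg u f :=
  forall K : set 'rV[R]_d, compact K ->
    (fun N => \int[mu]_(x in K) (Normc.normc (u N x - f x))%:E)%E @ \oo
      --> 0%E.

End complex_functions.

Section amalgam_fofana.
Context {R : realType} {d : nat}.
Implicit Types (q p alpha : \bar R) (f : 'rV[R]_d -> R[i]).

(* Meaningful for 0 < p only. *)
Definition seq_norm (I : choiceType) p (a : I -> \bar R) : \bar R :=
  match p with
  | r%:E => (\esum_(k in [set: I]) `|a k| `^ r) `^ r^-1
  | +oo => ereal_sup [set `|a k| | k in [set: I]]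
  | -oo => 0
  end%E.

Definition unit_cube (k : 'rV[int]_d) : set 'rV[R]_d :=
  [set x | forall i, (k ord0 i)%:~R <= x ord0 i < (k ord0 i)%:~R + 1].

Definition amalgam_norm q p f : \bar R :=
  seq_norm p (fun k : 'rV[int]_d =>
    cLnorm q (fun x => f x * (\1_(unit_cube k) x)%:C%C)).

Definition amalgam q p : set ('rV[R]_d -> R[i]) :=
  [set f | cmeasurable f /\ (amalgam_norm q p f < +oo)%E].

Definition dilation alpha (rho : R) f : 'rV[R]_d -> R[i] :=
  fun x => (rho `^ (- (d%:R * fine alpha^-1%E)))%:C%C * f (rho^-1 *: x).

Definition fofana_norm q p alpha f : \bar R :=
  ereal_sup [set amalgam_norm q p (dilation alpha rho f) |
             rho in [set rho : R | 0 < rho]].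

Definition fofana q p alpha : set ('rV[R]_d -> R[i]) :=
  [set f | L1loc f /\ (fofana_norm q p alpha f < +oo)%E].

End amalgam_fofana.

Section space_H.
Context {R : realType} {d : nat}.
Variables q p alpha : \bar R.
Local Notation mu := (@lebesgue_rV R d).
Local Notation q' := (hoelder_conjugate q).
Local Notation p' := (hoelder_conjugate p).
Local Notation alpha' := (hoelder_conjugate alpha).
Implicit Types (f g : 'rV[R]_d -> R[i]).

Definition abs_coef_sum (c : nat -> R[i]) : \bar R :=
  (\sum_(0 <= n <oo) (Normc.normc (c n))%:E)%E.

Definition h_decomposition f (c : nat -> R[i]) (rho : nat -> R)
    (h : nat -> 'rV[R]_d -> R[i]) :=
  [/\ forall n, 0 < rho n,
      forall n, amalgam q' p' (h n),
      (abs_coef_sum c < +oo)%E,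
      forall n, (amalgam_norm q' p' (h n) <= 1)%E &
      L1loc_cvg (fun N x =>
        \sum_(0 <= n < N) c n * dilation alpha' (rho n) (h n) x) f].

Definition H_space : set ('rV[R]_d -> R[i]) :=
  [set f | L1loc f /\ exists c rho h, h_decomposition f c rho h].

Definition H_norm f : \bar R :=
  ereal_inf [set abs_coef_sum c | c in
    [set c | exists rho h, h_decomposition f c rho h]].

(* A functional on H_space is a map on functions of which only the values on
   H_space matter; since elements of H_space are classes of functions modulo
   almost everywhere equality, it has to be compatible with this relation. *)
Definition H_dual (L : ('rV[R]_d -> R[i]) -> R[i]) :=
  [/\ forall f g, H_space f -> H_space g -> f = g %[ae mu] -> L f = L g,
      forall (a : R[i]) f g, H_space f -> H_space g ->
        L (fun x => a * f x + g x) = a * L f + L g &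
      forall f, H_space f -> forall eps : R, 0 < eps ->
        exists2 delta : R, 0 < delta &
          forall g, H_space g -> (H_norm (fun x => (g x - f x)%R) < delta%:E)%E ->
            Normc.normc (L g - L f) < eps].

Definition H_dual_norm (L : ('rV[R]_d -> R[i]) -> R[i]) : \bar R :=
  ereal_sup [set (Normc.normc (L f))%:E | f in
    [set f | H_space f /\ (H_norm f <= 1)%E]].

End space_H.

Definition pairing {R : realType} {d : nat} (g f : 'rV[R]_d -> R[i]) : R[i] :=
  cintegral (fun x => f x * g x).

(* Main.v *)
Require Import Defs.
From HB Require Import structures.
From mathcomp Require Import all_boot all_order all_algebra.
From mathcomp Require Import all_classical all_reals all_analysis.
From mathcomp Require Import complex.
From mathcomp Require Import measurable_realfun ess_sup_inf.
From mathcomp Require Import lra ring zify.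
Import Order.TTheory GRing.Theory Num.Theory.
Import numFieldNormedType.Exports.
Local Open Scope classical_set_scope.
Local Open Scope ring_scope.

Set Implicit Arguments.
Unset Strict Implicit.
Unset Printing Implicit Defensive.

Local Notation normc := Normc.normc.
Local Notation Re := complex.Re.
Local Notation Im := complex.Im.

(** Why the theorem holds.  Write [am] for the norm of the amalgam space with the
    conjugate exponents [q'] and [p']; these are finite because [1 < q <= p].

    The two dilations are adjoint: since [1/alpha + 1/alpha' = 1], the substitution
    [x -> rho x] moves the dilation of exponent [alpha'] and ratio [rho] from one
    factor of a pairing to the dilation of exponent [alpha] and ratio [1/rho] on the
    other one ([cintegral_dilation]).  Hoelder's inequality inside each unit cube and
    then over the cubes ([amalgam_hoelder]) therefore bounds the pairing of [g] with
    any dilated function of unit norm [am] by the Fofana norm of [g].  Summing over a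
    decomposition of [f], whose series of moduli dominates [|f|] almost everywhere
    ([decomposition_dominated]), makes [f g] integrable and gives
    [|<T_g, f>| <= ||g|| ||f||] ([decomposition_pairing_le]).

    Conversely, a norm of a dilation of [g] can be computed by testing against
    bounded measurable functions of bounded support, called [tame], whose product with
    [g] is tame as well ([amalgam_converse]).  As dilations of functions with [am f <= 1] lie in the unit
    ball of H, the Fofana norm of [g] is at most the norm of [T_g]
    ([fofana_norm_le_dual]), so that [g |-> T_g] is isometric.

    For surjectivity, let [L] be a continuous functional on H and let [w > 0] be a
    weight with [am w] finite ([weight_exists]).  Because [q'] and [p'] are finite,
    dominated convergence holds for [am], and so [A |-> L (w 1_A)] is a finite complex
    measure, absolutely continuous with respect to Lebesgue measure.  By
    Radon-Nikodym it has a density, which divided by [w] yields [g]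
    ([dual_weighted_density]).  Simple functions times [w] extend
    [L f = int f g] to every [f] with [am f] finite and [f g] integrable
    ([dual_represents]).  The boundedness of [L] on dilations and [amalgam_converse]
    then show that [g] is in the Fofana space; the identity passes to all dilated
    amalgam functions by truncation, and to H because these span a dense subspace
    ([dual_ext]).

    Injectivity is the fact that tame functions separate locally integrable ones
    ([tame_separating]). *)

(** * The modulus of a complex number *)

Section modulus.
Context {R : realType}.
Implicit Types (z w : R[i]) (x : R).

Lemma normcE2 z : normc z = Num.sqrt (Re z ^+ 2 + Im z ^+ 2).
Proof. by case: z. Qed.

Lemma normc_ge0 z : 0 <= normc z.
Proof. by rewrite normcE2 sqrtr_ge0. Qed.

Lemma normc_real x : normc x%:C%C = `|x|.
Proof. by rewrite normcE2 /= expr0n addr0 sqrtr_sqr. Qed.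

Lemma normc_re_le z : `|Re z| <= normc z.
Proof. by rewrite normcE2 -sqrtr_sqr ler_sqrt ?addr_ge0 ?sqr_ge0// lerDl sqr_ge0. Qed.

Lemma normc_im_le z : `|Im z| <= normc z.
Proof. by rewrite normcE2 -sqrtr_sqr ler_sqrt ?addr_ge0 ?sqr_ge0// lerDr sqr_ge0. Qed.

Lemma normc_le_sum z : normc z <= `|Re z| + `|Im z|.
Proof.
rewrite normcE2 -(ger0_norm (addr_ge0 (normr_ge0 (Re z)) (normr_ge0 (Im z)))).
rewrite -sqrtr_sqr ler_sqrt ?sqr_ge0// sqrrD !real_normK ?num_real//.
by rewrite -addrA lerD2l lerDr mulrn_wge0// mulr_ge0.
Qed.

Lemma normcD_le z w : normc (z + w) <= normc z + normc w.
Proof. exact: le_normcD. Qed.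

Lemma normcB_le z w : normc (z - w) <= normc z + normc w.
Proof. by rewrite (le_trans (normcD_le _ _))// normcN. Qed.

Lemma normcBC z w : normc (z - w) = normc (w - z).
Proof. by rewrite -normcN opprB. Qed.

Lemma normc_sum_le (I : Type) (r : seq I) (P : pred I) (F : I -> R[i]) :
  normc (\sum_(i <- r | P i) F i) <= \sum_(i <- r | P i) normc (F i).
Proof.
elim/big_ind2 : _ => [|x a y b xa yb|//]; first by rewrite Normc.normc0.
by rewrite (le_trans (normcD_le _ _))// lerD.
Qed.

Lemma ReD z w : Re (z + w) = Re z + Re w. Proof. by case: z w => [? ?] []. Qed.
Lemma ImD z w : Im (z + w) = Im z + Im w. Proof. by case: z w => [? ?] []. Qed.
Lemma Re_sum (I : Type) (l : seq I) (F : I -> R[i]) :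
  Re (\sum_(i <- l) F i) = \sum_(i <- l) Re (F i).
Proof. by elim: l => [|i l IH]; rewrite ?big_nil// !big_cons ReD IH. Qed.
Lemma Im_sum (I : Type) (l : seq I) (F : I -> R[i]) :
  Im (\sum_(i <- l) F i) = \sum_(i <- l) Im (F i).
Proof. by elim: l => [|i l IH]; rewrite ?big_nil// !big_cons ImD IH. Qed.
Lemma ReN z : Re (- z) = - Re z. Proof. by case: z. Qed.
Lemma ImN z : Im (- z) = - Im z. Proof. by case: z. Qed.
Lemma ReM z w : Re (z * w) = Re z * Re w - Im z * Im w.
Proof. by case: z w => [? ?] []. Qed.
Lemma ImM z w : Im (z * w) = Re z * Im w + Im z * Re w.
Proof. by case: z w => [? ?] []. Qed.

Lemma complex_eqP z w : Re z = Re w -> Im z = Im w -> z = w.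
Proof. by case: z w => [a b] [c e] /= -> ->. Qed.

(** The factor that rotates [z] onto the nonnegative axis; at [z = 0] it is [0],
    whence only a bound by [1] for its modulus. *)
Definition phase z : R[i] := ((normc z)^-1)%:C%C * (z^*)%C.

Lemma phaseM z : phase z * z = (normc z)%:C%C.
Proof.
have [h|z0] := eqVneq (normc z) 0; last first.
  rewrite /phase -mulrA; apply: complex_eqP; move: z0; rewrite normcE2;
  case: z => a b /= z0.
    rewrite !mul0r !subr0 mulNr opprK -!expr2 -[X in _ * X]sqr_sqrtr ?addr_ge0 ?sqr_ge0//.
    by rewrite expr2 mulrA mulVf// mul1r.
  by rewrite !mul0r mulNr (mulrC b a) subrr mulr0 add0r.
by rewrite (Normc.eq0_normc h) mulr0 Normc.normc0.
Qed.

Lemma normc_phase_le z : normc (phase z) <= 1.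
Proof.
rewrite /phase Normc.normcM normc_real ger0_norm ?invr_ge0 ?normc_ge0//.
rewrite (_ : normc z^*%C = normc z); last first.
  by case: z => a b; rewrite !normcE2/= sqrrN.
have [->|z0] := eqVneq (normc z) 0; first by rewrite mulr0 ler01.
by rewrite mulVf.
Qed.

End modulus.

(** * Sequences converging to zero *)

Section cvg_zero.
Context {R : realType}.

Lemma cvgr0_near (u : nat -> R) e : u @ \oo --> (0 : R) -> 0 < e ->
  \forall n \near \oo, u n < e.
Proof.
move=> /cvgrPdist_lt h e0; near=> n.
have : `|0 - u n| < e by near: n; exact: h.
by rewrite sub0r normrN; apply: le_lt_trans; exact: ler_norm.
Unshelve. all: by end_near. Qed.

Lemma near_cvgr0 (u : nat -> R) : (forall n, 0 <= u n) ->
  (forall e, 0 < e -> \forall n \near \oo, u n < e) -> u @ \oo --> (0 : R).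
Proof.
move=> u0 h; apply/cvgrPdist_lt => e e0; near=> n.
by rewrite sub0r normrN ger0_norm//; near: n; exact: h.
Unshelve. all: by end_near. Qed.

Lemma cvge0_near (u : nat -> \bar R) e : u @ \oo --> 0%E -> 0 < e ->
  \forall n \near \oo, (u n < e%:E)%E.
Proof.
move=> h e0; have : nbhs (0%E : \bar R) [set x | (x < e%:E)%E].
  by apply: open_nbhs_nbhs; split; [exact: open_ereal_lt_ereal|rewrite /= lte_fin].
by move/h.
Qed.

Lemma near_cvge0 (u : nat -> \bar R) : (forall n, 0 <= u n)%E ->
  (forall e, 0 < e -> \forall n \near \oo, (u n < e%:E)%E) -> u @ \oo --> 0%E.
Proof.
move=> u0 h.
apply/fine_cvgP; split.
  by near=> n; rewrite ge0_fin_numE// (@lt_trans _ _ 1%:E) ?ltry//; near: n; exact: h.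
apply: near_cvgr0 => [n|e e0]; first by rewrite /= fine_ge0.
near=> n => /=.
have un : (u n < e%:E)%E by near: n; exact: h.
by rewrite -lte_fin fineK// ge0_fin_numE// (lt_trans un) ?ltry.
Unshelve. all: by end_near. Qed.

Lemma squeeze_cvge0 (u v : nat -> \bar R) : (forall n, 0 <= u n <= v n)%E ->
  v @ \oo --> 0%E -> u @ \oo --> 0%E.
Proof.
move=> uv v0; apply: near_cvge0 => [n|e e0]; first by case/andP: (uv n).
near=> n; case/andP: (uv n) => _ h; apply: le_lt_trans h _.
by near: n; exact: cvge0_near.
Unshelve. all: by end_near. Qed.

Lemma cvg_EFin0 (u : nat -> R) : u @ \oo --> (0 : R) <->
  (fun n => (u n)%:E) @ \oo --> 0%E.
Proof.
split=> [h|/fine_cvgP[_ //]].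
by apply/fine_cvgP; split => //; exact: nearW.
Qed.

Lemma ge0_dct0 {dT} {T : measurableType dT} (m : {measure set T -> \bar R})
    (D : set T) (u : nat -> T -> \bar R) (G : T -> \bar R) :
  measurable D -> (forall n, measurable_fun D (u n)) -> measurable_fun D G ->
  (forall n x, D x -> 0 <= u n x <= G x)%E ->
  (forall x, D x -> u ^~ x @ \oo --> 0%E) ->
  (\int[m]_(x in D) G x < +oo)%E ->
  (fun n => \int[m]_(x in D) u n x)%E @ \oo --> 0%E.
Proof.
move=> mD mu_ mG uG u0 iG.
have G0 x : D x -> (0 <= G x)%E.
  by move=> Dx; case/andP: (uG 0%N _ Dx); exact: le_trans.
have iG' : m.-integrable D G.
  apply/integrableP; split => //; rewrite (eq_integral G)// => x /[!inE] Dx.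
  by rewrite gee0_abs// G0.
have cu : {ae m, forall x, D x -> u ^~ x @ \oo --> cst 0%E x} by exact: aeW.
have uG' : {ae m, forall x n, D x -> (`|u n x| <= G x)%E}.
  apply: aeW => x n Dx; case/andP: (uG n _ Dx) => ? ?.
  by rewrite gee0_abs.
have [_ _] := dominated_convergence mD mu_ (measurable_cst _) cu iG' uG'.
by rewrite integral0.
Qed.

Lemma cvg_normc_unique (z : nat -> R[i]) (a b : R[i]) :
  (fun n => normc (z n - a)) @ \oo --> (0 : R) ->
  (fun n => normc (z n - b)) @ \oo --> (0 : R) -> a = b.
Proof.
move=> za zb; apply/eqP; rewrite -subr_eq0; apply/eqP/Normc.eq0_normc/eqP.
rewrite eq_le normc_ge0 andbT; apply/ler_addgt0Pr => e e0; rewrite add0r.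
have e2 : 0 < e / 2 by rewrite divr_gt0.
near \oo => N.
rewrite (_ : a - b = (z N - b) - (z N - a)); last by ring.
rewrite (le_trans (normcB_le _ _))// (splitr e) lerD// ltW//.
  by near: N; exact: cvgr0_near.
by near: N; exact: cvgr0_near.
Unshelve. all: by end_near. Qed.

End cvg_zero.

(** * Measurable and integrable complex functions *)

Section complex_integral.
Context {R : realType} {d : nat}.
Local Notation mu := (@lebesgue_rV R d).
Local Notation V := ('rV[R]_d).
Implicit Types (f g : V -> R[i]) (u : V -> R).

Lemma cmeasurable_real u : measurable_fun setT u ->
  cmeasurable (fun x => (u x)%:C%C).
Proof. by move=> mu_; split => //=; exact: measurable_cst. Qed.

Lemma cmeasurable_cst (a : R[i]) : cmeasurable (fun _ : V => a).
Proof. by split; exact: measurable_cst. Qed.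

Lemma cmeasurableD f g : cmeasurable f -> cmeasurable g ->
  cmeasurable (fun x => f x + g x).
Proof.
move=> [f1 f2] [g1 g2]; split.
  by under eq_fun do rewrite ReD; exact: measurable_funD.
by under eq_fun do rewrite ImD; exact: measurable_funD.
Qed.

Lemma cmeasurableM f g : cmeasurable f -> cmeasurable g ->
  cmeasurable (fun x => f x * g x).
Proof.
move=> [f1 f2] [g1 g2]; split.
  by under eq_fun do rewrite ReM; apply: measurable_funB; exact: measurable_funM.
by under eq_fun do rewrite ImM; apply: measurable_funD; exact: measurable_funM.
Qed.

Lemma cmeasurableZ (a : R[i]) f : cmeasurable f -> cmeasurable (fun x => a * f x).
Proof. by apply: cmeasurableM; exact: cmeasurable_cst. Qed.

Lemma cmeasurableB f g : cmeasurable f -> cmeasurable g ->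
  cmeasurable (fun x => f x - g x).
Proof.
move=> mf mg; under eq_fun do rewrite -mulN1r.
exact/cmeasurableD/cmeasurableZ.
Qed.

Lemma cmeasurable_sum (I : Type) (r : seq I) (P : pred I) (F : I -> V -> R[i]) :
  (forall i, cmeasurable (F i)) -> cmeasurable (fun x => \sum_(i <- r | P i) F i x).
Proof.
move=> mF; elim: r => [|i r IH].
  by under eq_fun do rewrite big_nil; exact: cmeasurable_cst.
under eq_fun do rewrite big_cons.
by case: (P i) => //; exact: cmeasurableD.
Qed.

Lemma cmeasurable_comp (phi : V -> V) f : measurable_fun setT phi ->
  cmeasurable f -> cmeasurable (f \o phi).
Proof. move=> mphi [f1 f2]; split.
  exact: (measurableT_comp f1 mphi).
exact: (measurableT_comp f2 mphi). Qed.

Lemma measurable_normc f : cmeasurable f -> measurable_fun setT (fun x => normc (f x)).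
Proof.
move=> [f1 f2]; under eq_fun do rewrite normcE2.
apply: (@measurableT_comp _ _ _ _ _ _ (@Num.sqrt R)).
  by apply: continuous_measurable_fun; exact: sqrt_continuous.
by apply: measurable_funD; exact: measurable_funX.
Qed.

Lemma measurable_normcE f : cmeasurable f ->
  measurable_fun setT (fun x => (normc (f x))%:E).
Proof. by move=> mf; apply/measurable_EFinP; exact: measurable_normc. Qed.

Lemma cmeasurable_phase f : cmeasurable f -> cmeasurable (fun x => phase (f x)).
Proof.
move=> mf; apply: cmeasurableM.
  apply: cmeasurable_real; under eq_fun do rewrite -powR_inv1 ?normc_ge0//.
  exact: measurableT_comp (measurable_powR _) (measurable_normc mf).
have [f1 f2] := mf; split.
  by rewrite (_ : (fun _ => _) = (fun x => Re (f x)))//; apply/funext => x; case: (f x).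
rewrite (_ : (fun _ => _) = (fun x => - Im (f x))); last by apply/funext => x; case: (f x).
exact: measurableT_comp f2.
Qed.

Lemma cmeasurable_indic (A : set V) : measurable A ->
  cmeasurable (fun x => (\1_A x)%:C%C : R[i]).
Proof. by move=> mA; apply: cmeasurable_real; exact: measurable_indic. Qed.

Lemma cintegrableP f : cmeasurable f ->
  (\int[mu]_x (normc (f x))%:E < +oo)%E <-> cintegrable f.
Proof.
move=> mf; have [f1 f2] := mf; split => [h|[/integrableP[_ h1] /integrableP[_ h2]]].
  have hi : mu.-integrable setT (fun x => (normc (f x))%:E).
    apply/integrableP; split; first exact: measurable_normcE.
    by under eq_integral do rewrite gee0_abs ?lee_fin ?normc_ge0//.
  split; apply: (le_integrable measurableT _ _ hi); try exact/measurable_EFinP.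
    by move=> x _; rewrite /= lee_fin (le_trans (normc_re_le _))// ler_norm.
  by move=> x _; rewrite /= lee_fin (le_trans (normc_im_le _))// ler_norm.
apply: (@le_lt_trans _ _ (\int[mu]_x (`|(Re (f x))%:E| + `|(Im (f x))%:E|))%E).
  apply: ge0_le_integral => //.
  - by move=> x _; rewrite lee_fin normc_ge0.
  - exact: measurable_normcE.
  - by apply: emeasurable_funD; apply: measurableT_comp => //; exact/measurable_EFinP.
  - by move=> x _; rewrite /= -EFinD lee_fin normc_le_sum.
rewrite ge0_integralD//; first exact: lte_add_pinfty.
- by apply: measurableT_comp => //; exact/measurable_EFinP.
- by apply: measurableT_comp => //; exact/measurable_EFinP.
Qed.

Lemma cintegrable_le f g : cmeasurable f -> cmeasurable g ->
  (forall x, normc (f x) <= normc (g x)) -> cintegrable g -> cintegrable f.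
Proof.
move=> mf mg fg /(cintegrableP mg) ig; apply/(cintegrableP mf).
apply: le_lt_trans ig; apply: ge0_le_integral => //.
- by move=> x _; rewrite lee_fin normc_ge0.
- exact: measurable_normcE.
- exact: measurable_normcE.
- by move=> x _; rewrite lee_fin.
Qed.

Lemma cintegrable_meas f : cintegrable f -> cmeasurable f.
Proof.
by move=> [/integrableP[/measurable_EFinP f1 _] /integrableP[/measurable_EFinP f2 _]].
Qed.

Lemma cintegrableD f g : cintegrable f -> cintegrable g ->
  cintegrable (fun x => f x + g x).
Proof.
move=> [f1 f2] [g1 g2]; split.
  under eq_fun do rewrite ReD EFinD; exact: integrableD.
by under eq_fun do rewrite ImD EFinD; exact: integrableD.
Qed.

Lemma cintegrableZ (a : R[i]) f : cintegrable f -> cintegrable (fun x => a * f x).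
Proof.
move=> [f1 f2]; split.
  under eq_fun do rewrite ReM EFinB !EFinM; apply: integrableB => //; exact: integrableZl.
by under eq_fun do rewrite ImM EFinD !EFinM; apply: integrableD => //; exact: integrableZl.
Qed.

Lemma cintegralD f g : cintegrable f -> cintegrable g ->
  cintegral (fun x => f x + g x) = cintegral f + cintegral g.
Proof.
move=> [f1 f2] [g1 g2]; apply: complex_eqP; rewrite ?ReD ?ImD /=.
  by under eq_Rintegral do rewrite ReD; exact: RintegralD.
by under eq_Rintegral do rewrite ImD; exact: RintegralD.
Qed.

Lemma cintegralZ (a : R[i]) f : cintegrable f ->
  cintegral (fun x => a * f x) = a * cintegral f.
Proof.
move=> [f1 f2]; apply: complex_eqP; rewrite ?ReM ?ImM /=.
  under eq_Rintegral do rewrite ReM.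
  have Rf b := integrableZl measurableT b f1.
  have If b := integrableZl measurableT b f2.
  rewrite RintegralB//; [by rewrite !RintegralZl|exact: Rf|exact: If].
have Rf b := integrableZl measurableT b f1.
have If b := integrableZl measurableT b f2.
under eq_Rintegral do rewrite ImM.
rewrite RintegralD//; [by rewrite !RintegralZl|exact: If|exact: Rf].
Qed.

Lemma cintegralB f g : cintegrable f -> cintegrable g ->
  cintegral (fun x => f x - g x) = cintegral f - cintegral g.
Proof.
move=> if_ ig; under [in LHS]eq_fun do rewrite -mulN1r.
by rewrite cintegralD//; [rewrite cintegralZ// mulN1r|exact: cintegrableZ].
Qed.

Lemma cintegrableB f g : cintegrable f -> cintegrable g ->
  cintegrable (fun x => f x - g x).
Proof.
move=> if_ ig; under eq_fun do rewrite -mulN1r.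
exact/cintegrableD/cintegrableZ.
Qed.

Lemma cintegrable0 : cintegrable (fun _ : V => 0 : R[i]).
Proof. by split; rewrite /=; exact: integrable0. Qed.

Lemma cintegral0 : cintegral (fun _ : V => 0) = 0 :> R[i].
Proof. by rewrite /cintegral /Rintegral /= !integral0. Qed.

Lemma cintegrable_sum (I : Type) (l : seq I) (F : I -> V -> R[i]) :
  (forall i, cintegrable (F i)) -> cintegrable (fun x => \sum_(i <- l) F i x).
Proof.
move=> iF; elim: l => [|i l IH].
  by under eq_fun do rewrite big_nil; exact: cintegrable0.
by under eq_fun do rewrite big_cons; exact: cintegrableD.
Qed.

Lemma cintegral_sum (I : Type) (l : seq I) (F : I -> V -> R[i]) :
  (forall i, cintegrable (F i)) ->
  cintegral (fun x => \sum_(i <- l) F i x) = \sum_(i <- l) cintegral (F i).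
Proof.
move=> iF; elim: l => [|i l IH].
  by under eq_fun do rewrite big_nil; rewrite big_nil cintegral0.
under eq_fun do rewrite big_cons.
by rewrite big_cons cintegralD// ?IH//; exact: cintegrable_sum.
Qed.

Lemma cintegral_ae_eq f g : cmeasurable f -> cmeasurable g ->
  f = g %[ae mu] -> cintegral f = cintegral g.
Proof.
move=> [f1 f2] [g1 g2] fg; rewrite /cintegral /Rintegral.
congr (fine _ +i* fine _)%C; apply: ae_eq_integral => //;
  try exact/measurable_EFinP; by apply: filterS fg => x /(_ I) ->.
Qed.

(** Rotating the integral onto the positive axis replaces the modulus by a real
    part, for which the inequality is monotonicity. *)
Lemma normc_cintegral_le f : cintegrable f ->
  ((normc (cintegral f))%:E <= \int[mu]_x (normc (f x))%:E)%E.
Proof.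
move=> if_; have mf := cintegrable_meas if_.
set z := cintegral f; set a := phase z.
have ia : cintegrable (fun x => a * f x) by exact: cintegrableZ.
have ca : cintegral (fun x => a * f x) = (normc z)%:C%C by rewrite cintegralZ// phaseM.
have -> : normc z = Rintegral mu setT (fun x => Re (a * f x)).
  by move/(congr1 (@complex.Re R)): ca => /=.
rewrite /Rintegral fineK; last by case: ia => ia _; exact: integrable_fin_num.
apply: (le_trans (lee_abs _)) => /=.
apply: (le_trans (le_abse_integral _ _ _)) => //; first by case: (cintegrable_meas ia) => /measurable_EFinP.
apply: ge0_le_integral => //.
- by case: (cintegrable_meas ia) => h _; apply: measurableT_comp => //; exact/measurable_EFinP.
- exact: measurable_normcE.
- move=> x _; rewrite lee_fin (le_trans (normc_re_le _))// Normc.normcM.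
  by rewrite ler_piMl ?normc_ge0// normc_phase_le.
Qed.

(** Limits of complex functions are expressed through the modulus of the
    difference, so that only convergence of real sequences is needed. *)
Lemma cintegral_dct (F : nat -> V -> R[i]) f g :
  (forall n, cmeasurable (F n)) -> cmeasurable f -> cintegrable g ->
  (forall x, (fun n => normc (F n x - f x)) @ \oo --> (0 : R)) ->
  (forall n x, normc (F n x) <= normc (g x)) ->
  (fun n => normc (cintegral (F n) - cintegral f)) @ \oo --> (0 : R).
Proof.
move=> mF mf ig cF leF; have mg := cintegrable_meas ig.
have lef x : normc (f x) <= normc (g x).
  apply/ler_addgt0Pr => e e0.
  have [N _ /(_ N (leqnn N))/= FN] := cvgr0_near (cF x) e0.
  rewrite (_ : f x = F N x - (F N x - f x)); last by rewrite opprB addrC subrK.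
  by rewrite (le_trans (normcB_le _ _))// lerD// ltW.
have if_ : cintegrable f by exact: cintegrable_le ig.
have iF n : cintegrable (F n) by exact: cintegrable_le (mF n) mg _ ig.
have h : (\int[mu]_x (normc (F n x - f x))%:E)%E @[n --> \oo] --> 0%E.
  apply: (@ge0_dct0 _ _ _ _ _ _ (fun x => (2%:E * (normc (g x))%:E)%E)) => //.
  - by move=> n; exact: (measurable_normcE (cmeasurableB (mF n) mf)).
  - by apply: emeasurable_funM => //; exact: measurable_normcE.
  - move=> n x _; rewrite lee_fin normc_ge0/= -EFinM lee_fin.
    by rewrite (le_trans (normcB_le _ _))// mulr_natl mulr2n lerD.
  - by move=> x _; exact/cvg_EFin0.
  - rewrite ge0_integralZl//.
    + by rewrite lte_mul_pinfty//; exact/cintegrableP.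
    + exact: measurable_normcE.
    + by move=> x _; rewrite lee_fin normc_ge0.
apply/cvg_EFin0; apply: squeeze_cvge0 h => n.
rewrite lee_fin normc_ge0/=.
have := normc_cintegral_le (cintegrableB (iF n) if_).
by rewrite (cintegralB (iF n) if_).
Qed.

End complex_integral.

(** * Dilations *)

Section dilation_measure.
Context {R : realType}.
Local Open Scope ereal_scope.

Lemma measurable_scale_rV d (r : R) :
  measurable_fun [set: 'rV[R]_d] (fun x : 'rV[R]_d => (r *: x)%R).
Proof.
apply: measurable_fun_rVP => i; under eq_fun do rewrite mxE.
by apply: measurable_funM => //; exact: measurable_rV_coord.
Qed.

Definition scale1 (r : R) : measurableTypeR R -> measurableTypeR R := fun x => (r * x)%R.

Lemma measurable_scale1 (r : R) : measurable_fun setT (scale1 r).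
Proof. exact: measurable_funM. Qed.

(** Both sides are measures which agree on half-open intervals. *)
Lemma lebesgue_scale1 (r : R) (A : set (measurableTypeR R)) : (0 < r)%R ->
  measurable A ->
  lebesgue_measure A = r%:E * lebesgue_measure (scale1 r @^-1` A).
Proof.
move=> r0 mA.
pose m0 := measure_function_pushforward__canonical__measure_function_Measure
  (@lebesgue_measure R) (measurable_scale1 r).
pose m1 := mscale (NngNum (ltW r0)) m0.
rewrite -[RHS]/(m1 A); apply: (@lebesgue_measure_unique _ m1) => // X [[a b] _ <-].
rewrite -[RHS]/(r%:E * lebesgue_measure (scale1 r @^-1` `]a, b]%classic)).
rewrite (_ : scale1 r @^-1` _ = `](r^-1 * a)%R, (r^-1 * b)%R]%classic); last first.
  apply/seteqP; split => x; rewrite /scale1 /= !in_itv /=.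
    by rewrite ler_pdivlMl// ltr_pdivrMl.
  by rewrite ler_pdivlMl// ltr_pdivrMl.
rewrite !lebesgue_measure_itv /= !lte_fin ltr_pM2l ?invr_gt0//.
case: ifPn => _; last by rewrite mule0.
by rewrite -!EFinD -EFinM -mulrBr mulrA mulfV ?gt_eqF// mul1r.
Qed.

Lemma ge0_integral_scale1 (r : R) (u : measurableTypeR R -> \bar R) : (0 < r)%R ->
  measurable_fun setT u -> (forall x, 0 <= u x) ->
  \int[lebesgue_measure]_x u x = r%:E * \int[lebesgue_measure]_x u (scale1 r x).
Proof.
move=> r0 mu_ u0.
pose m0 := measure_function_pushforward__canonical__measure_function_Measure
  (@lebesgue_measure R) (measurable_scale1 r).
pose m1 := mscale (NngNum (ltW r0)) m0.
rewrite (@eq_measure_integral _ _ _ _ m1); last first.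
  by move=> A mA _; exact: lebesgue_scale1.
rewrite ge0_integral_mscale// /m0 /= ge0_integral_pushforward//.
exact: measurable_scale1.
Qed.

(** Lebesgue measure on vectors is an iterated product, so the one-dimensional case
    is applied to the first coordinate and the induction hypothesis to each
    section. *)
Lemma lebesgue_rV_scale d (r : R) (A : set 'rV[R]_d) : (0 < r)%R ->
  measurable A ->
  lebesgue_rV d A = (r ^+ d)%:E * lebesgue_rV d ((fun x => (r *: x)%R) @^-1` A).
Proof.
move=> r0; elim: d A => [|n IH] A mA.
  rewrite expr0 mul1e (_ : _ @^-1` _ = A)//.
  by apply/seteqP; split => x /=; rewrite (_ : (r *: x)%R = x)//;
    apply/rowP => -[].
rewrite /= /lebesgue_rV_step /pushforward /product_measure1.
set B := cons_rV (n:=n) @^-1` A.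
have mB : measurable B by rewrite -[X in measurable X]setTI; exact: measurable_cons_rV.
rewrite (@ge0_integral_scale1 r)//; last exact: measurable_fun_xsection.
rewrite exprS EFinM -muleA; congr (_ * _).
rewrite -ge0_integralZl//; last 2 first.
  - apply: measurable_fun_xsection.
    rewrite -[X in measurable X]setTI; apply: measurable_cons_rV => //.
    by rewrite -[X in measurable X]setTI; exact: measurable_scale_rV.
  - by rewrite lee_fin exprn_ge0// ltW.
apply: eq_integral => x _ /=; rewrite (IH (xsection B _)); last exact: measurable_xsection.
have E y : cons_rV (scale1 r x, (r *: y)%R) = (r *: cons_rV (x, y))%R.
  by apply/rowP => i; rewrite [RHS]mxE; case: (unliftP ord0 i) => [j|] ->;
    rewrite ?cons_rVS ?cons_rV0 /= ?mxE.
by congr (_ * lebesgue_rV n _); apply/seteqP; split => y;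
  rewrite /xsection /= !inE /B /= E.
Qed.

End dilation_measure.

Section dilation_integral.
Context {R : realType} {d : nat}.
Local Notation mu := (@lebesgue_rV R d).
Local Notation V := ('rV[R]_d).
Implicit Types (f g : V -> R[i]) (u : V -> \bar R).

Lemma ge0_integral_scale (r : R) u : 0 < r ->
  measurable_fun setT u -> (forall x, 0 <= u x)%E ->
  (\int[mu]_x u x = (r ^+ d)%:E * \int[mu]_x u (r *: x)%R)%E.
Proof.
move=> r0 mu_ u0.
pose m0 := measure_function_pushforward__canonical__measure_function_Measure
  mu (@measurable_scale_rV R d r).
have rd0 : 0 <= r ^+ d by rewrite exprn_ge0// ltW.
pose m1 := mscale (NngNum rd0) m0.
rewrite (@eq_measure_integral _ _ _ _ m1); last first.
  by move=> A mA _; exact: lebesgue_rV_scale.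
rewrite ge0_integral_mscale// /m0 /= ge0_integral_pushforward//.
exact: measurable_scale_rV.
Qed.

Lemma cmeasurable_scale (r : R) f : cmeasurable f -> cmeasurable (fun x => f (r *: x)).
Proof. by move=> mf; exact: (cmeasurable_comp (measurable_scale_rV r) mf). Qed.

Lemma cintegrable_scale (r : R) f : 0 < r -> cintegrable f ->
  cintegrable (fun x => f (r *: x)).
Proof.
move=> r0 if_; have mf := cintegrable_meas if_.
apply/cintegrableP; first exact: cmeasurable_scale.
move/(cintegrableP mf) : if_; rewrite (@ge0_integral_scale r)//.
- move=> h; rewrite ltey; apply/eqP => E; move: h.
  by rewrite E gt0_muley ?ltxx// lte_fin exprn_gt0.
- exact: measurable_normcE.
- by move=> x; rewrite lee_fin normc_ge0.
Qed.

(** The integral of a signed function is the difference of those of its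
    positive and negative parts, and both parts commute with scaling. *)
Lemma cintegral_scale (r : R) f : 0 < r -> cintegrable f ->
  cintegral f = (r ^+ d)%:C%C * cintegral (fun x => f (r *: x)).
Proof.
move=> r0 if_; have rd0 : 0 <= r ^+ d by rewrite exprn_ge0// ltW.
have [is1 is2] := cintegrable_scale r0 if_; have [i1 i2] := if_.
suff key (u : V -> R) : mu.-integrable setT (EFin \o u) ->
    mu.-integrable setT (EFin \o (fun x => u (r *: x))) ->
    Rintegral mu setT u = r ^+ d * Rintegral mu setT (fun x => u (r *: x)).
  apply: complex_eqP; rewrite ?ReM ?ImM /= mul0r ?subr0 ?addr0; exact: key.
move=> iu isu; have /measurable_int/measurable_EFinP mu_ := iu.
suff E : (\int[mu]_x (u x)%:E = (r ^+ d)%:E * \int[mu]_x (u (r *: x))%:E)%E.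
  rewrite /Rintegral E fineM//; exact: integrable_fin_num.
have muE : measurable_fun setT (fun x => (u x)%:E) by exact/measurable_EFinP.
rewrite [LHS]integralE [in RHS]integralE.
rewrite (@ge0_integral_scale r (fun x => (u x)%:E)^\+%E)//; last exact: measurable_funepos.
rewrite (@ge0_integral_scale r (fun x => (u x)%:E)^\-%E)//; last exact: measurable_funeneg.
have P : (\int[mu]_x (fun x => (u x)%:E)^\+ (r *: x) =
    \int[mu]_x (fun x => (u (r *: x))%:E)^\+ x)%E.
  by apply: eq_integral => x _;
    exact/esym/(congr1 (@^~ x) (funepos_comp (fun x => (u x)%:E) (fun x => r *: x))).
have N : (\int[mu]_x (fun x => (u x)%:E)^\- (r *: x) =
    \int[mu]_x (fun x => (u (r *: x))%:E)^\- x)%E.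
  by apply: eq_integral => x _;
    exact/esym/(congr1 (@^~ x) (funeneg_comp (fun x => (u x)%:E) (fun x => r *: x))).
have fP := integrable_fin_num measurableT (integrable_funepos measurableT isu).
have mulB (a b : \bar R) : a \is a fin_num ->
    ((r ^+ d)%:E * a - (r ^+ d)%:E * b = (r ^+ d)%:E * (a - b))%E.
  by move=> afin; rewrite muleBr// fin_num_adde_defr.
by rewrite P N; exact: mulB.
Qed.

Lemma cmeasurable_dilation (a : \bar R) (rho : R) f : cmeasurable f ->
  cmeasurable (dilation a rho f).
Proof. by move=> mf; apply/cmeasurableZ/cmeasurable_scale. Qed.

Lemma normc_dilation (a : \bar R) (rho : R) f x :
  normc (dilation a rho f x) =
  rho `^ (- (d%:R * fine a^-1%E)) * normc (f (rho^-1 *: x)).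
Proof. by rewrite /dilation Normc.normcM normc_real ger0_norm ?powR_ge0. Qed.

(** Moving a dilation across the pairing turns [a'] into [a] and [rho] into its
    inverse: the Jacobian [rho ^ d] absorbs the sum of the two exponents. *)
Lemma dilationK_mul (a a' : \bar R) (rho : R) f g x : 0 < rho ->
  fine a^-1%E + fine a'^-1%E = 1 ->
  (rho ^+ d)%:C%C * (dilation a' rho f (rho *: x) * g (rho *: x)) =
  f x * dilation a rho^-1 g x.
Proof.
move=> r0 aa'; rewrite /dilation invrK scalerA mulVf ?gt_eqF// scale1r.
set u := _ `^ _; set v := _ `^ _; suff <- : rho ^+ d * u = v.
  by rewrite rmorphM/=; ring.
rewrite /u /v.
rewrite -powR_mulrn ?ltW// -powRD; last by rewrite (gt_eqF r0) implybT.
rewrite -powR_inv1 ?ltW// -powRrM; congr (_ `^ _).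
rewrite (_ : fine a'^-1%E = 1 - fine a^-1%E); first by ring.
by rewrite -aa' addrAC subrr add0r.
Qed.

Lemma cintegrable_dilation (a a' : \bar R) (rho : R) f g : 0 < rho ->
  fine a^-1%E + fine a'^-1%E = 1 ->
  cintegrable (fun x => f x * dilation a rho^-1 g x) ->
  cintegrable (fun x => dilation a' rho f x * g x).
Proof.
move=> r0 aa' h.
have ri0 : 0 < rho^-1 by rewrite invr_gt0.
have := cintegrableZ ((rho ^- d)%:C%C) (cintegrable_scale ri0 h).
congr cintegrable; apply/funext => x.
rewrite -(dilationK_mul _ _ _ r0 aa') scalerA mulfV ?gt_eqF// scale1r mulrA.
by rewrite -rmorphM/= mulVf ?mul1r// expf_neq0// gt_eqF.
Qed.

Lemma cintegral_dilation (a a' : \bar R) (rho : R) f g : 0 < rho ->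
  fine a^-1%E + fine a'^-1%E = 1 ->
  cintegrable (fun x => f x * dilation a rho^-1 g x) ->
  cintegral (fun x => dilation a' rho f x * g x) =
  cintegral (fun x => f x * dilation a rho^-1 g x).
Proof.
move=> r0 aa' h; rewrite (cintegral_scale r0 (cintegrable_dilation r0 aa' h)).
rewrite -cintegralZ; last exact: cintegrable_scale r0 (cintegrable_dilation r0 aa' h).
by congr cintegral; apply/funext => x; exact: dilationK_mul.
Qed.

Lemma integral_normc_dilation (a a' : \bar R) (rho : R) f g : 0 < rho ->
  fine a^-1%E + fine a'^-1%E = 1 -> cmeasurable f -> cmeasurable g ->
  (\int[mu]_x (normc (dilation a' rho f x * g x))%:E =
   \int[mu]_x (normc (f x * dilation a rho^-1 g x))%:E)%E.
Proof.
move=> r0 aa' mf mg.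
have m1 := cmeasurableM (cmeasurable_dilation a' rho mf) mg.
rewrite (ge0_integral_scale r0 (measurable_normcE m1)); last first.
  by move=> x; rewrite lee_fin normc_ge0.
rewrite -ge0_integralZl//.
- apply: eq_integral => x _; rewrite -(dilationK_mul _ _ _ r0 aa') [in RHS]Normc.normcM.
  by rewrite normc_real ger0_norm// exprn_ge0// ltW.
- exact: (measurable_normcE (cmeasurable_scale rho m1)).
- by move=> x _; rewrite lee_fin normc_ge0.
- by rewrite lee_fin exprn_ge0// ltW.
Qed.

End dilation_integral.

(** * Sums over a countable index set as integrals *)

Section countable_sums.
Context {R : realType} {I : countType}.
Implicit Types (a b : I -> \bar R).
Local Open Scope ereal_scope.

(** Reading a family through [pickle_inv] turns an unordered sum into an integral
    for the counting measure of [nat], where the convergence theorems and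
    Hoelder's inequality are available. *)
Definition pickled a (n : nat) : \bar R := oapp a 0 (@pickle_inv I n).

Lemma pickled_ge0 a : (forall k, 0 <= a k) -> forall n, 0 <= pickled a n.
Proof. by move=> a0 n; rewrite /pickled; case: pickle_inv => /=. Qed.

Lemma esum_pickled a : (forall k, 0 <= a k) ->
  \esum_(k in [set: I]) a k = \sum_(0 <= n <oo) pickled a n.
Proof.
move=> a0; have -> : [set: I] = \bigcup_n [set k : I | pickle k = n].
  by apply/esym; rewrite -subTset => k _; exists (pickle k).
rewrite nneseries_sum_bigcup//; last first.
  by apply/trivIsetP => i j _ _ ij; rewrite -subset0 => k [/= -> /eqP]; rewrite (negbTE ij).
apply: eq_eseriesr => n _; rewrite /pickled.
case E : (@pickle_inv I n) => [k|] /=.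
  rewrite (_ : [set _ | _] = [set k]) ?esum_set1//.
  apply/seteqP; split => [l /= ln|l ->]; last by have := @pickle_invK I n; rewrite E.
  by have := @pickleK_inv I l; rewrite ln E => -[].
rewrite (_ : [set _ | _] = set0) ?esum_set0// -subset0 => k /= kn.
by have := @pickleK_inv I k; rewrite kn E.
Qed.

Lemma esum_counting a : (forall k, 0 <= a k) ->
  \esum_(k in [set: I]) a k = \int[counting]_n pickled a n.
Proof.
by move=> a0; rewrite esum_pickled// ge0_integral_count//; exact: pickled_ge0.
Qed.

Lemma esum_dct0 (u : nat -> I -> \bar R) a :
  (forall n k, 0 <= u n k <= a k) -> (forall k, u ^~ k @ \oo --> 0) ->
  \esum_(k in [set: I]) a k < +oo ->
  (fun n => \esum_(k in [set: I]) u n k) @ \oo --> 0.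
Proof.
move=> ua u0 sa.
have a0 k : 0 <= a k by case/andP: (ua 0%N k); exact: le_trans.
have uge0 n k : 0 <= u n k by case/andP: (ua n k).
under eq_fun do rewrite esum_counting//.
apply: (@ge0_dct0 _ _ _ _ _ _ (pickled a)) => //.
- by move=> n k _; rewrite /pickled; case: pickle_inv => //=; rewrite lexx.
- by move=> k _; rewrite /pickled; case: pickle_inv => //=; exact: cvg_cst.
- by rewrite -esum_counting.
Qed.

Lemma esum_ge1 a k : (forall l, 0 <= a l) -> a k <= \esum_(l in [set: I]) a l.
Proof.
by move=> a0; rewrite -[leLHS](esum_set1 (a0 k)); apply: esum_ge; exists [set k] => //;
  rewrite ?esum_set1 ?fsbig_set1.
Qed.

Lemma esumZl (c : R) a : (0 <= c)%R -> (forall k, 0 <= a k) ->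
  \esum_(k in [set: I]) (c%:E * a k) = c%:E * \esum_(k in [set: I]) a k.
Proof.
move=> c0 a0; rewrite !esum_pickled// => [|k]; last exact: mule_ge0.
rewrite -nneseriesZl//; last by move=> n _; exact: pickled_ge0.
by apply: eq_eseriesr => n _; rewrite /pickled; case: pickle_inv => //=; rewrite mule0.
Qed.

Lemma esum_hoelder (r s : R) a b : (0 < r)%R -> (0 < s)%R -> (r^-1 + s^-1 = 1)%R ->
  (forall k, 0 <= a k < +oo) -> (forall k, 0 <= b k < +oo) ->
  \esum_(k in [set: I]) (a k * b k) <=
  (\esum_(k in [set: I]) a k `^ r) `^ r^-1 * (\esum_(k in [set: I]) b k `^ s) `^ s^-1.
Proof.
move=> r0 s0 rs ha hb.
have a0 k : 0 <= a k by case/andP: (ha k).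
have b0 k : 0 <= b k by case/andP: (hb k).
have fa k : (fine (a k))%:E = a k by rewrite fineK// ge0_fin_numE//; case/andP: (ha k).
have fb k : (fine (b k))%:E = b k by rewrite fineK// ge0_fin_numE//; case/andP: (hb k).
pose f n := fine (pickled a n); pose g n := fine (pickled b n).
have mf : measurable_fun setT f by [].
have mg : measurable_fun setT g by [].
have fE n : (f n)%:E = pickled a n.
  by rewrite /f /pickled; case: pickle_inv => //= k; exact: fa.
have gE n : (g n)%:E = pickled b n.
  by rewrite /g /pickled; case: pickle_inv => //= k; exact: fb.
have := hoelder counting mf mg r0 s0 rs.
rewrite !Lnorm_counting//.
have ar0 k : 0 <= a k `^ r by exact: poweR_ge0.
have bs0 k : 0 <= b k `^ s by exact: poweR_ge0.
have ab0 k : 0 <= a k * b k by exact: mule_ge0.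
rewrite (esum_pickled ab0) (esum_pickled ar0) (esum_pickled bs0).
have abs0 (t : R) (c : I -> \bar R) n : (0 < t)%R -> (forall k, 0 <= c k) ->
    `|pickled c n| `^ t = pickled (fun k => c k `^ t) n.
  move=> t0 c0; rewrite /pickled; case: pickle_inv => /= [k|].
    by rewrite gee0_abs.
  by rewrite normr0 powR0// gt_eqF.
have -> : \sum_(0 <= k <oo) `|(EFin \o f) k| `^ r =
    \sum_(0 <= n <oo) pickled (fun k => a k `^ r) n.
  by apply: eq_eseriesr => n _; rewrite -abs0// -fE.
have -> : \sum_(0 <= k <oo) `|(EFin \o g) k| `^ s =
    \sum_(0 <= n <oo) pickled (fun k => b k `^ s) n.
  by apply: eq_eseriesr => n _; rewrite -abs0// -gE.
apply: le_trans; rewrite le_eqVlt; apply/orP; left; apply/eqP.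
rewrite invr1 poweRe1; last first.
  by apply: nneseries_ge0 => n _ _; exact: poweR_ge0.
apply: eq_eseriesr => n _.
rewrite poweRe1 ?abse_ge0// -[(EFin \o _) n]/((f n * g n)%:E) EFinM fE gE gee0_abs ?mule_ge0 ?pickled_ge0//.
by rewrite /pickled; case: pickle_inv => //=; rewrite mule0.
Qed.

End countable_sums.

(** * The unit cubes *)

Section cubes.
Context {R : realType} {d : nat}.
Local Notation mu := (@lebesgue_rV R d).
Local Notation V := ('rV[R]_d).
Local Notation cube := (@unit_cube R d).

Lemma measurable_box (A : 'I_d -> set R) : (forall i, measurable (A i)) ->
  measurable [set x : V | forall i, A i (x ord0 i)].
Proof.
move=> mA; rewrite (_ : [set _ | _] =
    \bigcap_(i in [set: 'I_d]) ((fun x : V => x ord0 i) @^-1` A i)).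
  apply: fin_bigcap_measurable => // i _.
  by rewrite -[X in measurable X]setTI; exact: measurable_rV_coord.
by apply/seteqP; split=> x /= h i => [_|]; exact: h.
Qed.

Lemma cubeE k : cube k =
  [set x | forall i, `[(k ord0 i)%:~R, (k ord0 i)%:~R + 1[%classic (x ord0 i)].
Proof. by apply/seteqP; split => x /= h i; have := h i; rewrite /= in_itv. Qed.

Lemma measurable_cube k : measurable (cube k).
Proof.
rewrite cubeE.
apply: (@measurable_box (fun i => `[(k ord0 i)%:~R, (k ord0 i)%:~R + 1[%classic)) => i.
exact: measurable_itv.
Qed.

#[local] Hint Resolve measurable_cube : core.

Lemma lebesgue_cube k : mu (cube k) = 1%E.
Proof.
rewrite cubeE.
rewrite (@lebesgue_rV_box R d (fun i => `[(k ord0 i)%:~R, (k ord0 i)%:~R + 1[%classic));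
  last by move=> i; exact: measurable_itv.
rewrite big1// => i _; rewrite lebesgue_measure_itv/= lte_fin ltrDl ltr01.
by rewrite -EFinD addrAC subrr add0r.
Qed.

Definition cube_of (x : V) : 'rV[int]_d := \row_i Num.floor (x ord0 i).

Lemma cube_ofP x k : cube k x <-> cube_of x = k.
Proof.
split=> [h|<- i]; last first.
  by rewrite mxE; have := real_floor_itv (num_real (x ord0 i)); rewrite rmorphD.
by apply/rowP => i; rewrite mxE; apply: floor_def; rewrite rmorphD; exact: h.
Qed.

Lemma cube_disjoint k l x : cube k x -> cube l x -> k = l.
Proof. by move=> /cube_ofP <- /cube_ofP. Qed.

(** The cubes are enumerated through [pickle_inv], as countable additivity is
    stated for sequences of sets. *)
Lemma ge0_integral_cubes (u : V -> \bar R) : measurable_fun setT u ->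
  (forall x, 0 <= u x)%E ->
  (\int[mu]_x u x = \esum_(k in [set: 'rV[int]_d]) \int[mu]_(x in cube k) u x)%E.
Proof.
move=> mu_ u0.
pose F n := oapp cube set0 (@pickle_inv 'rV[int]_d n).
have FT : \bigcup_n F n = setT.
  rewrite -subTset => x _; exists (pickle (cube_of x)) => //.
  by rewrite /F pickleK_inv /=; exact/cube_ofP.
have mF n : measurable (F n).
  by rewrite /F; case: pickle_inv => //= k; exact: measurable_cube.
rewrite -FT ge0_integral_bigcup//; last 2 first.
- by apply: measurable_funTS.
- apply/trivIsetP => i j _ _ ij; rewrite -subset0 => x [].
  rewrite /F; case Ei : pickle_inv => [k|//]; case Ej : pickle_inv => [l|//] /=.
  move=> /cube_disjoint h /h kl; move: ij.
  have := @pickle_invK 'rV[int]_d i; rewrite Ei /= => <-.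
  by have := @pickle_invK 'rV[int]_d j; rewrite Ej /= => <-; rewrite kl eqxx.
rewrite esum_pickled; last by move=> k; exact: integral_ge0.
apply: eq_eseriesr => n _; rewrite /F /pickled; case: pickle_inv => //=.
by rewrite integral_set0.
Qed.

End cubes.

(** * Amalgam norms with finite exponents *)

Section poweR_extra.
Context {R : realType}.
Local Open Scope ereal_scope.

Lemma le_poweR (x y : \bar R) (r : R) : (0 <= r)%R -> 0 <= x -> x <= y ->
  x `^ r <= y `^ r.
Proof.
move=> r0 x0 xy; apply: gt0_ler_poweR => //; rewrite in_itv/= leey andbT//.
exact: le_trans xy.
Qed.

Lemma lt_poweR_EFin (x : \bar R) (e r : R) : (0 < r)%R -> (0 < e)%R -> 0 <= x ->
  x < (e `^ r^-1)%:E -> x `^ r < e%:E.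
Proof.
move=> r0 e0 x0 xe; have xfin : x \is a fin_num.
  by rewrite ge0_fin_numE// (lt_trans xe) ?ltry.
move: xe x0; rewrite -(fineK xfin) poweR_EFin !lte_fin lee_fin => xe x0.
rewrite -[ltRHS](powRr1 (ltW e0)) -(mulVf (lt0r_neq0 r0)) powRrM.
by apply: gt0_ltr_powR => //; rewrite nnegrE// powR_ge0.
Qed.

Lemma cvge0_poweR (u : nat -> \bar R) (r : R) : (0 < r)%R -> (forall n, 0 <= u n) ->
  u @ \oo --> 0 -> (fun n => u n `^ r) @ \oo --> 0.
Proof.
move=> r0 u0 cu; apply: near_cvge0 => [n|e e0]; first exact: poweR_ge0.
near=> n; apply: lt_poweR_EFin => //.
by near: n; apply: cvge0_near => //; exact: powR_gt0.
Unshelve. all: by end_near. Qed.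

Lemma poweRK (x : \bar R) (r : R) : (0 < r)%R -> 0 <= x -> (x `^ r) `^ r^-1 = x.
Proof. by move=> r0 x0; rewrite -poweRrM mulfV ?gt_eqF// poweRe1. Qed.

Lemma poweRVK (x : \bar R) (r : R) : (0 < r)%R -> 0 <= x -> (x `^ r^-1) `^ r = x.
Proof. by move=> r0 x0; rewrite -poweRrM mulVf ?gt_eqF// poweRe1. Qed.

End poweR_extra.

Section amalgam_finite.
Context {R : realType} {d : nat}.
Local Notation mu := (@lebesgue_rV R d).
Local Notation V := ('rV[R]_d).
Local Notation cube := (@unit_cube R d).
Implicit Types (f h : V -> R[i]).
Local Open Scope ereal_scope.

Definition cube_int (r : R) f (k : 'rV[int]_d) : \bar R :=
  \int[mu]_(x in cube k) (normc (f x) `^ r)%:E.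

Lemma cube_int_ge0 r f k : 0 <= cube_int r f k.
Proof. by apply: integral_ge0 => x _; rewrite lee_fin powR_ge0. Qed.

Lemma normc_cube f k (x : V) :
  normc (f x * (\1_(cube k) x)%:C%C)%R = (normc (f x) * \1_(cube k) x)%R.
Proof. by rewrite Normc.normcM normc_real ger0_norm. Qed.

Lemma cLnorm_cube (r : R) f k : (0 < r)%R ->
  cLnorm r%:E (fun x => f x * (\1_(cube k) x)%:C%C)%R = cube_int r f k `^ r^-1.
Proof.
move=> r0; rewrite /cLnorm unlock /cube_int [in RHS]integral_mkcond; congr (_ `^ _).
apply: eq_integral => x _.
rewrite patchE normc_cube /= ger0_norm ?mulr_ge0 ?normc_ge0// indicE.
by case: ifPn => xk; rewrite ?mulr1// mulr0 powR0// gt_eqF.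
Qed.

Lemma cLnorm_ge0 (q : \bar R) f : 0 <= cLnorm q f.
Proof. exact: Lnorm_ge0. Qed.

Lemma amalgam_normE (r s : R) f : (0 < r)%R -> (0 < s)%R ->
  amalgam_norm r%:E s%:E f =
  (\esum_(k in [set: 'rV[int]_d]) cube_int r f k `^ (r^-1 * s)) `^ s^-1.
Proof.
move=> r0 s0; rewrite /amalgam_norm /seq_norm; congr (_ `^ _).
by apply: eq_esum => k _; rewrite cLnorm_cube// gee0_abs ?poweR_ge0// poweRrM.
Qed.

Lemma measurable_normc_powR (r : R) f : cmeasurable f ->
  measurable_fun setT (fun x => (normc (f x) `^ r)%:E).
Proof.
move=> mf; apply/measurable_EFinP.
exact: measurableT_comp (measurable_powR _) (measurable_normc mf).
Qed.

Lemma le_cube_int (r : R) f h (c : R) k : (0 < r)%R -> (0 <= c)%R ->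
  cmeasurable f -> cmeasurable h ->
  (forall x, normc (f x) <= c * normc (h x))%R ->
  cube_int r f k <= (c `^ r)%:E * cube_int r h k.
Proof.
move=> r0 c0 mf mh fh.
rewrite /cube_int -ge0_integralZl//; last first.
- by rewrite lee_fin powR_ge0.
- by move=> x _; rewrite lee_fin powR_ge0.
- by apply: measurable_funTS; exact: measurable_normc_powR.
  exact: measurable_cube.
apply: ge0_le_integral; first exact: measurable_cube.
- by move=> x _; rewrite lee_fin powR_ge0.
- by apply: measurable_funTS; exact: measurable_normc_powR.
- by apply: emeasurable_funM => //; apply: measurable_funTS; exact: measurable_normc_powR.
move=> x _; rewrite -EFinM lee_fin -powRM ?normc_ge0//.
by apply: ge0_ler_powR; rewrite ?nnegrE ?normc_ge0 ?mulr_ge0 ?normc_ge0// ltW.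
Qed.

Lemma le_amalgam_norm (r s : R) f h (c : R) : (0 < r)%R -> (0 < s)%R -> (0 <= c)%R ->
  cmeasurable f -> cmeasurable h ->
  (forall x, normc (f x) <= c * normc (h x))%R ->
  amalgam_norm r%:E s%:E f <= c%:E * amalgam_norm r%:E s%:E h.
Proof.
move=> r0 s0 c0 mf mh fh; rewrite !amalgam_normE//.
have cs0 : (0 <= c `^ s)%R by exact: powR_ge0.
have t0 : (0 <= r^-1 * s)%R by rewrite mulr_ge0 ?invr_ge0// ltW.
have kE k : cube_int r f k `^ (r^-1 * s) <= (c `^ s)%:E * cube_int r h k `^ (r^-1 * s).
  apply: (le_trans (le_poweR t0 (cube_int_ge0 _ _ _) (le_cube_int k r0 c0 mf mh fh))).
  rewrite poweRM ?lee_fin ?powR_ge0 ?cube_int_ge0// poweR_EFin -powRrM.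
  by rewrite mulrA mulfV ?gt_eqF// mul1r.
have s'0 : (0 <= s^-1)%R by rewrite invr_ge0 ltW.
apply: (@le_trans _ _ ((\esum_(k in [set: 'rV[int]_d])
    ((c `^ s)%:E * cube_int r h k `^ (r^-1 * s))) `^ s^-1)).
  apply: le_poweR => //.
    by apply: esum_ge0 => k _; exact: poweR_ge0.
  by apply: le_esum => k _.
rewrite esumZl//; last by move=> k; exact: poweR_ge0.
rewrite poweRM//; last by apply: esum_ge0 => k _; exact: poweR_ge0.
by rewrite -poweR_EFin poweRK// lexx.
Qed.

Lemma amalgam_norm_ge0 (q p : \bar R) f : 0 <= amalgam_norm q p f.
Proof.
rewrite /amalgam_norm /seq_norm; case: p => [s||//]; first exact: poweR_ge0.
apply: le_trans (abse_ge0 (cLnorm q (fun x => f x * (\1_(cube 0%R) x)%:C%C)%R)) _.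
by apply: ereal_sup_ubound; exists 0%R.
Qed.

(** Dominated convergence in the amalgam space: it is applied first inside each
    cube and then to the sum over the cubes, which is possible because both
    exponents are finite. *)
Lemma amalgam_dct (r s : R) (F : nat -> V -> R[i]) h : (0 < r)%R -> (0 < s)%R ->
  (forall n, cmeasurable (F n)) -> cmeasurable h ->
  (forall n x, normc (F n x) <= normc (h x))%R ->
  (forall x, (fun n => normc (F n x)) @ \oo --> (0 : R)%R) ->
  amalgam_norm r%:E s%:E h < +oo ->
  (fun n => amalgam_norm r%:E s%:E (F n)) @ \oo --> 0.
Proof.
move=> r0 s0 mF mh Fh F0 hoo.
have t0 : (0 < r^-1 * s)%R by rewrite mulr_gt0 ?invr_gt0.
have soo : \esum_(k in [set: 'rV[int]_d]) cube_int r h k `^ (r^-1 * s) < +oo.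
  by move: hoo; rewrite amalgam_normE//; apply: lty_poweRy; rewrite invr_neq0// gt_eqF.
have koo k : cube_int r h k < +oo.
  apply: (@lty_poweRy _ _ (r^-1 * s)); first by rewrite gt_eqF.
  apply: le_lt_trans soo; apply: (esum_ge1 (a := fun k => cube_int r h k `^ (r^-1 * s))).
  by move=> l; exact: poweR_ge0.
under eq_fun do rewrite amalgam_normE//.
apply: cvge0_poweR; first by rewrite invr_gt0.
  by move=> n; apply: esum_ge0 => k _; exact: poweR_ge0.
apply: esum_dct0 soo => [n k|k].
  rewrite poweR_ge0/=; apply: le_poweR; rewrite ?cube_int_ge0 ?(ltW t0)//.
  have := @le_cube_int r (F n) h 1%R k r0 ler01 (mF n) mh.
  by rewrite powR1 mul1e; apply => x; rewrite mul1r.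
apply: cvge0_poweR => // [n|]; first exact: cube_int_ge0.
apply: (@ge0_dct0 _ _ _ _ _ _ (fun x => (normc (h x) `^ r)%:E)) => //.
- exact: measurable_cube.
- by move=> n; apply: measurable_funTS; exact: measurable_normc_powR.
- by apply: measurable_funTS; exact: measurable_normc_powR.
- move=> n x _; rewrite !lee_fin powR_ge0/=.
  by apply: ge0_ler_powR; rewrite ?nnegrE ?normc_ge0 ?mulr_ge0 ?normc_ge0// ltW.
- move=> x _.
  have := @cvge0_poweR _ (fun n => (normc (F n x))%:E) r r0.
  by apply => [n|]; [rewrite lee_fin normc_ge0|exact/cvg_EFin0].
- exact: koo.
Qed.

End amalgam_finite.

(** * Hoelder's inequality for amalgam norms *)

Section conjugate_exponents.
Context {R : realType}.
Local Open Scope ereal_scope.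

(** The pairs formed by an exponent [q > 1], possibly infinite, and its conjugate.
    The conjugate is a real number: on the side of the predual both exponents are
    finite, which is what makes dominated convergence available there. *)
Variant conj_exp : \bar R -> R -> Prop :=
  | conj_exp_fin t r of (1 < t)%R & (1 < r)%R & (r^-1 + t^-1 = 1)%R :
      conj_exp t%:E r
  | conj_exp_infty : conj_exp +oo 1%R.

Lemma conj_expP (q : \bar R) : 1 < q ->
  exists2 r : R, hoelder_conjugate q = r%:E & conj_exp q r.
Proof.
case: q => [t||//]; last by move=> _; exists 1%R => //; exact: conj_exp_infty.
rewrite lte_fin => t1; have t0 : (0 < t)%R by exact: lt_trans t1.
exists (t / (t - 1))%R.
  rewrite /hoelder_conjugate /= eqe gt_eqF// -EFinD inver subr_eq0 gt_eqF//.
have t10 : (0 < t - 1)%R by rewrite subr_gt0.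
apply: conj_exp_fin => //.
  by rewrite ltr_pdivlMr// mul1r gtrBl.
by rewrite invf_div -[X in (_ + X = _)%R]mul1r -mulrDl subrK mulfV ?gt_eqF.
Qed.

Lemma conj_exp_ge1 (q : \bar R) r : conj_exp q r -> (1 <= r)%R.
Proof. by case=> // ? ? _ /ltW. Qed.

Lemma conj_exp_gt0 (q : \bar R) r : conj_exp q r -> (0 < r)%R.
Proof. by move=> /conj_exp_ge1; exact: lt_le_trans. Qed.

End conjugate_exponents.

Section sequence_hoelder.
Context {R : realType} {I : countType}.
Implicit Types a b : I -> \bar R.
Local Open Scope ereal_scope.

Lemma seq_norm_finE (s : R) a : (forall k, 0 <= a k) ->
  seq_norm s%:E a = (\esum_(k in [set: I]) a k `^ s) `^ s^-1.
Proof.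
by move=> a0; rewrite /seq_norm; congr (_ `^ _); apply: eq_esum => k _; rewrite gee0_abs.
Qed.

Lemma seq_norm_ge (p : \bar R) a k : 0 < p -> (forall k, 0 <= a k) ->
  a k <= seq_norm p a.
Proof.
case: p => [s| |//] p0 a0; last first.
  by rewrite /seq_norm; apply: ereal_sup_ubound; exists k => //; rewrite gee0_abs.
rewrite seq_norm_finE// -[leLHS](poweRK (r := s))//.
apply: le_poweR; first by rewrite invr_ge0 ltW.
  exact: poweR_ge0.
by apply: (esum_ge1 (a := fun k => a k `^ s)) => l; exact: poweR_ge0.
Qed.

(** The index [k0] excludes the empty family, whose supremum is [-oo]. *)
Lemma seq_norm_hoelder (k0 : I) (p : \bar R) (s : R) a b : conj_exp p s ->
  (forall k, 0 <= a k) -> (forall k, 0 <= b k) ->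
  seq_norm s%:E a < +oo -> seq_norm p b < +oo ->
  \esum_(k in [set: I]) (a k * b k) <= seq_norm s%:E a * seq_norm p b.
Proof.
move=> ps a0 b0 aoo boo; have s0 := conj_exp_gt0 ps.
have p0 : 0 < p by case: ps => // t r t1 _ _; rewrite lte_fin (lt_trans _ t1).
have ha k : 0 <= a k < +oo by rewrite a0 (le_lt_trans (seq_norm_ge k _ a0) aoo).
have hb k : 0 <= b k < +oo by rewrite b0 (le_lt_trans (seq_norm_ge k _ b0) boo).
case: ps s0 p0 aoo boo hb => [t r t1 r1 rt|] r0 p0 aoo boo hb.
  by rewrite !seq_norm_finE//; apply: esum_hoelder.
set M := seq_norm +oo b in boo *.
have M0 : 0 <= M by exact: le_trans (b0 k0) (seq_norm_ge k0 p0 b0).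
have Mfin : M \is a fin_num by rewrite ge0_fin_numE.
rewrite seq_norm_finE// invr1 poweRe1; last by apply: esum_ge0 => k _; exact: poweR_ge0.
rewrite muleC -(fineK Mfin) -esumZl//; last 2 first.
- by rewrite fine_ge0.
- by move=> k; exact: poweR_ge0.
apply: le_esum => k _; rewrite poweRe1// fineK// muleC lee_wpmul2r//.
exact: seq_norm_ge.
Qed.

End sequence_hoelder.

Section amalgam_hoelder.
Context {R : realType} {d : nat}.
Local Notation mu := (@lebesgue_rV R d).
Local Notation V := ('rV[R]_d).
Local Notation cube := (@unit_cube R d).
Implicit Types (f g : V -> R[i]).
Local Open Scope ereal_scope.

Lemma lebesgue_rV_setT_gt0 : 0 < mu setT.
Proof.
rewrite (@lt_le_trans _ _ (mu (cube 0%R)))//; first by rewrite lebesgue_cube.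
by apply: le_measure; rewrite ?inE//; exact: measurable_cube.
Qed.

(** When [q = +oo] the modulus of [g] is bounded almost everywhere by its essential
    supremum. *)
Lemma cLnorm_hoelder (q : \bar R) (r : R) f g : conj_exp q r ->
  cmeasurable f -> cmeasurable g ->
  \int[mu]_x (normc (f x * g x))%:E <= cLnorm r%:E f * cLnorm q g.
Proof.
move=> qr mf mg.
have mnf := measurable_normc mf; have mng := measurable_normc mg.
case: qr => [t s t1 s1 st|].
  have := @hoelder _ _ _ mu (fun x => normc (f x)) (fun x => normc (g x)) s t
    mnf mng (lt_trans ltr01 s1) (lt_trans ltr01 t1) st.
  apply: le_trans; rewrite Lnorm1 le_eqVlt; apply/orP; left; apply/eqP.
  apply: eq_integral => x _ /=.
  by rewrite Normc.normcM ger0_norm// mulr_ge0 ?normc_ge0.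
rewrite /cLnorm Lnorm1 unlock lebesgue_rV_setT_gt0.
set M := ess_sup _ _.
have Mge : {ae mu, forall x, (normc (g x))%:E <= M}.
  have := ess_sup_ge mu (abse \o (fun x => (normc (g x))%:E)).
  by apply: filterS => x /=; rewrite ger0_norm ?normc_ge0.
have M0 : 0 <= M.
  by apply: ess_sup_gee; [exact: lebesgue_rV_setT_gt0|apply: nearW => x; exact: abse_ge0].
rewrite -ge0_integralZr//; last first.
  by apply: measurableT_comp => //; exact: measurable_normcE.
apply: ae_ge0_le_integral => //.
- by move=> x _; rewrite lee_fin normc_ge0.
- exact: (measurable_normcE (cmeasurableM mf mg)).
- by move=> x _; rewrite mule_ge0.
- by apply: emeasurable_funM => //; apply: measurableT_comp => //; exact: measurable_normcE.
apply: filterS Mge => x gM _.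
by rewrite Normc.normcM EFinM /= ger0_norm ?normc_ge0// lee_wpmul2l// lee_fin normc_ge0.
Qed.

Lemma cmeasurable_cube f k : cmeasurable f ->
  cmeasurable (fun x : V => f x * (\1_(cube k) x)%:C%C)%R.
Proof. by move=> mf; exact: (cmeasurableM mf (cmeasurable_indic (measurable_cube k))). Qed.

Lemma cube_hoelder (q : \bar R) (r : R) f g k : conj_exp q r ->
  cmeasurable f -> cmeasurable g ->
  \int[mu]_(x in cube k) (normc (f x * g x))%:E <=
  cLnorm r%:E (fun x => f x * (\1_(cube k) x)%:C%C)%R *
  cLnorm q (fun x => g x * (\1_(cube k) x)%:C%C)%R.
Proof.
move=> qr mf mg.
apply: le_trans (cLnorm_hoelder qr (cmeasurable_cube k mf) (cmeasurable_cube k mg)).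
rewrite integral_mkcond le_eqVlt; apply/orP; left; apply/eqP.
apply: eq_integral => x _; rewrite patchE indicE; case: ifPn => xk; first by rewrite !mulr1.
by rewrite !mulr0 Normc.normc0.
Qed.

Lemma amalgam_hoelder (q p : \bar R) (r s : R) f g : conj_exp q r -> conj_exp p s ->
  cmeasurable f -> cmeasurable g ->
  amalgam_norm r%:E s%:E f < +oo -> amalgam_norm q p g < +oo ->
  \int[mu]_x (normc (f x * g x))%:E <=
  amalgam_norm r%:E s%:E f * amalgam_norm q p g.
Proof.
move=> qr ps mf mg foo goo.
rewrite ge0_integral_cubes; last 2 first.
- exact: (measurable_normcE (cmeasurableM mf mg)).
- by move=> x; rewrite lee_fin normc_ge0.
apply: le_trans (seq_norm_hoelder 0%R ps _ _ foo goo).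
- by apply: le_esum => k _; exact: cube_hoelder.
- by move=> k; exact: cLnorm_ge0.
- by move=> k; exact: cLnorm_ge0.
Qed.

End amalgam_hoelder.

(** * Bounded functions with bounded support *)

Section tame.
Context {R : realType} {d : nat}.
Local Notation mu := (@lebesgue_rV R d).
Local Notation V := ('rV[R]_d).
Local Notation cube := (@unit_cube R d).
Implicit Types (f g : V -> R[i]).

Definition big_box (M : R) : set V := [set x | forall i, `[- M, M]%classic (x ord0 i)].

Lemma measurable_big_box M : measurable (big_box M).
Proof.
by apply: (@measurable_box _ _ (fun=> `[- M, M]%classic)) => i; exact: measurable_itv.
Qed.

Lemma lebesgue_big_box M : (mu (big_box M) < +oo)%E.
Proof.
rewrite (@lebesgue_rV_box R d (fun=> `[- M, M]%classic)) => [|i]; last exact: measurable_itv.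
have fin : lebesgue_measure `[- M, M]%classic \is a fin_num.
  by rewrite lebesgue_measure_itv/=; case: ifPn.
by rewrite ltey_eq (_ : _ \is a fin_num)//; elim/big_ind : _ => // x y; exact: fin_numM.
Qed.

(** A single constant serves as a bound for the values and for the support, which
    costs nothing by monotonicity ([tame_bound]). *)
Definition tame f := cmeasurable f /\
  exists M : R, forall x, normc (f x) <= M * \1_(big_box M) x.

Lemma in_big_box x : exists n : nat, big_box n%:R x.
Proof.
pose N := \sum_(i < d) `|x ord0 i|; exists (Num.truncn N).+1 => i.
rewrite /= in_itv/= -ler_norml (le_trans _ (ltW (truncnS_gt N)))//.
by rewrite /N (bigD1 i)//= lerDl; apply: sumr_ge0.
Qed.

Lemma sub_big_box M N : M <= N -> big_box M `<=` big_box N.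
Proof.
move=> MN x h i; have := h i; rewrite /= !in_itv/= => /andP[a b].
by rewrite (le_trans _ a) ?lerN2// (le_trans b).
Qed.

Lemma tame_bound f : cmeasurable f -> (exists M N : R, forall x,
  normc (f x) <= M * \1_(big_box N) x) -> tame f.
Proof.
move=> mf [M [N MN]]; split => //; exists (Num.max `|M| N) => x.
rewrite (le_trans (MN x))// !indicE; have [xN|xN] := boolP (x \in _); last first.
  by rewrite mulr0 mulr_ge0// le_max normr_ge0.
rewrite mulr1 mem_set ?mulr1.
  by rewrite (le_trans (ler_norm _))// le_max lexx.
by apply: sub_big_box (set_mem xN); rewrite le_max lexx orbT.
Qed.

Lemma tame_le f g (c : R) : cmeasurable f -> 0 <= c ->
  (forall x, normc (f x) <= c * normc (g x)) -> tame g -> tame f.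
Proof.
move=> mf c0 fg [mg [M gM]]; apply: tame_bound => //; exists (c * M), M => x.
by rewrite (le_trans (fg x))// -mulrA ler_wpM2l.
Qed.

Lemma tameD f g : tame f -> tame g -> tame (fun x => f x + g x).
Proof.
move=> [mf [M fM]] [mg [N gN]]; apply: tame_bound; first exact: cmeasurableD.
exists (`|M| + `|N|), (Num.max M N) => x.
rewrite (le_trans (normcD_le _ _))// mulrDl lerD//.
  rewrite (le_trans (fM x))// !indicE; have [xM|xM] := boolP (x \in big_box M).
    rewrite mem_set ?mulr1 ?ler_norm//.
    by apply: sub_big_box (set_mem xM); rewrite le_max lexx.
  by rewrite mulr0 mulr_ge0.
rewrite (le_trans (gN x))// !indicE; have [xM|xM] := boolP (x \in big_box N).
  rewrite mem_set ?mulr1 ?ler_norm//.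
  by apply: sub_big_box (set_mem xM); rewrite le_max lexx orbT.
by rewrite mulr0 mulr_ge0.
Qed.

Lemma tameZ (a : R[i]) f : tame f -> tame (fun x => a * f x).
Proof.
move=> tf; apply: (@tame_le _ f (normc a)) => //; first by apply: cmeasurableZ; case: tf.
  exact: normc_ge0.
by move=> x; rewrite Normc.normcM.
Qed.

Lemma tame0 : tame (fun=> 0).
Proof.
apply: tame_bound; first exact: cmeasurable_cst.
by exists 0, 0 => x; rewrite Normc.normc0 mul0r.
Qed.

Lemma tame_sum (I : Type) (l : seq I) (F : I -> V -> R[i]) :
  (forall i, tame (F i)) -> tame (fun x => \sum_(i <- l) F i x).
Proof.
move=> tF; elim: l => [|i l IH].
  by under eq_fun do rewrite big_nil; exact: tame0.
by under eq_fun do rewrite big_cons; exact: tameD.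
Qed.

Lemma tame_cintegrable f : tame f -> cintegrable f.
Proof.
move=> [mf [M fM]]; apply/(cintegrableP mf).
have M0 : 0 <= `|M| by [].
apply: (@le_lt_trans _ _ (\int[mu]_x (`|M|%:E * (\1_(big_box M) x)%:E))%E).
  apply: ge0_le_integral => //.
  - by move=> x _; rewrite lee_fin normc_ge0.
  - exact: measurable_normcE.
  - apply/measurable_EFinP; apply: measurable_funM => //.
    exact: (measurable_indic (measurable_big_box M)).
  - by move=> x _; rewrite lee_fin (le_trans (fM x))// ler_wpM2r ?ler_norm.
rewrite (@ge0_integralZl _ _ _ mu setT measurableT
  (fun x => (\1_(big_box M) x)%:E))//; last first.
- by apply/measurable_EFinP; exact: (measurable_indic (measurable_big_box M)).
rewrite integral_indic//; last exact: measurable_big_box.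
by rewrite setIT lte_mul_pinfty// lebesgue_big_box.
Qed.

Lemma tame_dilation (a : \bar R) (rho : R) f : 0 < rho -> tame f -> tame (dilation a rho f).
Proof.
move=> r0 [mf [M fM]]; apply: tame_bound; first exact: cmeasurable_dilation.
exists (rho `^ (- (d%:R * fine a^-1%E)) * M), (rho * M) => x.
rewrite normc_dilation -mulrA ler_wpM2l ?powR_ge0// (le_trans (fM _))//.
rewrite le_eqVlt; apply/orP; left; apply/eqP; congr (M * _); rewrite !indicE.
have E : big_box M (rho^-1 *: x) <-> big_box (rho * M) x.
  by split=> h i; have := h i; rewrite /= !in_itv/= !mxE ler_pdivlMl// ler_pdivrMl// mulrN.
have [h|h] := pselect (big_box (rho * M) x); first by rewrite !mem_set//; exact/E.
by rewrite !memNset//; move/E.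
Qed.

Lemma finite_cubes (N : nat) :
  finite_set [set k : 'rV[int]_d | forall i, (absz (k ord0 i) <= N)%N].
Proof.
pose F (phi : {ffun 'I_d -> 'I_(N + N).+1}) : 'rV[int]_d :=
  \row_i ((phi i : nat)%:Z - N%:Z).
apply: (@sub_finite_set _ _ (F @` setT)); last first.
  by apply: finite_image; exact: finite_finset.
move=> k kN /=; exists [ffun i => inord (absz (k ord0 i + N%:Z))] => //.
apply/rowP => i; rewrite mxE ffunE; have := kN i => kNi.
have h : (absz (k ord0 i + N%:Z)%R < (N + N).+1)%N.
  by move: kNi; move: (k ord0 i) => z; lia.
rewrite inordK// -[k 0 i]/(k ord0 i); move: kNi; move: (k ord0 i) => z; lia.
Qed.

(** Bounded sets meet finitely many cubes: sums over cubes of functions of bounded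
    support are finite sums. *)
Lemma box_cubes (M : R) : exists2 K : set 'rV[int]_d, finite_set K &
  forall k x, cube k x -> big_box M x -> K k.
Proof.
have [N MN] : exists N : nat, `|M| + 1 <= N%:R.
  by exists (Num.truncn (`|M| + 1)).+1; exact/ltW/truncnS_gt.
exists [set k : 'rV[int]_d | forall i, (absz (k ord0 i) <= N)%N]; first exact: finite_cubes.
move=> k x kx xM i; have := kx i; have := xM i; rewrite /= in_itv/=.
move=> /andP[x1 x2] /andP[x3 x4].
have h1 : - N%:R <= (k ord0 i)%:~R :> R by have := ler_norm M; lra.
have h2 : (k ord0 i)%:~R <= N%:R :> R by have := ler_norm M; lra.
move: h1 h2; rewrite -mulrz_nat -mulrNz !ler_int; lia.
Qed.

Lemma tame_amalgam (r s : R) f : 0 < r -> 0 < s -> tame f ->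
  (amalgam_norm r%:E s%:E f < +oo)%E.
Proof.
move=> r0 s0 [mf [M fM]]; rewrite amalgam_normE//; apply: poweR_lty.
have [K finK KM] := box_cubes M.
have K0 k : ~ K k -> cube_int r f k = 0%E.
  move=> nK; rewrite /cube_int.
  rewrite (eq_integral (cst 0%E)) ?integral0// => x /set_mem kx.
  have -> : normc (f x) = 0.
    apply/eqP; rewrite eq_le normc_ge0 andbT (le_trans (fM x))// indicE memNset ?mulr0//.
    by move=> xM; apply: nK; exact: KM kx xM.
  by rewrite powR0// gt_eqF.
rewrite (_ : esum _ _ = (\esum_(k in K) cube_int r f k `^ (r^-1 * s))%E); last first.
  rewrite [RHS]esum_mkcond; apply: eq_esum => k _; case: ifPn => // kK.
  rewrite K0 ?poweR0r//; first by rewrite gt_eqF// mulr_gt0// invr_gt0.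
  by move=> Kk; move: kK; rewrite mem_set.
rewrite esum_fset//; last by move=> k _; exact: poweR_ge0.
rewrite fsbig_finite//=.
rewrite ltey_eq (_ : _ \is a fin_num)//; apply/sum_fin_numP => k _ _.
rewrite fin_num_poweR// ge0_fin_numE ?cube_int_ge0//.
have := @le_cube_int _ _ r f (fun=> 1) `|M| k r0 (normr_ge0 _) mf (cmeasurable_cst _).
have fM' x : normc (f x) <= `|M| * normc (1 : R[i]).
  rewrite Normc.normc1 mulr1 (le_trans (fM x))// indicE.
  by case: (_ \in _); rewrite ?mulr1 ?mulr0 ?ler_norm.
move=> /(_ fM') /le_lt_trans; apply.
rewrite /cube_int (_ : (fun x => _) = (fun=> 1%E)); last first.
  by apply/funext => x; rewrite Normc.normc1 powR1.
rewrite integral_cst; last exact: measurable_cube.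
by rewrite mul1e [X in (_ * X)%E](lebesgue_cube k) mule1 ltry.
Qed.

End tame.

(** * The converse of Hoelder's inequality *)

Section test_functions.
Context {R : realType} {d : nat}.
Local Notation mu := (@lebesgue_rV R d).
Local Notation V := ('rV[R]_d).
Local Notation cube := (@unit_cube R d).
Implicit Types (f g : V -> R[i]).
Local Open Scope ereal_scope.

Definition sublevel g (M : R) : set V := [set x | (normc (g x) <= M)%R].

Lemma measurable_sublevel g M : cmeasurable g -> measurable (sublevel g M).
Proof.
move=> mg; rewrite (_ : sublevel g M = (fun x => normc (g x)) @^-1` `]-oo, M]%classic).
  by rewrite -[X in measurable X]setTI; apply: (measurable_normc mg).
by apply/seteqP; split => x; rewrite /sublevel/= in_itv.
Qed.

(** Truncation where [g] is bounded makes the products of test functions with [g]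
    bounded, at an arbitrarily small cost. *)
Lemma integral_truncation g (E : set V) (u : V -> \bar R) (c : \bar R) :
  cmeasurable g -> measurable E -> measurable_fun setT u -> (forall x, 0 <= u x) ->
  c < \int[mu]_(x in E) u x ->
  exists2 M : R, (0 < M)%R & c < \int[mu]_(x in E `&` sublevel g M) u x.
Proof.
move=> mg mE mu_ u0 cE.
pose F (n : nat) := E `&` sublevel g n.+1%:R.
have mF n : measurable (F n) by apply: measurableI => //; exact: measurable_sublevel.
have ndF : nondecreasing_seq F.
  move=> m n mn; apply/subsetPset => x [Ex gx]; split => //.
  by rewrite /sublevel/= (le_trans gx)// ler_nat.
have UF : \bigcup_n F n = E.
  apply/seteqP; split => [x [n _ []]//|x Ex]; exists (Num.truncn (normc (g x))) => //.
  by split => //; rewrite /sublevel/= ltW// truncnS_gt.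
have [n Hn] : exists n, c < \int[mu]_(x in F n) u x.
  apply: contrapT => /forallNP h.
  have := @ge0_nondecreasing_set_cvg_integral _ _ _ F u mu ndF mF.
  rewrite UF => /(_ (fun n => measurable_funTS mu_) (fun n x _ => u0 x)) cv.
  move: cE; rewrite -(cvg_lim _ cv)//; apply/negP; rewrite -leNgt.
  apply: lime_le; first by apply/cvg_ex; exists (\int[mu]_(x in E) u x).
  by apply: nearW => n; rewrite leNgt; apply/negP/h.
by exists n.+1%:R.
Qed.

(** The modulus of a test function; the phase of [g] is supplied by [cube_test].  For
    finite [q] it is the extremal function [|g| ^ (q - 1)] of Hoelder's inequality,
    truncated and normalised; for [q = +oo] it is the normalised indicator of a set
    of positive measure on which [|g|] exceeds [t]. *)
Lemma cube_test_modulus (q : \bar R) (r : R) g k (t : R) : conj_exp q r ->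
  cmeasurable g -> (0 <= t)%R ->
  t%:E < cLnorm q (fun x => g x * (\1_(cube k) x)%:C%C)%R ->
  exists u : V -> R, [/\ measurable_fun setT u,
    exists M B : R, forall x, (0 <= u x <= B * \1_(cube k `&` sublevel g M) x)%R,
    \int[mu]_(x in cube k) (u x `^ r)%:E <= 1 &
    t%:E <= \int[mu]_x (u x * normc (g x))%:E].
Proof.
move=> qr mg t0; have mk := @measurable_cube R d k.
have indI (E : set V) x : cube k x = false -> \1_(cube k `&` E) x = 0%R :> R.
  by move=> h; rewrite indicE memNset// => -[]; rewrite h.
case: qr => [tau s t1 s1 st|].
- have tau0 : (0 < tau)%R by exact: lt_trans t1.
  have s0 : (0 < s)%R by exact: lt_trans s1.
  rewrite cLnorm_cube// => tlt.
  have tltJ : (t `^ tau)%:E < cube_int tau g k.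
    rewrite -[ltRHS](poweRVK tau0) ?cube_int_ge0// -poweR_EFin.
    move: tlt (poweR_ge0 (cube_int tau g k) tau^-1).
    case: (_ `^ tau^-1) => [y| |//].
      rewrite lte_fin lee_fin => ty y0; rewrite !poweR_EFin lte_fin.
      by apply: gt0_ltr_powR.
    by move=> _ _; rewrite poweRyr ?gt_eqF// poweR_EFin ltry.
  have [M M0 JM] := integral_truncation mg mk (measurable_normc_powR tau mg)
    (fun x => powR_ge0 _ _) tltJ.
  set E := cube k `&` sublevel g M in JM *.
  have mE : measurable E by apply: measurableI => //; exact: measurable_sublevel.
  set A := integral _ _ _ in JM.
  have A0 : 0 < A by apply: le_lt_trans JM; rewrite lee_fin powR_ge0.
  have Afin : A \is a fin_num.
    rewrite ge0_fin_numE ?(ltW A0)//.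
    apply: (@le_lt_trans _ _ (\int[mu]_(x in E) (M `^ tau)%:E)).
      apply: ge0_le_integral => //.
      - by move=> x _; rewrite lee_fin powR_ge0.
      - by apply: measurable_funTS; exact: measurable_normc_powR.
      - move=> x [_ gx]; rewrite lee_fin; apply: ge0_ler_powR => //.
        + exact: ltW.
        + by rewrite nnegrE normc_ge0.
        + by rewrite nnegrE ltW.
    rewrite integral_cst// lte_mul_pinfty ?lee_fin ?powR_ge0//.
    apply: (@le_lt_trans _ _ (mu (cube k))); last by rewrite lebesgue_cube ltry.
    by apply: le_measure; rewrite ?inE//; exact: subIsetl.
  pose h x := (normc (g x) `^ tau)%:E.
  have mh : measurable_fun setT h by exact: measurable_normc_powR.
  have h0 x : 0 <= h x by rewrite lee_fin powR_ge0.
  (* the power s of the extremal function is the power tau of the modulus of g *)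
  have tse : ((tau - 1) * s = tau)%R.
    have : (tau + s = s * tau)%R.
      rewrite -[RHS]mulr1 -st; field; by rewrite ?gt_eqF.
    by rewrite mulrBl mul1r mulrC => <-; rewrite addrK.
  pose a := fine A; have aE : A = a%:E by rewrite fineK.
  have a0 : (0 < a)%R by rewrite -lte_fin -aE.
  pose u x := (a `^ (- s^-1) * (normc (g x) `^ (tau - 1) * \1_E x))%R.
  have mu_u : measurable_fun setT u.
    apply: measurable_funM => //; apply: measurable_funM.
      exact: measurableT_comp (measurable_powR _) (measurable_normc mg).
    exact: measurable_indic.
  exists u; split => //.
  + exists M, (a `^ (- s^-1) * M `^ (tau - 1))%R => x.
    rewrite /u !mulr_ge0 ?powR_ge0//= -mulrA ler_wpM2l ?powR_ge0// indicE.
    have [xE|xE] := boolP (x \in E); rewrite ?mulr0 ?mulr1//.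
    apply: ge0_ler_powR; rewrite ?nnegrE ?normc_ge0 ?(ltW M0) ?subr_ge0 ?(ltW t1)//.
    by case: (set_mem xE).
  + rewrite (eq_integral (fun x => (a^-1)%:E * (h \_ (sublevel g M)) x)); last first.
      move=> x /set_mem kx; rewrite /u patchE.
      rewrite !powRM ?mulr_ge0 ?powR_ge0// -!powRrM tse mulNr mulVf ?gt_eqF//.
      rewrite powR_inv1 ?ltW// EFinM; congr (_ * _); rewrite /E indicE.
      have [xM|xM] := boolP (x \in sublevel g M).
        by rewrite mem_set ?powR1 ?mulr1//; split => //; exact: set_mem.
      rewrite memNset ?powR0 ?mulr0 ?gt_eqF// => -[_ h'].
      by move: xM; rewrite mem_set.
    have m1 : measurable_fun (cube k) (h \_ (sublevel g M)).
      apply: measurable_funTS; apply/(measurable_restrictT _ _).1.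
        exact: measurable_sublevel.
      exact: measurable_funTS.
    rewrite (@ge0_integralZl _ _ _ mu _ mk _ m1)//; last first.
      by rewrite lee_fin invr_ge0 ltW.
      by move=> x _; apply: erestrict_ge0.
    by rewrite -integral_mkcondr -/E -/A aE -EFinM mulVf ?gt_eqF.
  + rewrite (eq_integral (fun x => (a `^ (- s^-1))%:E * (h \_ E) x)); last first.
      move=> x _; rewrite /u patchE indicE; case: ifPn => xE.
        by rewrite mulr1 -mulrA [X in (_ * X)%R]mulrC mulr_powRB1 ?normc_ge0.
      by rewrite !mulr0 mul0r mule0.
    have m1 : measurable_fun setT (h \_ E).
      by apply/(measurable_restrictT _ _).1 => //; exact: measurable_funTS.
    rewrite (@ge0_integralZl _ _ _ mu _ measurableT _ m1)//; last first.
      by rewrite lee_fin powR_ge0.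
      by move=> x _; apply: erestrict_ge0.
    rewrite -integral_mkcond -/A aE -EFinM lee_fin.
    rewrite -[X in (_ * X)%R](powRr1 (ltW a0)) -powRD; last by rewrite (gt_eqF a0) implybT.
    rewrite (_ : (- s^-1 + 1 = tau^-1)%R); last by rewrite -st addrA addNr add0r.
    rewrite -[leLHS](powRr1 t0) -(mulfV (lt0r_neq0 tau0)) powRrM.
    apply: ge0_ler_powR; rewrite ?invr_ge0 ?nnegrE ?powR_ge0 ?(ltW a0) ?(ltW tau0)//.
    by rewrite -lee_fin -aE ltW.
- rewrite /cLnorm unlock lebesgue_rV_setT_gt0 => tlt.
  set E := cube k `&` ~` sublevel g t.
  have mE : measurable E.
    by apply: measurableI => //; apply: measurableC; exact: measurable_sublevel.
  have E0 : 0 < \int[mu]_(x in E) cst 1 x.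
    rewrite integral_cst// mul1e lt0e measure_ge0 andbT; apply/eqP => mE0.
    move: tlt; apply/negP; rewrite -leNgt; apply/ess_supP.
    exists E; split => // x /= /negP; rewrite -ltNge lte_fin ger0_norm ?normc_ge0//.
    rewrite normc_cube indicE; have [xk|xk] := boolP (x \in cube k).
      rewrite mulr1 => tx; split; first exact: set_mem.
      by rewrite /sublevel/=; apply/negP; rewrite -ltNge.
    by rewrite mulr0 ltNge t0.
  have [M M0] := integral_truncation mg mE (measurable_cst _) (fun=> lee01) E0.
  set E1 := E `&` _; have mE1 : measurable E1.
    by apply: measurableI => //; exact: measurable_sublevel.
  rewrite integral_cst// mul1e => E10.
  have E1fin : mu E1 \is a fin_num.
    rewrite ge0_fin_numE// (@le_lt_trans _ _ (mu (cube k)))//; last by rewrite lebesgue_cube ltry.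
    by apply: le_measure; rewrite ?inE// => x [[]].
  pose a := fine (mu E1); have aE : mu E1 = a%:E by rewrite fineK.
  have a0 : (0 < a)%R by rewrite -lte_fin -aE.
  have mind : measurable_fun setT (fun x => (\1_E1 x)%:E : \bar R).
    by apply/measurable_EFinP; exact: measurable_indic.
  exists (fun x => a^-1 * \1_E1 x)%R; split.
  + by apply: measurable_funM => //; exact: measurable_indic.
  + exists M, a^-1%R => x; rewrite mulr_ge0 ?invr_ge0 ?(ltW a0)//=.
    rewrite ler_wpM2l ?invr_ge0 ?(ltW a0)// !indicE.
    have [xE|xE] := boolP (x \in E1); last by [].
    by rewrite mem_set//; case: (set_mem xE) => -[].
  + rewrite (eq_integral (fun x => (a^-1)%:E * (\1_E1 x)%:E)); last first.
      by move=> x _; rewrite powRr1// mulr_ge0// invr_ge0 ltW.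
    rewrite (@ge0_integralZl _ _ _ mu _ mk _ (measurable_funTS mind))//; last first.
      by rewrite lee_fin invr_ge0 ltW.
    rewrite integral_indic// setIidl; last by move=> x [[]].
    by rewrite [X in _ * X]aE -EFinM mulVf ?gt_eqF.
  + apply: (@le_trans _ _ (\int[mu]_x ((t * a^-1)%:E * (\1_E1 x)%:E))).
      rewrite (@ge0_integralZl _ _ _ mu _ measurableT _ mind)//; last first.
        by rewrite lee_fin mulr_ge0// invr_ge0 ltW.
      by rewrite integral_indic// setIT [X in _ * X]aE -EFinM -mulrA mulVf ?gt_eqF// mulr1.
    apply: ge0_le_integral => //.
    * by move=> x _; rewrite -EFinM lee_fin !mulr_ge0// invr_ge0 ltW.
    * by apply: emeasurable_funM.
    * apply/measurable_EFinP; apply: measurable_funM; last exact: measurable_normc.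
      by apply: measurable_funM => //; exact: measurable_indic.
    * move=> x _; rewrite -EFinM lee_fin -[leRHS]mulrA.
      have -> : (t * a^-1 * \1_E1 x = a^-1 * (\1_E1 x * t))%R by ring.
      rewrite ler_wpM2l ?invr_ge0 ?(ltW a0)// indicE.
      have [xE|xE] := boolP (x \in E1); last by rewrite !mul0r.
      rewrite !mul1r ltW//; case: (set_mem xE) => -[_].
      by rewrite /sublevel/= => /negP; rewrite -ltNge.
Qed.

(** On each cube a bounded function of unit norm nearly attains the local norm
    of [g]. *)
Lemma cube_test (q : \bar R) (r : R) g k (t : R) : conj_exp q r ->
  cmeasurable g -> (0 <= t)%R ->
  t%:E < cLnorm q (fun x => g x * (\1_(cube k) x)%:C%C)%R ->
  exists phi : V -> R[i], [/\ tame phi, tame (fun x => phi x * g x)%R,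
    forall x, ~ cube k x -> phi x = 0%R,
    cube_int r phi k <= 1 &
    exists2 v, (t <= v)%R & cintegral (fun x => phi x * g x)%R = v%:C%C].
Proof.
move=> qr mg t0 tlt.
have [u [mu_u [M [B uB]] u1 tu]] := cube_test_modulus qr mg t0 tlt.
have r0 := conj_exp_gt0 qr.
have u0 x : (0 <= u x)%R by case/andP: (uB x).
pose phi x := (phase (g x) * (u x)%:C%C)%R.
have mphi : cmeasurable phi.
  by apply: cmeasurableM; [exact: cmeasurable_phase|exact: cmeasurable_real].
have phigE x : (phi x * g x = (u x * normc (g x))%:C%C)%R.
  by rewrite /phi mulrAC phaseM -rmorphM/= mulrC.
have phile x : (normc (phi x) <= u x)%R.
  rewrite Normc.normcM normc_real (ger0_norm (u0 x)).
  by rewrite ler_piMl// normc_phase_le.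
have B0 x : (0 <= B * \1_(cube k `&` sublevel g M) x)%R.
  by case/andP: (uB x); exact: le_trans.
(* a box containing the cube *)
pose N := (\sum_(i < d) (`|(k ord0 i)%:~R| + 1) : R)%R.
have cubeN : cube k `<=` big_box N.
  move=> x kx i; have /andP[h1 h2] := kx i.
  have kN : (`|(k ord0 i)%:~R| + 1 <= N)%R.
    rewrite /N (bigD1 i)//= lerDl; apply: sumr_ge0 => j _.
    by rewrite addr_ge0.
  rewrite /= in_itv/=; apply/andP; split.
    have := ler_norm (- (k ord0 i)%:~R : R)%R; rewrite normrN; lra.
  have := ler_norm ((k ord0 i)%:~R : R)%R; lra.
have boxle (c : R) x : (0 <= c)%R ->
    (c * \1_(cube k `&` sublevel g M) x <= c * \1_(big_box N) x)%R.
  move=> c0; rewrite ler_wpM2l// !indicE.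
  have [xE|//] := boolP (x \in cube k `&` _).
  by rewrite mem_set//; apply: cubeN; case: (set_mem xE).
have uB' x : (u x <= `|B| * \1_(cube k `&` sublevel g M) x)%R.
  case/andP: (uB x) => _ /le_trans; apply.
  by rewrite ler_wpM2r// ler_norm.
have tphig : tame (fun x => phi x * g x)%R.
  apply: tame_bound; first exact: cmeasurableM.
  exists (`|B| * `|M|)%R, N => x.
  rewrite phigE normc_real ger0_norm ?mulr_ge0 ?normc_ge0//.
  apply: le_trans (boxle _ x (mulr_ge0 (normr_ge0 B) (normr_ge0 M))).
  apply: (le_trans (ler_wpM2r (normc_ge0 _) (uB' x))).
  rewrite indicE; have [xE|xE] := boolP (x \in cube k `&` _); last by rewrite !mulr0 mul0r.
  rewrite !mulr1 ler_wpM2l//; case: (set_mem xE) => _ /le_trans; apply.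
  exact: ler_norm.
exists phi; split.
- apply: tame_bound => //; exists `|B|%R, N => x.
  by rewrite (le_trans (phile x))// (le_trans (uB' x))// boxle.
- exact: tphig.
- move=> x kx; apply: Normc.eq0_normc; apply/eqP; rewrite eq_le normc_ge0 andbT.
  rewrite (le_trans (phile x))// (le_trans (uB' x))// indicE memNset ?mulr0//.
  by case.
- apply: le_trans u1; apply: ge0_le_integral.
  + exact: measurable_cube.
  + by move=> x _; rewrite lee_fin powR_ge0.
  + by apply: measurable_funTS; exact: measurable_normc_powR.
  + apply: measurable_funTS; apply/measurable_EFinP.
    exact: measurableT_comp (measurable_powR _) mu_u.
  + move=> x _; rewrite lee_fin; apply: ge0_ler_powR => //.
    * exact: ltW.
    * by rewrite nnegrE normc_ge0.
    * by rewrite nnegrE.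
- exists (Rintegral mu setT (fun x => u x * normc (g x))%R).
    rewrite -lee_fin /Rintegral fineK//.
    have [iRe _] := tame_cintegrable tphig.
    have := integrable_fin_num measurableT iRe.
    by rewrite (eq_integral (fun x => (u x * normc (g x))%:E))// => x _; rewrite phigE.
  apply: complex_eqP => /=; first by apply: eq_Rintegral => x _; rewrite phigE.
  by under eq_Rintegral do rewrite phigE; rewrite /= /Rintegral integral0.
Qed.

End test_functions.

Section converse_hoelder.
Context {R : realType} {d : nat}.
Local Notation mu := (@lebesgue_rV R d).
Local Notation V := ('rV[R]_d).
Local Notation Z := ('rV[int]_d).
Local Notation cube := (@unit_cube R d).
Implicit Types (f g : V -> R[i]).

(** Testing against sums of test functions living on distinct cubes turns the
    hypothesis on [g] into a statement about its sequence of local norms.  Strict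
    inequalities are needed because these norms are approached, not attained, by
    tame functions; cubes where [g] vanishes are left out with [t k = 0]. *)
Lemma cubes_test (q : \bar R) (r s : R) g (C : R) : conj_exp q r -> 0 < s ->
  cmeasurable g ->
  (forall f, tame f -> tame (fun x => f x * g x) ->
    (amalgam_norm r%:E s%:E f <= 1)%E -> normc (cintegral (fun x => f x * g x)) <= C) ->
  forall (l : seq Z) (b t : Z -> R), uniq l ->
  (forall k, 0 <= b k) -> \sum_(k <- l) b k `^ s <= 1 ->
  (forall k, t k = 0 \/ 0 <= t k /\
    ((t k)%:E < cLnorm q (fun x => g x * (\1_(cube k) x)%:C%C)%R)%E) ->
  \sum_(k <- l) b k * t k <= C.
Proof.
move=> qr s0 mg H l b t ul b0 b1 ht; have r0 := conj_exp_gt0 qr.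
have /choice[phiv hphi] : forall k, exists phiv : (V -> R[i]) * R,
    [/\ tame phiv.1, tame (fun x => phiv.1 x * g x),
      forall x, ~ cube k x -> phiv.1 x = 0, (cube_int r phiv.1 k <= 1)%E &
      t k <= phiv.2 /\ cintegral (fun x => phiv.1 x * g x) = phiv.2%:C%C].
  move=> k; case: (ht k) => [->|[tk0 tk]].
    exists (fun=> 0, 0) => /=; split => //.
    - exact: tame0.
    - by under eq_fun do rewrite mul0r; exact: tame0.
    - rewrite /cube_int (eq_integral (cst 0%E)) ?integral0// => x _.
      by rewrite Normc.normc0 powR0// gt_eqF.
    - by split => //; under eq_fun do rewrite mul0r; rewrite cintegral0.
  have [phi [? ? ? ? [v ? ?]]] := cube_test qr mg tk0 tk.
  by exists (phi, v).
pose phi k := (phiv k).1; pose v k := (phiv k).2.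
pose f x := \sum_(k <- l) (b k)%:C%C * phi k x.
have tf : tame f.
  by apply: tame_sum => k; apply: tameZ; case: (hphi k).
have fgE : (fun x => f x * g x) = (fun x => \sum_(k <- l) (b k)%:C%C * (phi k x * g x)).
  by apply/funext => x; rewrite /f mulr_suml; apply: eq_bigr => k _; rewrite mulrA.
have tfg : tame (fun x => f x * g x).
  by rewrite fgE; apply: tame_sum => k; apply: tameZ; case: (hphi k).
have mphi k : cmeasurable (phi k) by case: (hphi k) => -[].
have fk k x : cube k x -> f x = if k \in l then (b k)%:C%C * phi k x else 0.
  move=> kx; have phi0 j : j != k -> phi j x = 0.
    move=> jk; case: (hphi j) => _ _ + _ _; apply => jx.
    by move: jk; rewrite (cube_disjoint jx kx) eqxx.
  case: ifPn => kl.
    rewrite /f (bigD1_seq k)//= big1 ?addr0// => j jk.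
    by rewrite phi0// mulr0.
  rewrite /f big1_seq// => j /= jl; rewrite phi0 ?mulr0//.
  by apply: contraNneq kl => <-.
have cf k : (cube_int r f k <= (if k \in l then b k `^ r else 0)%:E)%E.
  have [kl|kl] := boolP (k \in l); last first.
    rewrite /cube_int (eq_integral (cst 0%E)) ?integral0// => x /set_mem kx.
    by rewrite (fk k)// (negbTE kl) Normc.normc0 powR0// gt_eqF.
  have -> : cube_int r f k = cube_int r (fun x => (b k)%:C%C * phi k x) k.
    by apply: eq_integral => x /set_mem kx; rewrite (fk k)// kl.
  have mbphi := cmeasurableZ (b k)%:C%C (mphi k).
  apply: (le_trans (@le_cube_int _ _ r _ (phi k) (b k) k r0 (b0 k) mbphi (mphi k) _)).
    by move=> x; rewrite Normc.normcM normc_real ger0_norm.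
  rewrite -[leRHS]mule1 lee_wpmul2l ?lee_fin ?powR_ge0//.
  by case: (hphi k).
have af : (amalgam_norm r%:E s%:E f <= 1)%E.
  rewrite amalgam_normE// -[leRHS](_ : (1 `^ s^-1)%E = 1%E); last first.
    by rewrite poweR_EFin powR1.
  apply: le_poweR; first by rewrite invr_ge0 ltW.
    by apply: esum_ge0 => k _; exact: poweR_ge0.
  apply: (@le_trans _ _ (\esum_(k in [set: Z])
      (if k \in [set` l] then (b k `^ s)%:E else 0))%E).
    apply: le_esum => k _; apply: (le_trans (le_poweR _ (cube_int_ge0 _ _ _) (cf k))).
      by rewrite mulr_ge0 ?invr_ge0 ?ltW.
    rewrite mem_setE; case: ifPn => _.
      by rewrite poweR_EFin -powRrM mulrA mulfV ?gt_eqF// mul1r.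
    by rewrite poweR0r// mulf_neq0// ?invr_neq0// gt_eqF.
  rewrite -esum_mkcond esum_fset; last first.
  - by move=> k _; rewrite lee_fin powR_ge0.
  - exact: finite_seq.
  by rewrite -fsbig_seq// sumEFin lee_fin.
have := H f tf tfg af.
rewrite fgE cintegral_sum; last first.
  by move=> k; apply: cintegrableZ; apply: tame_cintegrable; case: (hphi k).
rewrite (eq_bigr (fun k => (b k * v k)%:C%C)); last first.
  move=> k _; rewrite cintegralZ; last by apply: tame_cintegrable; case: (hphi k).
  by case: (hphi k) => _ _ _ _ [_ ->]; rewrite -rmorphM.
have -> : \sum_(k <- l) (b k * v k)%:C%C = (\sum_(k <- l) b k * v k)%:C%C :> R[i].
  by rewrite rmorph_sum.
rewrite normc_real; apply: le_trans.
rewrite (le_trans _ (ler_norm _))//; apply: ler_sum => k _; rewrite ler_wpM2l//.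
by case: (hphi k) => _ _ _ _ [].
Qed.

(** Local norms are only known through the numbers below them, so that no finiteness
    has to be assumed beforehand. *)
Lemma le_of_lt_test (a : \bar R) (C : R) : 0 <= C ->
  (forall t : R, 0 <= t -> (t%:E < a)%E -> t <= C) -> (a <= C%:E)%E.
Proof.
move=> C0 H; rewrite leNgt; apply/negP; case: a H => [a| |//] H Ca.
  move: Ca; rewrite lte_fin => Ca.
  have := H ((C + a) / 2); rewrite lte_fin; have -> : 0 <= (C + a) / 2 by lra.
  have -> : (C + a) / 2 < a by lra.
  by move=> /(_ isT isT); lra.
by have := H (C + 1) (addr_ge0 C0 ler01) (ltry _); lra.
Qed.

(** The same extremal argument as inside a cube, now for the sequence of local norms.
    Each local norm is first seen to be finite by testing on one cube.  For finite
    [p] a finite partial sum is then tested with weights proportional to the power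
    [p - 1] of the local norms, shrunk by a factor [th < 1] to stay strictly below
    them. *)
Lemma amalgam_converse (q p : \bar R) (r s : R) g (C : R) :
  conj_exp q r -> conj_exp p s -> 0 <= C -> cmeasurable g ->
  (forall f, tame f -> tame (fun x => f x * g x) ->
    (amalgam_norm r%:E s%:E f <= 1)%E -> normc (cintegral (fun x => f x * g x)) <= C) ->
  (amalgam_norm q p g <= C%:E)%E.
Proof.
move=> qr ps C0 mg H; have s0 := conj_exp_gt0 ps.
have test := cubes_test qr s0 mg H.
pose a k := cLnorm q (fun x => g x * (\1_(cube k) x)%:C%C).
have a0 k : (0 <= a k)%E by exact: cLnorm_ge0.
have aC k : (a k <= C%:E)%E.
  apply: le_of_lt_test => // t t0 ta.
  have := test [:: k] (fun=> 1) (fun j => if j == k then t else 0).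
  rewrite !big_seq1 eqxx mul1r powR1; apply => // j.
  by case: eqP => [->|_]; [right|left].
have afin k : a k \is a fin_num by rewrite ge0_fin_numE// (le_lt_trans (aC k)) ?ltry.
rewrite /amalgam_norm -/(seq_norm p a).
case: ps s0 test => [sigma s' sig1 s1 sS|] s0 test; last first.
  rewrite /seq_norm; apply: ge_ereal_sup => _ [k _ <-].
  by rewrite gee0_abs; [exact: aC|exact: a0].
have sig0 : 0 < sigma by exact: lt_trans sig1.
rewrite seq_norm_finE//.
suff S : (\esum_(k in [set: Z]) a k `^ sigma <= (C `^ sigma)%:E)%E.
  apply: (le_trans (le_poweR _ _ S)).
  - by rewrite invr_ge0 ltW.
  - by apply: esum_ge0 => k _; exact: poweR_ge0.
  - by rewrite -poweR_EFin poweRK.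
apply: ge_ereal_sup => _ [A [finA _] <-].
pose l : seq Z := finmap.enum_fset (fset_set A).
have ul : uniq l by exact: finmap.fset_uniq.
rewrite fsbig_finite//= -/l.
pose c k := fine (a k); have cE k : a k = (c k)%:E by rewrite fineK.
have c0 k : 0 <= c k by rewrite fine_ge0.
under eq_bigr do rewrite cE poweR_EFin.
rewrite sumEFin lee_fin; set S := \sum_(k <- l) _.
have key eta : 0 < eta -> eta < 1 -> eta * S <= C `^ sigma.
  move=> e0 e1.
  pose th := eta `^ sigma^-1; have th0 : 0 < th by exact: powR_gt0.
  have thE : th `^ sigma = eta by rewrite -powRrM mulVf ?gt_eqF// powRr1// ltW.
  have th1 : th < 1.
    rewrite ltNge; apply/negP => th1; move: e1; rewrite ltNge -thE => /negP; apply.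
    have <- : 1 `^ sigma = 1 :> R by rewrite powR1.
    by apply: ge0_ler_powR; rewrite ?nnegrE ?(ltW th0) ?(ltW sig0).
  pose t k := th * c k; have t0 k : 0 <= t k by rewrite mulr_ge0 ?(ltW th0).
  pose T := \sum_(k <- l) t k `^ sigma.
  have TE : T = eta * S.
    rewrite /T /S mulr_sumr; apply: eq_bigr => k _.
    by rewrite powRM ?thE// ltW.
  rewrite -TE; have T0 : 0 <= T by apply: sumr_ge0 => k _; exact: powR_ge0.
  have [->|Tn0] := eqVneq T 0; first exact: powR_ge0.
  have {T0}Tgt0 : 0 < T by rewrite lt0r Tn0.
  (* the extremal sequence of Hoelder's inequality for the shrunk local norms *)
  pose b k := T `^ (- s'^-1) * t k `^ (sigma - 1).
  have tse : (sigma - 1) * s' = sigma.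
    have : sigma + s' = s' * sigma by rewrite -[RHS]mulr1 -sS; field; rewrite ?gt_eqF.
    by rewrite mulrBl mul1r mulrC => <-; rewrite addrK.
  have TC : T `^ sigma^-1 <= C.
    have -> : T `^ sigma^-1 = \sum_(k <- l) b k * t k.
      under eq_bigr => k _ do rewrite /b -mulrA [_ `^ _ * t k]mulrC mulr_powRB1//.
      rewrite -mulr_sumr -/T -[X in _ = _ * X](powRr1 (ltW Tgt0)) -powRD; last first.
        by rewrite (gt_eqF Tgt0) implybT.
      by congr (_ `^ _); rewrite -sS addrA addNr add0r.
    apply: test => //.
    - by move=> k; rewrite mulr_ge0 ?powR_ge0.
    - under eq_bigr => k _ do rewrite /b powRM ?powR_ge0// -!powRrM tse mulNr mulVf ?gt_eqF//.
      by rewrite -mulr_sumr -/T (powR_inv1 (ltW Tgt0)) mulVf.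
    - move=> k; have [ck|ck] := eqVneq (c k) 0; first by left; rewrite /t ck mulr0.
      right; split => //; rewrite -/(a k) cE lte_fin /t gtr_pMl//.
      by rewrite lt0r ck c0.
  rewrite -[leLHS](powRr1 (ltW Tgt0)) -(mulVf (lt0r_neq0 sig0)) powRrM.
  by apply: ge0_ler_powR; rewrite ?nnegrE ?powR_ge0// ltW.
rewrite leNgt; apply/negP => CS.
have K0 : 0 <= C `^ sigma by exact: powR_ge0.
have S0 : 0 < S by exact: le_lt_trans CS.
(* this factor makes the left-hand side the mean of C `^ sigma and S *)
have := key ((C `^ sigma + S) / (2 * S)).
have -> : (C `^ sigma + S) / (2 * S) * S = (C `^ sigma + S) / 2.
  by field; rewrite gt_eqF.
have e0 : 0 < (C `^ sigma + S) / (2 * S) by rewrite divr_gt0 ?mulr_gt0 ?ltr_wpDl.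
have e1 : (C `^ sigma + S) / (2 * S) < 1.
  by rewrite ltr_pdivrMr ?mulr_gt0// mul1r; lra.
move=> /(_ e0 e1); lra.
Qed.

End converse_hoelder.

(** * Local integrability *)

Section local_integrability.
Context {R : realType} {d : nat}.
Local Notation mu := (@lebesgue_rV R d).
Local Notation V := ('rV[R]_d).
Local Notation cube := (@unit_cube R d).
Implicit Types (f g h : V -> R[i]).
Local Open Scope ereal_scope.

Lemma subset_integral_le (K B : set V) (u : V -> \bar R) :
  K `<=` B -> (forall x, 0 <= u x) ->
  \int[mu]_(x in K) u x <= \int[mu]_(x in B) u x.
Proof.
move=> KB u0; rewrite (integral_mkcond K) (integral_mkcond B).
have p0 (A : set V) x : 0 <= (u \_ A) x by rewrite patchE; case: ifP.
rewrite !ge0_integralTE//; apply: ereal_sup_le => _ [s sK <-].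
exists s => // x; apply: le_trans (sK x) _; rewrite !patchE.
case: ifPn => xK; last by case: ifP.
by rewrite mem_set//; exact/KB/set_mem.
Qed.

Lemma compact_big_box M : compact (@big_box R d M).
Proof.
by apply: (@rV_compact R d (fun=> `[(- M)%R, M]%classic)) => i; exact: segment_compact.
Qed.

(** Boxes are cofinal among compact sets, so local integrability and local
    convergence need to be tested on boxes only. *)
Lemma compact_sub_big_box (K : set V) : compact K -> exists M, K `<=` @big_box R d M.
Proof.
move=> cK.
have bi (i : 'I_d) : exists M : R, forall x, K x -> (`|x ord0 i| <= M)%R.
  have ci : compact [set x ord0 i | x in K].
    apply: continuous_compact => //; apply: continuous_subspaceT => x.
    exact: coord_continuous.
  have [M [_ HM]] := compact_bounded ci.
  exists (M + 1)%R => x Kx; apply: (HM (M + 1)%R); first by rewrite ltrDl.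
  by exists x.
have /choice[M HM] := bi.
exists (\sum_(i < d) `|M i|)%R => x Kx i; rewrite /= in_itv/= -ler_norml.
rewrite (le_trans (HM i x Kx))// (le_trans (ler_norm _))// (bigD1 i)//= lerDl.
by apply: sumr_ge0.
Qed.

Lemma L1locP f : L1loc f <-> cmeasurable f /\
  forall M, \int[mu]_(x in @big_box R d M) (normc (f x))%:E < +oo.
Proof.
split=> [[mf H]|[mf H]]; split => //.
  by move=> M; apply: H; exact: compact_big_box.
move=> K cK; have [M KM] := compact_sub_big_box cK; apply: le_lt_trans (H M).
by apply: subset_integral_le => // x; rewrite lee_fin normc_ge0.
Qed.

Lemma L1loc_cvgP (u : nat -> V -> R[i]) f : L1loc_cvg u f <->
  forall M, (fun N => \int[mu]_(x in @big_box R d M) (normc (u N x - f x)%R)%:E) @ \oo --> 0.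
Proof.
split=> H => [M|K cK]; first by apply: H; exact: compact_big_box.
have [M KM] := compact_sub_big_box cK; apply: squeeze_cvge0 (H M) => N.
rewrite integral_ge0 => [|x _]; last by rewrite lee_fin normc_ge0.
by apply: subset_integral_le => // x; rewrite lee_fin normc_ge0.
Qed.

Lemma L1locD f g : L1loc f -> L1loc g -> L1loc (fun x => f x + g x)%R.
Proof.
move=> /L1locP[mf fM] /L1locP[mg gM]; apply/L1locP; split=> [|M].
  exact: cmeasurableD.
apply: (@le_lt_trans _ _ (\int[mu]_(x in @big_box R d M)
    ((normc (f x))%:E + (normc (g x))%:E))).
  apply: ge0_le_integral.
  - exact: measurable_big_box.
  - by move=> x _; rewrite lee_fin normc_ge0.
  - by apply: measurable_funTS; exact: (measurable_normcE (cmeasurableD mf mg)).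
  - by apply: emeasurable_funD; apply: measurable_funTS; exact: measurable_normcE.
  - by move=> x _; rewrite -EFinD lee_fin normcD_le.
rewrite ge0_integralD.
- exact: lte_add_pinfty.
- exact: measurable_big_box.
- by move=> x _; rewrite lee_fin normc_ge0.
- by apply: measurable_funTS; exact: measurable_normcE.
- by move=> x _; rewrite lee_fin normc_ge0.
- by apply: measurable_funTS; exact: measurable_normcE.
Qed.

Lemma L1locZ (a : R[i]) f : L1loc f -> L1loc (fun x => a * f x)%R.
Proof.
move=> /L1locP[mf fM]; apply/L1locP; split=> [|M]; first exact: cmeasurableZ.
under eq_integral do rewrite Normc.normcM EFinM.
rewrite ge0_integralZl.
- by rewrite lte_mul_pinfty ?lee_fin ?normc_ge0.
- exact: measurable_big_box.
- by apply: measurable_funTS; exact: measurable_normcE.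
- by move=> x _; rewrite lee_fin normc_ge0.
- by rewrite lee_fin normc_ge0.
Qed.

Lemma L1loc0 : L1loc (fun _ : V => 0%R : R[i]).
Proof.
apply/L1locP; split=> [|M]; first exact: cmeasurable_cst.
by under eq_integral do rewrite Normc.normc0; rewrite integral0 ltry.
Qed.

Lemma L1loc_sum (I : Type) (l : seq I) (F : I -> V -> R[i]) :
  (forall i, L1loc (F i)) -> L1loc (fun x => \sum_(i <- l) F i x)%R.
Proof.
move=> iF; elim: l => [|i l IH].
  by under eq_fun do rewrite big_nil; exact: L1loc0.
by under eq_fun do rewrite big_cons; exact: L1locD.
Qed.

Lemma L1loc_cubes f : cmeasurable f ->
  (forall k, \int[mu]_(x in cube k) (normc (f x))%:E < +oo) -> L1loc f.
Proof.
move=> mf fk; apply/L1locP; split => // M.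
have [K finK KM] := @box_cubes R d M.
have mbox := @measurable_big_box R d M.
rewrite integral_mkcond ge0_integral_cubes; last 2 first.
- apply/(measurable_restrictT _ _).1 => //.
  by apply: measurable_funTS; exact: measurable_normcE.
- by move=> x; rewrite patchE; case: ifP; rewrite ?lee_fin ?normc_ge0.
apply: (@le_lt_trans _ _ (\esum_(k in K) \int[mu]_(x in cube k) (normc (f x))%:E)).
  rewrite [leRHS]esum_mkcond; apply: le_esum => k _; case: ifPn => kK.
    apply: ge0_le_integral.
    - exact: measurable_cube.
    - by move=> x _; rewrite patchE; case: ifP; rewrite ?lee_fin ?normc_ge0.
    - apply: measurable_funTS; apply/(measurable_restrictT _ _).1 => //.
      by apply: measurable_funTS; exact: measurable_normcE.
    - by apply: measurable_funTS; exact: measurable_normcE.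
    - by move=> x _; rewrite patchE; case: ifP; rewrite ?lee_fin ?normc_ge0.
  rewrite (eq_integral (cst 0)) ?integral0// => x /set_mem kx.
  rewrite patchE; case: ifPn => // /set_mem xM.
  by move: kK; rewrite mem_set//; exact: (KM _ _ kx xM).
rewrite esum_fset//; last first.
  by move=> k _; apply: integral_ge0 => x _; rewrite lee_fin normc_ge0.
rewrite fsbig_finite//= ltey_eq (_ : _ \is a fin_num)//; apply/sum_fin_numP => k _ _.
rewrite ge0_fin_numE//.
by apply: integral_ge0 => x _; rewrite lee_fin normc_ge0.
Qed.

(** On a cube of measure one, [|h| <= 1 + |h| ^ r]; this covers [r = 1], where
    Hoelder's inequality against the constant [1] would involve an infinite
    exponent. *)
Lemma amalgam_L1loc (r s : R) h : (1 <= r)%R -> (0 < s)%R -> cmeasurable h ->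
  amalgam_norm r%:E s%:E h < +oo -> L1loc h.
Proof.
move=> r1 s0 mh hoo; have r0 : (0 < r)%R by exact: lt_le_trans r1.
apply: L1loc_cubes => // k.
have kfin : cube_int r h k < +oo.
  apply: (@lty_poweRy _ _ r^-1); first by rewrite invr_neq0// gt_eqF.
  rewrite -cLnorm_cube//; apply: le_lt_trans hoo.
  by apply: (@seq_norm_ge _ _ _ (fun k => cLnorm r%:E
    (fun x => h x * (\1_(cube k) x)%:C%C)%R)) => // l; exact: cLnorm_ge0.
apply: (@le_lt_trans _ _ (\int[mu]_(x in cube k) (1 + (normc (h x) `^ r)%:E))).
  apply: ge0_le_integral.
  - exact: measurable_cube.
  - by move=> x _; rewrite lee_fin normc_ge0.
  - by apply: measurable_funTS; exact: measurable_normcE.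
  - by apply: emeasurable_funD => //; apply: measurable_funTS; exact: measurable_normc_powR.
  - move=> x _; rewrite -EFinD lee_fin.
    have [h1|/ltW h1] := leP (normc (h x)) 1%R; first by rewrite ler_wpDr ?powR_ge0.
    by rewrite ler_wpDl// le1r_powR.
rewrite ge0_integralD//.
- rewrite integral_cst; last exact: measurable_cube.
  by rewrite mul1e [X in X + _](lebesgue_cube k); apply: lte_add_pinfty => //; exact: ltry.
- exact: measurable_cube.
- by move=> x _; rewrite lee_fin powR_ge0.
- by apply: measurable_funTS; exact: measurable_normc_powR.
Qed.

Lemma L1loc_dilation (a : \bar R) (rho : R) h : (0 < rho)%R -> L1loc h ->
  L1loc (dilation a rho h).
Proof.
move=> r0 /L1locP[mh hM]; apply: L1locZ; apply/L1locP; split => [|M].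
  exact: cmeasurable_scale.
have mbox N := @measurable_big_box R d N.
rewrite integral_mkcond (ge0_integral_scale r0); last 2 first.
- apply/(measurable_restrictT _ _).1 => //.
  by apply: measurable_funTS; exact: (measurable_normcE (cmeasurable_scale _ mh)).
- by move=> x; rewrite patchE; case: ifP; rewrite ?lee_fin ?normc_ge0.
rewrite lte_mul_pinfty ?lee_fin ?exprn_ge0 ?(ltW r0)//.
rewrite (_ : integral _ _ _ = \int[mu]_(x in @big_box R d (rho^-1 * M)%R) (normc (h x))%:E)//.
rewrite [RHS]integral_mkcond; apply: eq_integral => x _; rewrite !patchE.
rewrite scalerA mulVf ?gt_eqF// scale1r.
have E : big_box M (rho *: x)%R <-> big_box (rho^-1 * M)%R x.
  by split=> hx i; have := hx i; rewrite /= !in_itv/= !mxE -mulrN ler_pdivrMl// ler_pdivlMl.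
have [xM|xM] := pselect (big_box (rho^-1 * M)%R x); first by rewrite !mem_set//; exact/E.
by rewrite !memNset//; move/E.
Qed.

End local_integrability.

(** * Tame functions approximate and separate *)

Section tame_tests.
Context {R : realType} {d : nat}.
Local Notation mu := (@lebesgue_rV R d).
Local Notation V := ('rV[R]_d).
Implicit Types (f g h : V -> R[i]).

(** Cutting down to a box and to a set where [k] is bounded. *)
Lemma tame_truncation k : cmeasurable k -> exists F : nat -> V -> R[i],
  [/\ forall n, tame (F n), forall n x, normc (F n x) <= normc (k x) &
    forall x, (fun n => normc (F n x - k x)) @ \oo --> (0 : R)].
Proof.
move=> mk; pose E n := @big_box R d n%:R `&` sublevel k n%:R.
have mE n : measurable (E n).
  by apply: measurableI; [exact: measurable_big_box|exact: measurable_sublevel].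
exists (fun n x => k x * (\1_(E n) x)%:C%C); split.
- move=> n; apply: tame_bound; first exact: (cmeasurableM mk (cmeasurable_indic (mE n))).
  exists n%:R, n%:R => x; rewrite Normc.normcM normc_real ger0_norm// !indicE.
  have [/set_mem[xb xk]|_] := boolP (x \in E n); last by rewrite mulr0 mulr_ge0.
  by rewrite mem_set// !mulr1.
- by move=> n x; rewrite Normc.normcM normc_real ger0_norm// ler_piMr ?normc_ge0//.
- move=> x; have [m xm] := in_big_box x.
  apply: near_cvgr0 => [n|e e0]; first exact: normc_ge0.
  exists (maxn m (Num.truncn (normc (k x))).+1) => // n /=.
  rewrite geq_max => /andP[mn kn].
  rewrite indicE mem_set ?mulr1 ?subrr ?Normc.normc0//; split.
    by apply: sub_big_box xm; rewrite ler_nat.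
  by rewrite /sublevel/= (le_trans (ltW (truncnS_gt _)))// ler_nat.
Qed.

(** Indicators of measurable subsets of a box are tame, and on a box locally
    integrable functions are integrable, hence determined by their integrals over
    measurable subsets. *)
Lemma tame_separating g h : L1loc g -> L1loc h ->
  (forall f, tame f ->
    cintegral (fun x => f x * g x) = cintegral (fun x => f x * h x)) ->
  g = h %[ae mu].
Proof.
move=> /L1locP[mg gM] /L1locP[mh hM] gh.
have box_ae (n : nat) : {ae mu, forall x, @big_box R d n%:R x -> g x = h x}.
  set B := @big_box R d n%:R; have mB : measurable B := measurable_big_box n%:R.
  have loc f : cmeasurable f -> (\int[mu]_(x in B) (normc (f x))%:E < +oo)%E ->
      mu.-integrable B (EFin \o (fun x => Re (f x))) /\
      mu.-integrable B (EFin \o (fun x => Im (f x))).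
    move=> mf fB; have [f1 f2] := mf.
    have iB : mu.-integrable B (fun x => (normc (f x))%:E).
      apply/integrableP; split; first by apply: measurable_funTS; exact: measurable_normcE.
      by under eq_integral do rewrite gee0_abs ?lee_fin ?normc_ge0//.
    split; apply: (le_integrable mB _ _ iB).
    - by apply: measurable_funTS; exact/measurable_EFinP.
    - by move=> x _; rewrite /= lee_fin (ger0_norm (normc_ge0 _)) normc_re_le.
    - by apply: measurable_funTS; exact/measurable_EFinP.
    - by move=> x _; rewrite /= lee_fin (ger0_norm (normc_ge0 _)) normc_im_le.
  have [g1 g2] := loc g mg (gM n%:R); have [h1 h2] := loc h mh (hM n%:R).
  have test E : E `<=` B -> measurable E ->
      cintegral (fun x => (\1_E x)%:C%C * g x) = cintegral (fun x => (\1_E x)%:C%C * h x).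
    move=> EB mE; apply: gh; apply: tame_bound; first exact: cmeasurable_indic.
    exists 1, n%:R => x; rewrite normc_real ger0_norm// mul1r !indicE.
    by have [/set_mem/EB/mem_set ->|//] := boolP (x \in E); rewrite ?lexx.
  have ReE E f : Re (cintegral (fun x => (\1_E x)%:C%C * f x)) = Rintegral mu E (fun x => Re (f x)).
    rewrite /= [RHS]Rintegral_mkcond; apply: eq_Rintegral => x _.
    rewrite ReM /= mul0r subr0 patchE indicE.
    by case: ifP => _; rewrite ?mul1r ?mul0r.
  have ImE E f : Im (cintegral (fun x => (\1_E x)%:C%C * f x)) = Rintegral mu E (fun x => Im (f x)).
    rewrite /= [RHS]Rintegral_mkcond; apply: eq_Rintegral => x _.
    rewrite ImM /= mul0r addr0 patchE indicE.
    by case: ifP => _; rewrite ?mul1r ?mul0r.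
  have eq_ae (u v : V -> R) : mu.-integrable B (EFin \o u) -> mu.-integrable B (EFin \o v) ->
      (forall E, E `<=` B -> measurable E -> Rintegral mu E u = Rintegral mu E v) ->
      ae_eq mu B (EFin \o u) (EFin \o v).
    move=> iu iv uv; apply: integral_ae_eq => //; first by case/integrableP: iv.
    move=> E EB mE; have iuE := integrableS mB mE EB iu; have ivE := integrableS mB mE EB iv.
    rewrite -(fineK (integrable_fin_num mE iuE)) -(fineK (integrable_fin_num mE ivE)).
    by congr EFin; exact: uv.
  have aeR : ae_eq mu B (EFin \o (fun x => Re (g x))) (EFin \o (fun x => Re (h x))).
    by apply: eq_ae => // E EB mE; rewrite -!ReE test.
  have aeI : ae_eq mu B (EFin \o (fun x => Im (g x))) (EFin \o (fun x => Im (h x))).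
    by apply: eq_ae => // E EB mE; rewrite -!ImE test.
  apply: filterS2 aeR aeI => x rx ix Bx; apply: complex_eqP; first by case: (rx Bx).
  by case: (ix Bx).
have := ae_foralln box_ae; apply: filterS => x Hx _.
by have [n xn] := in_big_box x; exact: Hx xn.
Qed.

End tame_tests.

(** * Density, weight and approximation by simple functions *)

Section radon_nikodym.
Local Open Scope charge_scope.
Context {dT : measure_display} {T : measurableType dT} {R : realType}.
Context (mu : {sigma_finite_measure set T -> \bar R}).

(** A countably additive real set function is a charge, to which the
    Radon-Nikodym theorem for charges applies. *)
Lemma radon_nikodym_real (nu : set T -> R) : nu set0 = 0 ->
  (forall F : nat -> set T, (forall n, measurable (F n)) -> trivIset setT F ->
    (fun n => \sum_(0 <= i < n) nu (F i)) @ \oo --> nu (\bigcup_n F n)) ->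
  (forall A, measurable A -> mu A = 0%E -> nu A = 0) ->
  exists u : T -> R, mu.-integrable setT (EFin \o u) /\
    forall A, measurable A -> nu A = Rintegral mu A u.
Proof.
move=> nu0 nuS numu.
pose nuE (A : set T) := (nu A)%:E.
have c0 : nuE set0 = 0%E by rewrite /nuE nu0.
have cfin : forall A, measurable A -> nuE A \is a fin_num by [].
have cs : measure_function.semi_sigma_additive nuE.
  move=> F mF tF mUF; under eq_fun do rewrite sumEFin.
  by apply/fine_cvgP; split; [exact: nearW|exact: nuS].
pose nuc : {charge set T -> \bar R} := HB.pack nuE (isCharge.Build _ _ _ nuE c0 cfin cs).
have dom : nuc `<< mu.
  by move=> N muN A mA AN; rewrite /= /nuE numu//; exact: muN.
have irn := Radon_Nikodym_integrable dom.
have frn x := Radon_Nikodym_fin_num x dom.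
exists (fun x => fine ('d nuc '/d mu x)); split.
  apply: eq_integrable irn => //= x _; by rewrite fineK.
move=> A mA; rewrite /Rintegral.
rewrite (eq_integral ('d nuc '/d mu)); last by move=> x _; rewrite fineK.
by rewrite -Radon_Nikodym_integral.
Qed.

End radon_nikodym.

Section weight.
Context {R : realType} {d : nat}.
Local Notation mu := (@lebesgue_rV R d).
Local Notation V := ('rV[R]_d).
Local Notation Z := ('rV[int]_d).
Local Notation cube := (@unit_cube R d).

(** Any function of the index of the cube is measurable, since there are countably
    many cubes. *)
Lemma measurable_cube_of (c : Z -> R) : measurable_fun setT (fun x : V => c (cube_of x)).
Proof.
move=> _ B mB; rewrite setTI.
rewrite (_ : _ @^-1` _ = \bigcup_n
    oapp (fun k => if c k \in B then cube k else set0) set0 (@pickle_inv Z n)).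
  apply: bigcupT_measurable => n; case: pickle_inv => //= k; case: ifP => // _.
  exact: measurable_cube.
apply/seteqP; split=> [x /= Bx|x [n _]].
  exists (pickle (cube_of x)) => //; rewrite pickleK_inv/= mem_set//.
  exact/cube_ofP.
case: pickle_inv => //= k; case: ifPn => // /set_mem Bk /cube_ofP xk.
by rewrite /preimage/= xk.
Qed.

(** Powers of [1/2] along an enumeration of the cubes: such a weight turns functionals
    on the amalgam space into finite measures on the whole space. *)
Lemma weight_exists (r s : R) : 0 < r -> 1 <= s ->
  exists w : V -> R, [/\ measurable_fun setT w, forall x, 0 < w x &
    (amalgam_norm r%:E s%:E (fun x => (w x)%:C%C) < +oo)%E].
Proof.
move=> r0 s1; have s0 : 0 < s by exact: lt_le_trans s1.
pose c (k : Z) : R := 2^-1 ^+ (pickle k).+1.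
have c0 k : 0 < c k by rewrite exprn_gt0// invr_gt0.
have c1 k : c k <= 1 by rewrite exprn_ile1 ?invr_ge0// invf_le1// ler1n.
exists (fun x => c (cube_of x)); split => //; first exact: measurable_cube_of.
rewrite amalgam_normE//; apply: poweR_lty.
have cE k : cube_int r (fun x : V => (c (cube_of x))%:C%C) k = (c k `^ r)%:E.
  rewrite /cube_int (eq_integral (cst (c k `^ r)%:E)) => [|x /set_mem /cube_ofP ->].
    rewrite integral_cst; last exact: measurable_cube.
    by rewrite [X in (_ * X)%E](lebesgue_cube k) mule1.
  by rewrite normc_real gtr0_norm.
apply: (@le_lt_trans _ _ (\esum_(k in [set: Z]) (c k)%:E)%E).
  apply: le_esum => k _; rewrite cE poweR_EFin lee_fin -powRrM mulrA mulfV ?gt_eqF// mul1r.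
  by apply: ge1r_powR => //; rewrite c0 c1.
rewrite esum_pickled; last by move=> k; rewrite lee_fin ltW.
apply: (@le_lt_trans _ _ (\sum_(0 <= n <oo) (0 + (1 / (2 ^ n.+1)%:R)%:E))%E).
  apply: lee_nneseries => [n *|n *].
    by apply: pickled_ge0 => k; rewrite lee_fin ltW.
  rewrite add0e /pickled; case E : pickle_inv => [k|] /=; last by rewrite lee_fin divr_ge0.
  have := @pickle_invK Z n; rewrite E /= => kn.
  by rewrite lee_fin /c kn natrX exprVn div1r.
apply: (le_lt_trans (epsilon_trick xpredT (fun=> lexx _) ler01)).
by rewrite eseries0// add0e ltry.
Qed.

End weight.

Section simple_functions.
Import HBNNSimple.

(** The approximants are linear combinations of indicators with explicit sets, so
    that a linear functional can be evaluated on them. *)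
Lemma simple_approximation d (T : measurableType d) (R : realType) (u : T -> R) :
  measurable_fun setT u -> (forall x, 0 <= u x) ->
  exists v : nat -> T -> R, [/\ forall n, measurable_fun setT (v n),
    forall n x, 0 <= v n x <= u x, forall x, (v ^~ x) @ \oo --> u x &
    forall n, exists (l : seq R) (A : R -> set T), (forall y, measurable (A y)) /\
      forall x, v n x = \sum_(y <- l) y * \1_(A y) x].
Proof.
move=> mu u0.
have meu : measurable_fun setT (EFin \o u) by exact/measurable_EFinP.
have eu0 : forall x, setT x -> (0%:E <= (EFin \o u) x)%E by move=> x _; rewrite lee_fin.
exists (fun n => nnsfun_approx measurableT meu n); split.
- move=> n.
  exact: measurable_funPT.
- move=> n x; apply/andP; split; first exact: fun_ge0.
  by rewrite -lee_fin nnsfun_approxE; exact: le_approx.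
- move=> x; have /fine_cvgP[_] := cvg_nnsfun_approx measurableT meu eu0 (I : setT x).
  exact.
- move=> n; set phi := nnsfun_approx measurableT meu n.
  exists (finmap.enum_fset (fset_set (range phi))), (fun y => phi @^-1` [set y]).
  split; first by move=> y; exact: measurable_sfunP.
  move=> x; rewrite fimfunE fsbig_finite//=.
Qed.

End simple_functions.

(** * Pairing the Fofana space with H *)

Section space_H_facts.
Context {R : realType} {d : nat} (q p alpha : \bar R) (r s t : R).
Context (qr : conj_exp q r) (ps : conj_exp p s) (alt : conj_exp alpha t).
Context (hq : hoelder_conjugate q = r%:E) (hp : hoelder_conjugate p = s%:E)
  (ha : hoelder_conjugate alpha = t%:E).
Local Notation mu := (@lebesgue_rV R d).
Local Notation V := ('rV[R]_d).
Implicit Types (f g : V -> R[i]) (c : nat -> R[i]) (rho : nat -> R)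
  (h : nat -> V -> R[i]).
Local Notation H := (@H_space R d q p alpha).
Local Notation Hnorm := (@H_norm R d q p alpha).
Local Notation decomposition := (@h_decomposition R d q p alpha).
Local Notation am := (@amalgam_norm R d r%:E s%:E).
Local Notation dil := (@dilation R d t%:E).
Local Notation fof := (@fofana_norm R d q p alpha).

Let r0 : 0 < r := conj_exp_gt0 qr.
Let s0 : 0 < s := conj_exp_gt0 ps.

Lemma conj_exp_fineV : fine alpha^-1%E + fine (t%:E)^-1%E = 1.
Proof.
case: alt => [u v u1 v1 uv|]; last by rewrite invey inver oner_eq0 invr1 /= add0r.
by rewrite !inver !gt_eqF ?(lt_trans ltr01)//= addrC.
Qed.

(** With the conjugate exponents replaced by real numbers, finiteness of the norms of
    the atoms is implied by the bound by one. *)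
Lemma decompositionP f c rho h : decomposition f c rho h <->
  [/\ forall n, 0 < rho n, forall n, cmeasurable (h n) /\ (am (h n) <= 1)%E,
    (abs_coef_sum c < +oo)%E &
    L1loc_cvg (fun N x => \sum_(0 <= n < N) c n * dil (rho n) (h n) x) f].
Proof.
rewrite /h_decomposition /amalgam hq hp ha; split.
  by move=> [rho0 hm c1 h1 cv]; split => // n; split => //; case: (hm n).
move=> [rho0 hm c1 cv]; split => // n; last by case: (hm n).
by split; case: (hm n) => // _ /le_lt_trans; apply; exact: ltry.
Qed.

Lemma fofana_norm_ge (rho : R) g : 0 < rho ->
  (amalgam_norm q p (dilation alpha rho g) <= fof g)%E.
Proof. by move=> rho0; apply: ereal_sup_ubound; exists rho. Qed.

Lemma fofana_norm_ge0 g : (0 <= fof g)%E.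
Proof. exact: le_trans (amalgam_norm_ge0 _ _ _) (fofana_norm_ge g ltr01). Qed.

(** The basic estimate: the dilation is moved to [g], whose amalgam norm after any
    dilation is at most the Fofana norm. *)
Lemma atom_pairing_le (rho : R) g (k : V -> R[i]) : 0 < rho -> cmeasurable g -> cmeasurable k ->
  (am k < +oo)%E -> (fof g < +oo)%E ->
  (\int[mu]_x (normc (dil rho k x * g x))%:E <= am k * fof g)%E.
Proof.
move=> rho0 mg mh hoo goo.
have ri0 : 0 < rho^-1 by rewrite invr_gt0.
rewrite (integral_normc_dilation rho0 conj_exp_fineV mh mg).
have gle := fofana_norm_ge g ri0.
apply: (le_trans (amalgam_hoelder qr ps mh (cmeasurable_dilation alpha rho^-1 mg) hoo _)).
  exact: le_lt_trans goo.
by rewrite lee_wpmul2l// amalgam_norm_ge0.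
Qed.

(** The partial sums are dominated by the series of moduli and converge locally
    in mean, so the part of the modulus of [f] exceeding that series integrates
    to zero over every box. *)
Lemma decomposition_dominated f c rho h : cmeasurable f -> decomposition f c rho h ->
  {ae mu, forall x, ((normc (f x))%:E <=
    \sum_(0 <= n <oo) (normc (c n * dil (rho n) (h n) x))%:E)%E}.
Proof.
move=> mf /decompositionP[rho0 hm c1 /L1loc_cvgP cv].
pose F x := (\sum_(0 <= n <oo) (normc (c n * dil (rho n) (h n) x))%:E)%E.
have mcd n : cmeasurable (fun x => c n * dil (rho n) (h n) x).
  by apply: cmeasurableZ; apply: cmeasurable_dilation; case: (hm n).
have F0 x : (0 <= F x)%E by apply: nneseries_ge0 => n _ _; rewrite lee_fin normc_ge0.
have mF : measurable_fun setT F.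
  by apply: ge0_emeasurable_sum => n *; [rewrite lee_fin normc_ge0|exact: measurable_normcE].
pose D x := maxe ((normc (f x))%:E - F x)%E 0%E.
have D0 x : (0 <= D x)%E by rewrite /D le_max lexx orbT.
have mD : measurable_fun setT D.
  apply: measurable_maxe => //; apply: emeasurable_funB => //.
  exact: measurable_normcE.
pose S N x := \sum_(0 <= n < N) c n * dil (rho n) (h n) x.
have mS N : cmeasurable (S N) by exact: cmeasurable_sum.
have DS N x : (D x <= (normc (S N x - f x))%:E)%E.
  rewrite /D ge_max lee_fin normc_ge0 andbT.
  have SF : ((normc (S N x))%:E <= F x)%E.
    apply: (@le_trans _ _ (\sum_(0 <= n < N) (normc (c n * dil (rho n) (h n) x))%:E)%E).
      by rewrite sumEFin lee_fin normc_sum_le.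
    by apply: nneseries_lim_ge => n _ _; rewrite lee_fin normc_ge0.
  apply: (@le_trans _ _ ((normc (f x))%:E - (normc (S N x))%:E)%E).
    by rewrite leeB.
  rewrite -EFinB lee_fin lerBlDl normcBC.
  by rewrite (le_trans _ (normcD_le _ _))// addrC subrK.
have D_ae M : {ae mu, forall x, @big_box R d M x -> D x = 0%E}.
  have mM := @measurable_big_box R d M.
  have mDM : measurable_fun (@big_box R d M) D by exact: measurable_funTS.
  apply/(ae_eq_integral_abs mu mM mDM); apply/eqP; rewrite eq_le integral_ge0 ?andbT//.
  apply/lee_addgt0Pr => e e0; rewrite add0e.
  have [N _ /(_ N (leqnn N)) /= /ltW] := cvge0_near (cv M) e0.
  apply: le_trans; apply: ge0_le_integral => //.
  - by apply: measurableT_comp.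
  - by apply: measurable_funTS; exact: (measurable_normcE (cmeasurableB (mS N) mf)).
  - by move=> x _; rewrite gee0_abs//; exact: DS.
have := ae_foralln (fun n : nat => D_ae n%:R); apply: filterS => x Dx.
have [n xn] := in_big_box x.
by rewrite -/(F x) -sube_le0 -(Dx n xn) /D le_max lexx.
Qed.

(** The modulus of [f] being dominated by the series of moduli, the estimate of the
    atoms can be summed term by term. *)
Lemma decomposition_pairing_le f g c rho h : cmeasurable f -> cmeasurable g ->
  (fof g < +oo)%E -> decomposition f c rho h ->
  (\int[mu]_x (normc (f x * g x))%:E <= fof g * abs_coef_sum c)%E.
Proof.
move=> mf mg goo dec; have domf := decomposition_dominated mf dec.
have /decompositionP[rho0 hm c1 _] := dec.
have mcd n : cmeasurable (fun x => c n * dil (rho n) (h n) x).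
  by apply: cmeasurableZ; apply: cmeasurable_dilation; case: (hm n).
have mterm n : measurable_fun setT
    (fun x => (normc (c n * dil (rho n) (h n) x * g x))%:E).
  exact: (measurable_normcE (cmeasurableM (mcd n) mg)).
apply: (@le_trans _ _ (\int[mu]_x
    \sum_(0 <= n <oo) (normc (c n * dil (rho n) (h n) x * g x))%:E)%E).
  apply: ae_ge0_le_integral => //.
  - by move=> x _; rewrite lee_fin normc_ge0.
  - exact: (measurable_normcE (cmeasurableM mf mg)).
  - by move=> x _; apply: nneseries_ge0 => n _ _; rewrite lee_fin normc_ge0.
  - by apply: ge0_emeasurable_sum => n *; rewrite ?lee_fin ?normc_ge0.
  apply: filterS domf => x fx _.
  rewrite Normc.normcM EFinM muleC.
  under eq_eseriesr => n _ do rewrite [X in X%:E]Normc.normcM EFinM muleC.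
  rewrite nneseriesZl; last by move=> n _; rewrite lee_fin normc_ge0.
  by rewrite lee_wpmul2l// lee_fin normc_ge0.
rewrite integral_nneseries//; last by move=> n x _; rewrite lee_fin normc_ge0.
rewrite /abs_coef_sum.
have gfin : fof g \is a fin_num by rewrite ge0_fin_numE// fofana_norm_ge0.
rewrite -(fineK gfin) -nneseriesZl; last by move=> n _; rewrite lee_fin normc_ge0.
apply: lee_nneseries.
  by move=> n *; apply: integral_ge0 => x _; rewrite lee_fin normc_ge0.
move=> n *; rewrite fineK//.
under eq_integral do rewrite -mulrA Normc.normcM EFinM.
case: (hm n) => mh h1.
rewrite ge0_integralZl//.
- rewrite muleC lee_wpmul2r ?lee_fin ?normc_ge0//.
  apply: (le_trans (atom_pairing_le (rho0 n) mg mh _ goo)).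
    exact: le_lt_trans h1 (ltry _).
  by rewrite -[leRHS]mul1e lee_wpmul2r// fofana_norm_ge0.
- exact: (measurable_normcE (cmeasurableM (cmeasurable_dilation t%:E (rho n) mh) mg)).
- by move=> x _; rewrite lee_fin normc_ge0.
- by rewrite lee_fin normc_ge0.
Qed.

Lemma fofana_meas g : fofana q p alpha g -> cmeasurable g /\ (fof g < +oo)%E.
Proof. by move=> [[mg _] goo]. Qed.

Lemma H_meas f : H f -> cmeasurable f.
Proof. by move=> [[]]. Qed.

Lemma pairing_integrable g f : fofana q p alpha g -> H f ->
  cintegrable (fun x => f x * g x).
Proof.
move=> /fofana_meas[mg goo] [[mf _] [c [rho [h dec]]]].
apply/(cintegrableP (cmeasurableM mf mg)).
apply: (le_lt_trans (decomposition_pairing_le mf mg goo dec)).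
have gfin : fof g \is a fin_num by rewrite ge0_fin_numE// fofana_norm_ge0.
case/decompositionP: dec => _ _ c1 _.
by rewrite -(fineK gfin) lte_mul_pinfty// lee_fin fine_ge0// fofana_norm_ge0.
Qed.

Lemma pairing_normc_le g f (T : R) : fofana q p alpha g -> cmeasurable f ->
  cintegrable (fun x => f x * g x) -> (Hnorm f < T%:E)%E ->
  normc (pairing g f) <= fine (fof g) * T.
Proof.
move=> /fofana_meas[mg goo] mf ifg /ereal_inf_lt[_ [c [rho [h dec]] <-] cT].
have gfin : fof g \is a fin_num by rewrite ge0_fin_numE// fofana_norm_ge0.
rewrite -lee_fin; apply: (le_trans (normc_cintegral_le ifg)).
apply: (le_trans (decomposition_pairing_le mf mg goo dec)).
by rewrite EFinM fineK// lee_wpmul2l ?fofana_norm_ge0// ltW.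
Qed.

Lemma pairing_H_dual g : fofana q p alpha g -> H_dual q p alpha (pairing g).
Proof.
move=> fg; have [mg goo] := fofana_meas fg; split.
- move=> f1 f2 /H_meas m1 /H_meas m2 f12; apply: cintegral_ae_eq.
  + exact: cmeasurableM.
  + exact: cmeasurableM.
  + by apply: filterS f12 => x /(_ I) ->.
- move=> a f1 f2 H1 H2.
  have i1 := pairing_integrable fg H1; have i2 := pairing_integrable fg H2.
  rewrite /pairing -cintegralZ// -cintegralD//; last exact: cintegrableZ.
  by congr cintegral; apply/funext => x; rewrite mulrDl mulrA.
- move=> f Hf e e0; set G := fine (fof g).
  have G0 : 0 <= G by rewrite fine_ge0// fofana_norm_ge0.
  have G1 : 0 < G + 1 by rewrite ltr_wpDl.
  exists (e / (G + 1)); first by rewrite divr_gt0.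
  move=> f' Hf' fd.
  have i1 := pairing_integrable fg Hf'; have i2 := pairing_integrable fg Hf.
  have E : (fun x => (f' x - f x) * g x) = (fun x => f' x * g x - f x * g x).
    by apply/funext => x; rewrite mulrBl.
  have i3 : cintegrable (fun x => (f' x - f x) * g x).
    by rewrite E; exact: cintegrableB.
  have -> : pairing g f' - pairing g f = pairing g (fun x => f' x - f x).
    by rewrite /pairing E cintegralB.
  apply: (le_lt_trans (pairing_normc_le fg _ i3 fd)).
    by apply: cmeasurableB; exact: H_meas.
  by rewrite mulrA ltr_pdivrMr// mulrDr mulr1 mulrC ltrDl.
Qed.

(** The infimum in the norm of H need not be attained, hence the margin [e]. *)
Lemma pairing_dual_norm_le g : fofana q p alpha g ->
  (H_dual_norm q p alpha (pairing g) <= fof g)%E.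
Proof.
move=> fg; have [mg goo] := fofana_meas fg.
have gfin : fof g \is a fin_num by rewrite ge0_fin_numE// fofana_norm_ge0.
apply: ge_ereal_sup => _ [f [Hf f1] <-].
rewrite -(fineK gfin); set G := fine (fof g).
have G0 : 0 <= G by rewrite fine_ge0// fofana_norm_ge0.
apply/lee_addgt0Pr => e e0.
have := @pairing_normc_le g f (1 + e / (G + 1)) fg (H_meas Hf) (pairing_integrable fg Hf).
rewrite -EFinD lee_fin => H1; apply: (le_trans (H1 _)).
  apply: (le_lt_trans f1); rewrite lte_fin ltrDl divr_gt0// ltr_wpDl//.
rewrite -/G mulrDr mulr1 lerD2l mulrA ler_pdivrMr ?ltr_wpDl//.
by rewrite mulrDr mulr1 mulrC lerDl ltW.
Qed.

(** * Elements of H *)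

Lemma L1loc_cvg_near (u : nat -> V -> R[i]) f :
  (\forall N \near \oo, forall x, u N x = f x) -> L1loc_cvg u f.
Proof.
move=> uf; apply/L1loc_cvgP => M; apply: near_cvge0 => [N|e e0].
  by apply: integral_ge0 => x _; rewrite lee_fin normc_ge0.
apply: filterS uf => N uN; rewrite (eq_integral (cst 0%E)) ?integral0 ?lte_fin// => x _.
by rewrite uN subrr Normc.normc0.
Qed.

Lemma H_norm_le f c rho h : decomposition f c rho h -> (Hnorm f <= abs_coef_sum c)%E.
Proof. by move=> dec; apply: ereal_inf_lbound; exists c => //; exists rho, h. Qed.

Lemma H_atom_decomposition (a : R[i]) (rho : R) (k : V -> R[i]) : 0 < rho ->
  cmeasurable k -> (am k <= 1)%E ->
  decomposition (fun x => a * dil rho k x) (fun n => if n == 0 then a else 0)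
    (fun=> rho) (fun=> k) /\
  abs_coef_sum (fun n => if n == 0 then a else 0) = (normc a)%:E.
Proof.
move=> rho0 mk k1.
have cE : abs_coef_sum (fun n => if n == 0 then a else 0) = (normc a)%:E.
  rewrite /abs_coef_sum (nneseries_split 0 1); last by move=> n _; rewrite lee_fin normc_ge0.
  rewrite add0n big_nat1 eseries0 ?adde0// => n n1 _.
  by rewrite gtn_eqF// Normc.normc0.
split => //; apply/decompositionP; split => //; first by rewrite cE ltry.
apply: L1loc_cvg_near; exists 1%N => // N /= N1 x.
rewrite -(subnK N1) addn1 big_nat_recl//= big1 ?addr0// => n _.
by rewrite mul0r.
Qed.

Lemma dil_L1loc (rho : R) (k : V -> R[i]) : 0 < rho -> cmeasurable k ->
  (am k < +oo)%E -> L1loc (dil rho k).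
Proof.
move=> rho0 mk koo; apply: L1loc_dilation => //.
exact: (amalgam_L1loc (conj_exp_ge1 qr) s0 mk koo).
Qed.

Lemma H_atom (a : R[i]) (rho : R) (k : V -> R[i]) : 0 < rho ->
  cmeasurable k -> (am k <= 1)%E -> H (fun x => a * dil rho k x).
Proof.
move=> rho0 mk k1; have [dec _] := H_atom_decomposition a rho0 mk k1.
split; last by exists (fun n => if n == 0 then a else 0), (fun=> rho), (fun=> k).
by apply: L1locZ; apply: dil_L1loc => //; exact: le_lt_trans k1 (ltry _).
Qed.

Lemma H_norm_atom (a : R[i]) (rho : R) (k : V -> R[i]) : 0 < rho ->
  cmeasurable k -> (am k <= 1)%E ->
  (Hnorm (fun x => a * dil rho k x)%R <= (normc a)%:E)%E.
Proof.
move=> rho0 mk k1; have [dec <-] := H_atom_decomposition a rho0 mk k1.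
exact: H_norm_le dec.
Qed.

Lemma am_scale (a : R) (k : V -> R[i]) : 0 <= a -> cmeasurable k ->
  (am (fun x => a%:C%C * k x)%R <= a%:E * am k)%E.
Proof.
move=> a0 mk; apply: le_amalgam_norm => //; first exact: cmeasurableZ.
by move=> x; rewrite Normc.normcM normc_real ger0_norm.
Qed.

Lemma dilZ (a : R[i]) (rho : R) (k : V -> R[i]) x :
  dil rho (fun y => a * k y) x = a * dil rho k x.
Proof. by rewrite /dilation mulrCA. Qed.

(** Every dilated amalgam function is a multiple of an atom. *)
Lemma dil_atom (rho e : R) (k : V -> R[i]) : 0 < e -> 0 < rho -> cmeasurable k ->
  (am k <= e%:E)%E -> exists k1, [/\ cmeasurable k1, (am k1 <= 1)%E &
    dil rho k = (fun x => e%:C%C * dil rho k1 x)].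
Proof.
move=> e0 rho0 mk ke; exists (fun x => (e^-1)%:C%C * k x); split.
- exact: cmeasurableZ.
- apply: (le_trans (am_scale _ mk)); first by rewrite invr_ge0 ltW.
  apply: (@le_trans _ _ ((e^-1)%:E * e%:E)%E).
    by rewrite lee_wpmul2l// lee_fin invr_ge0 ltW.
  by rewrite -EFinM mulVf ?gt_eqF.
- apply/funext => x; rewrite dilZ mulrA -rmorphM/= mulfV ?gt_eqF//.
  by rewrite mul1r.
Qed.

Lemma am_fin_bound (k : V -> R[i]) : (am k < +oo)%E ->
  exists2 e : R, 0 < e & (am k <= e%:E)%E.
Proof.
move=> koo; have kfin : am k \is a fin_num by rewrite ge0_fin_numE// amalgam_norm_ge0.
exists (fine (am k) + 1); first by rewrite ltr_wpDl// fine_ge0// amalgam_norm_ge0.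
by rewrite EFinD fineK// leeDl.
Qed.

Lemma H_dil (rho : R) (k : V -> R[i]) : 0 < rho -> cmeasurable k -> (am k < +oo)%E ->
  H (dil rho k).
Proof.
move=> rho0 mk /am_fin_bound[e e0 ke].
by have [k1 [mk1 k11 ->]] := dil_atom e0 rho0 mk ke; exact: H_atom.
Qed.

Lemma dil1 (k : V -> R[i]) : dil 1 k = k.
Proof. by apply/funext => x; rewrite /dilation powR1 invr1 scale1r mul1r. Qed.

Lemma H_amalgam (k : V -> R[i]) : cmeasurable k -> (am k < +oo)%E -> H k.
Proof. by move=> mk koo; rewrite -(dil1 k); exact: H_dil. Qed.

Lemma am0 : am (fun=> 0) = 0%E.
Proof.
apply/eqP; rewrite eq_le amalgam_norm_ge0 andbT.
have := @am_scale 0 (fun=> 0) (lexx _) (cmeasurable_cst _).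
rewrite mul0e; apply: le_trans; rewrite le_eqVlt; apply/orP; left; apply/eqP.
by congr amalgam_norm; apply/funext => x; rewrite mulr0.
Qed.

Lemma H0 : H (fun=> 0).
Proof. by apply: H_amalgam; [exact: cmeasurable_cst|rewrite am0 ltry]. Qed.

Lemma H_partial_sum f c rho h N : decomposition f c rho h ->
  H (fun x => \sum_(0 <= n < N) c n * dil (rho n) (h n) x).
Proof.
move=> /decompositionP[rho0 hm c1 cv].
split.
  apply: L1loc_sum => n; case: (hm n) => mh h1.
  by apply: L1locZ; apply: dil_L1loc => //; exact: le_lt_trans h1 (ltry _).
exists (fun n => if (n < N)%N then c n else 0), rho, h; apply/decompositionP; split => //.
  apply: le_lt_trans c1; apply: lee_nneseries => [n _ _|n _].
    by rewrite lee_fin normc_ge0.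
  by case: ifPn => _; rewrite ?lexx// Normc.normc0 lee_fin normc_ge0.
apply: L1loc_cvg_near; exists N => // M /= NM x.
rewrite (big_cat_nat (leq0n N) NM)/= [X in _ + X](_ : _ = 0) ?addr0; last first.
  by rewrite big_nat; apply: big1 => n /andP[Nn _]; rewrite ltnNge Nn mul0r.
by rewrite !big_nat; apply: eq_bigr => n /andP[_ ->].
Qed.

(** The tail of a decomposition, reindexed and with opposite coefficients, is a
    decomposition of the difference. *)
Lemma H_norm_tail f c rho h N : decomposition f c rho h ->
  (Hnorm (fun x => (\sum_(0 <= n < N) c n * dil (rho n) (h n) x - f x)%R) <=
   \sum_(N <= n <oo) (normc (c n))%:E)%E.
Proof.
move=> /decompositionP[rho0 hm c1 cv].
have <- : abs_coef_sum (fun n => - c (n + N)%N) = (\sum_(N <= n <oo) (normc (c n))%:E)%E.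
  rewrite -(@nneseries_addn _ (fun n => (normc (c n))%:E)); last first.
    by move=> n; rewrite lee_fin normc_ge0.
  by apply: eq_eseriesr => n _; rewrite normcN.
apply: (@H_norm_le _ _ (fun n => rho (n + N)%N) (fun n => h (n + N)%N)).
apply/decompositionP; split => //.
- rewrite /abs_coef_sum; under eq_eseriesr do rewrite normcN.
  rewrite (@nneseries_addn _ (fun n => (normc (c n))%:E)) => [|n]; last first.
    by rewrite lee_fin normc_ge0.
  apply: le_lt_trans c1; rewrite [leRHS](nneseries_split 0 N); last first.
    by move=> n _; rewrite lee_fin normc_ge0.
  by rewrite leeDr// sume_ge0// => n _; rewrite lee_fin normc_ge0.
- apply/L1loc_cvgP => M; move/L1loc_cvgP : cv => /(_ M) cv.
  have : (fun n => n + N)%N @ \oo --> \oo by exact: cvg_addnr.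
  move=> /cvg_comp /(_ cv); apply: cvg_trans; rewrite /comp.
  apply: near_eq_cvg; apply: nearW => n; apply: eq_integral => x _.
  congr (_%:E); rewrite normcBC; congr normc.
  rewrite (big_cat_nat (leq0n N) (leq_addl n N))/= -{2}[N]add0n big_addn addnK.
  rewrite [X in _ = X - _](_ : _ =
      - \sum_(0 <= i < n) c (i + N)%N * dil (rho (i + N)%N) (h (i + N)%N) x); last first.
    by rewrite -sumrN; apply: eq_bigr => m _; rewrite mulNr.
  by ring.
Qed.

(** * Continuous functionals on H *)

Implicit Type L : (V -> R[i]) -> R[i].

Lemma dual_linear L a f g : H_dual q p alpha L -> H f -> H g ->
  L (fun x => a * f x + g x) = a * L f + L g.
Proof. by move=> [_ lin _]; exact: lin. Qed.

Lemma dual0 L : H_dual q p alpha L -> L (fun=> 0) = 0.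
Proof.
move=> dL; have := dual_linear 1 dL H0 H0.
rewrite (_ : (fun _ => _) = (fun=> 0)); last by apply/funext => x; rewrite mulr0 addr0.
by move/eqP; rewrite mul1r -subr_eq subrr eq_sym => /eqP.
Qed.

Lemma dualZ L a f : H_dual q p alpha L -> H f -> L (fun x => a * f x) = a * L f.
Proof.
move=> dL Hf; have := dual_linear a dL Hf H0; rewrite (dual0 dL) addr0 => <-.
by congr L; apply/funext => x; rewrite addr0.
Qed.

Lemma dualB L f g : H_dual q p alpha L -> H f -> H g ->
  L (fun x => f x - g x) = L f - L g.
Proof.
move=> dL Hf Hg; have := dual_linear (-1) dL Hg Hf; rewrite mulN1r addrC => <-.
by congr L; apply/funext => x; rewrite mulN1r addrC.
Qed.

(** Continuity at the origin and homogeneity give one bound for all dilations. *)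
Lemma dual_bound L : H_dual q p alpha L -> exists2 C : R, 0 <= C &
  forall (rho e : R) (k : V -> R[i]), 0 < rho -> 0 < e -> cmeasurable k -> (am k <= e%:E)%E ->
    normc (L (dil rho k)) <= C * e.
Proof.
move=> dL; have [_ _ cont] := dL.
have [delta del0 Hdel] := cont _ H0 1 ltr01.
exists (2 / delta); first by rewrite divr_ge0// ltW.
move=> rho e k rho0 e0 mk ke.
have [k1 [mk1 k11 ->]] := dil_atom e0 rho0 mk ke.
have Hk1 : H (dil rho k1) by apply: H_dil => //; exact: le_lt_trans k11 (ltry _).
rewrite dualZ// Normc.normcM normc_real gtr0_norm// mulrC ler_pM2r//.
have d2 : 0 <= delta / 2 by rewrite divr_ge0// ltW.
have := Hdel _ (H_atom (delta / 2)%:C%C rho0 mk1 k11).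
rewrite (_ : (fun x => _ - 0) = (fun x => (delta / 2)%:C%C * dil rho k1 x)); last first.
  by apply/funext => x; rewrite subr0.
rewrite (dual0 dL) subr0 dualZ// Normc.normcM normc_real ger0_norm// => H1.
have : delta / 2 * normc (L (dil rho k1)) < 1.
  apply: H1; apply: (le_lt_trans (H_norm_atom _ rho0 mk1 k11)).
  by rewrite normc_real ger0_norm// lte_fin ltr_pdivrMr// ltr_pMr// ltr1n.
by rewrite mulrC -ltr_pdivlMr ?divr_gt0// div1r invf_div => /ltW.
Qed.

Lemma am_dominated f k : cmeasurable f -> cmeasurable k ->
  (forall x, normc (f x) <= normc (k x)) -> (am k < +oo)%E -> (am f < +oo)%E.
Proof.
move=> mf mk fk koo; have := @le_amalgam_norm _ _ r s f k 1 r0 s0 ler01 mf mk.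
rewrite mul1e => H1; apply: le_lt_trans koo; apply: H1 => x.
by rewrite mul1r.
Qed.

(** Dominated convergence for functionals follows from [amalgam_dct], because
    [dual_bound] controls their values by the amalgam norm. *)
Lemma dual_dct L (rho : R) (F : nat -> V -> R[i]) f k : H_dual q p alpha L -> 0 < rho ->
  (forall n, cmeasurable (F n)) -> cmeasurable f -> cmeasurable k ->
  (forall n x, normc (F n x) <= normc (k x)) ->
  (forall x, normc (f x) <= normc (k x)) ->
  (forall x, (fun n => normc (F n x - f x)) @ \oo --> (0 : R)) ->
  (am k < +oo)%E ->
  (fun n => normc (L (dil rho (F n)) - L (dil rho f))) @ \oo --> (0 : R).
Proof.
move=> dL rho0 mF mf mk Fk fk Ff koo.
have [C C0 HC] := dual_bound dL.
have HF n : H (dil rho (F n)) by apply: H_dil => //; exact: am_dominated koo.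
have Hf : H (dil rho f) by apply: H_dil => //; exact: am_dominated koo.
have mFf n : cmeasurable (fun x => F n x - f x) by exact: cmeasurableB.
have E n : L (dil rho (F n)) - L (dil rho f) = L (dil rho (fun x => F n x - f x)).
  by rewrite -dualB//; congr L; apply/funext => x; rewrite /dilation mulrBr.
under eq_fun do rewrite E.
have m2k : cmeasurable (fun x => 2%:C%C * k x) by exact: cmeasurableZ.
have am2k : (am (fun x => 2%:C%C * k x)%R < +oo)%E.
  apply: (le_lt_trans (am_scale (ler0n _ 2) mk)).
  by rewrite lte_mul_pinfty.
have cv : (fun n => am (fun x => F n x - f x)%R) @ \oo --> 0%E.
  apply: (amalgam_dct r0 s0 mFf m2k _ _ am2k) => // n x.
  rewrite Normc.normcM normc_real ger0_norm// mulr_natl mulr2n.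
  by rewrite (le_trans (normcB_le _ _))// lerD.
apply: near_cvgr0 => [n|e e0]; first exact: normc_ge0.
have C1 : 0 < C + 1 by rewrite ltr_wpDl.
have e1 : 0 < e / (C + 1) by rewrite divr_gt0.
apply: filterS (cvge0_near cv e1) => n /ltW am_n.
apply: (le_lt_trans (HC _ _ _ rho0 e1 (mFf n) am_n)).
by rewrite mulrA ltr_pdivrMr// mulrDr mulr1 mulrC ltrDl.
Qed.

(** The atoms have a dense span, so they determine a continuous functional. *)
Lemma dual_ext L1 L2 : H_dual q p alpha L1 -> H_dual q p alpha L2 ->
  (forall (rho : R) (k : V -> R[i]), 0 < rho -> cmeasurable k -> (am k < +oo)%E ->
    L1 (dil rho k) = L2 (dil rho k)) ->
  forall f, H f -> L1 f = L2 f.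
Proof.
move=> d1 d2 L12 f Hf; have [_ [c [rho [h dec]]]] := Hf.
have /decompositionP[rho0 hm c1 _] := dec.
pose S N x := \sum_(0 <= n < N) c n * dil (rho n) (h n) x.
have HS N : H (S N) by exact: H_partial_sum dec.
have hoo n : (am (h n) < +oo)%E by case: (hm n) => _ /le_lt_trans; apply; exact: ltry.
have LS L : H_dual q p alpha L -> forall N,
    L (S N) = \sum_(0 <= n < N) c n * L (dil (rho n) (h n)).
  move=> dL; elim=> [|N IH].
    rewrite big_nil -[RHS](dual0 dL); congr L; apply/funext => x.
    by rewrite /S big_nil.
  rewrite big_nat_recr//= -IH addrC -(dual_linear _ dL)//; last first.
    by case: (hm N) => mh _; exact: H_dil.
  by congr L; apply/funext => x; rewrite /S big_nat_recr//= addrC.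
have L12S N : L1 (S N) = L2 (S N).
  rewrite (LS _ d1) (LS _ d2); apply: eq_bigr => n _; congr (_ * _).
  by case: (hm n) => mh _; exact: L12.
have tail : (\sum_(N <= n <oo) (normc (c n))%:E)%E @[N --> \oo] --> 0%E.
  by apply: nneseries_tail_cvg => // n _; rewrite lee_fin normc_ge0.
have near_L L e : H_dual q p alpha L -> 0 < e ->
    \forall N \near \oo, normc (L (S N) - L f) < e.
  move=> [_ _ cont] e0; have [delta del0 Hdel] := cont f Hf e e0.
  apply: filterS (cvge0_near tail del0) => N tN.
  by apply: Hdel => //; apply: le_lt_trans tN; exact: H_norm_tail.
apply/eqP; rewrite -subr_eq0; apply/eqP/Normc.eq0_normc/eqP.
rewrite eq_le normc_ge0 andbT; apply/ler_addgt0Pr => e e0; rewrite add0r.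
have e2 : 0 < e / 2 by rewrite divr_gt0.
near \oo => N.
rewrite (_ : L1 f - L2 f = (L2 (S N) - L2 f) - (L1 (S N) - L1 f)); last first.
  by rewrite L12S; ring.
rewrite (le_trans (normcB_le _ _))// (splitr e) lerD// ltW//.
  by near: N; exact: near_L.
by near: N; exact: near_L.
Unshelve. all: by end_near. Qed.

(** * Representation of continuous functionals *)

Lemma amalgam_dual_dct L (F : nat -> V -> R[i]) f (k : V -> R[i]) : H_dual q p alpha L ->
  (forall n, cmeasurable (F n)) -> cmeasurable f -> cmeasurable k ->
  (forall n x, normc (F n x) <= normc (k x)) ->
  (forall x, (fun n => normc (F n x - f x)) @ \oo --> (0 : R)) ->
  (am k < +oo)%E ->
  (fun n => normc (L (F n) - L f)) @ \oo --> (0 : R).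
Proof.
move=> dL mF mf mk Fk Ff koo.
have fk x : normc (f x) <= normc (k x).
  apply/ler_addgt0Pr => e e0.
  have [N _ /(_ N (leqnn N))/= FN] := cvgr0_near (Ff x) e0.
  rewrite (_ : f x = F N x - (F N x - f x)); last by rewrite opprB addrC subrK.
  by rewrite (le_trans (normcB_le _ _))// lerD// ltW.
have := dual_dct dL ltr01 mF mf mk Fk fk Ff koo.
by under eq_fun do rewrite !dil1.
Qed.

(** Domination by one amalgam function makes every partial sum an element of H. *)
Lemma dual_sum L (I : Type) (l : seq I) (F : I -> V -> R[i]) (a : I -> R[i])
    (k : V -> R[i]) :
  H_dual q p alpha L -> cmeasurable k -> (am k < +oo)%E ->
  (forall i, cmeasurable (F i)) -> (forall i x, normc (F i x) <= normc (k x)) ->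
  L (fun x => \sum_(i <- l) a i * F i x) = \sum_(i <- l) a i * L (F i).
Proof.
move=> dL mk koo mF Fk.
have HF i : H (F i) by apply: H_amalgam => //; exact: (am_dominated (mF i) mk (Fk i) koo).
have HS (l' : seq I) : H (fun x => \sum_(i <- l') a i * F i x).
  apply: H_amalgam; first by apply: cmeasurable_sum => i; exact: cmeasurableZ.
  have C0 : 0 <= \sum_(i <- l') normc (a i) by apply: sumr_ge0 => i _; exact: normc_ge0.
  apply: (le_lt_trans (le_amalgam_norm (h := k) r0 s0 C0 _ mk _)).
  - by apply: cmeasurable_sum => i; exact: cmeasurableZ.
  - move=> x; rewrite (le_trans (normc_sum_le _ _ _))// mulr_suml ler_sum// => i _.
    by rewrite Normc.normcM ler_wpM2l ?normc_ge0.
  - by rewrite lte_mul_pinfty.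
elim: l => [|i l IH].
  rewrite big_nil -[RHS](dual0 dL); congr L; apply/funext => x.
  by rewrite big_nil.
rewrite big_cons -IH -(dual_linear _ dL)//; congr L; apply/funext => x.
by rewrite big_cons.
Qed.

Lemma dual_null L f : H_dual q p alpha L -> H f -> f = (fun=> 0) %[ae mu] -> L f = 0.
Proof.
by move=> dL Hf f0; have [ae _ _] := dL; rewrite -(dual0 dL); apply: ae => //; exact: H0.
Qed.

Section density.
Context (w : V -> R) (mw : measurable_fun setT w) (w0 : forall x, 0 < w x).
Let W x := (w x)%:C%C : R[i].
Context (woo : (am W < +oo)%E).

Let mW : cmeasurable W. Proof. exact: cmeasurable_real. Qed.

Let WA (A : set V) x := W x * (\1_A x)%:C%C.

Let mWA A : measurable A -> cmeasurable (WA A).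
Proof. by move=> mA; exact: (cmeasurableM mW (cmeasurable_indic mA)). Qed.

Let WA_le A x : normc (WA A x) <= normc (W x).
Proof.
rewrite /WA Normc.normcM ler_piMr ?normc_ge0// normc_real indicE.
by case: (_ \in _); rewrite ?normr1 ?normr0.
Qed.

Let H_WA A : measurable A -> H (WA A).
Proof.
move=> mA; apply: H_amalgam; first exact: mWA.
exact: (am_dominated (mWA mA) mW (WA_le A) woo).
Qed.

(** Since the weight lies in the amalgam space, [L] evaluated on its restrictions to
    measurable sets is a finite complex measure on the whole space, and its density
    with respect to the weighted Lebesgue measure represents [L]. *)
Lemma dual_weighted_density L : H_dual q p alpha L ->
  exists g, [/\ cmeasurable g, cintegrable (fun x => W x * g x) &
    forall A, measurable A -> L (WA A) = cintegral (fun x => WA A x * g x)].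
Proof.
move=> dL.
have nu0 : L (WA set0) = 0.
  rewrite -(dual0 dL); congr L; apply/funext => x.
  by rewrite /WA indic0 mulr0.
have nuS (F : nat -> set V) : (forall n, measurable (F n)) -> trivIset setT F ->
    (fun n => normc (\sum_(0 <= i < n) L (WA (F i)) - L (WA (\bigcup_n F n)))) @ \oo
    --> (0 : R).
  move=> mF tF.
  have E n : \sum_(0 <= i < n) L (WA (F i)) =
      L (fun x => \sum_(0 <= i < n) 1 * WA (F i) x).
    rewrite (dual_sum _ _ dL mW woo) => [|i|i x]; last 2 first.
    - exact: mWA.
    - exact: WA_le.
    by apply: eq_bigr => i _; rewrite mul1r.
  under eq_fun do rewrite E.
  set U := \bigcup_n F n.
  (* at each point the partial sums vanish identically or jump once to W x *)
  have SE x : ((forall n, \sum_(0 <= i < n) 1 * WA (F i) x = 0) /\ WA U x = 0) \/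
      exists j, (forall n, \sum_(0 <= i < n) 1 * WA (F i) x =
        if (j < n)%N then W x else 0) /\ WA U x = W x.
    have [[j _ Fjx]|nUx] := pselect (U x).
      right; exists j; split; last by rewrite /WA indicE mem_set ?mulr1//; exists j.
      have Fi i : i != j -> 1 * WA (F i) x = 0.
        move=> ij; rewrite /WA indicE memNset ?mulr0// => Fix.
        by move: ij; rewrite (tF i j I I) ?eqxx//; exists x.
      have Fj : 1 * WA (F j) x = W x by rewrite /WA indicE mem_set// mul1r mulr1.
      move=> n; case: ifPn => jn; last first.
        rewrite big_nat; apply: big1 => i /andP[_ iltn]; apply: Fi.
        by apply: contraNneq jn => <-.
      rewrite (bigD1_seq j)/=; [|by rewrite mem_index_iota|exact: iota_uniq].
      by rewrite Fj big1 ?addr0.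
    left; split; last by rewrite /WA indicE memNset ?mulr0.
    move=> n; apply: big1 => i _; rewrite /WA indicE memNset ?mulr0// => Fix.
    by apply: nUx; exists i.
  apply: (amalgam_dual_dct dL _ _ mW _ _ woo).
  - by move=> n; apply: cmeasurable_sum => i; apply: cmeasurableZ; exact: mWA.
  - by apply: mWA; exact: bigcupT_measurable.
  - move=> n x; have [[-> _]|[j [-> _]]] := SE x.
      by rewrite Normc.normc0 normc_ge0.
    by case: ifP; rewrite ?lexx// Normc.normc0 normc_ge0.
  - move=> x; apply: near_cvgr0 => [n|e e0]; first exact: normc_ge0.
    have [[S0 ->]|[j [Sj ->]]] := SE x.
      by apply: nearW => n; rewrite S0 subrr Normc.normc0.
    by exists j.+1 => // n /= jn; rewrite Sj jn subrr Normc.normc0.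
have nunull A : measurable A -> mu A = 0%E -> L (WA A) = 0.
  move=> mA A0; apply: (dual_null dL (H_WA mA)).
  exists A; split => // x /= /not_implyP[_ h]; apply: contrapT => nAx; apply: h.
  by rewrite /WA indicE memNset// mulr0.
have [uR [iR nuR]] : exists u : V -> R, mu.-integrable setT (EFin \o u) /\
    forall A, measurable A -> Re (L (WA A)) = Rintegral mu A u.
  apply: radon_nikodym_real => [|F mF tF|A mA A0].
  - by rewrite nu0.
  - apply/cvgrPdist_lt => e e0.
    apply: filterS (cvgr0_near (nuS F mF tF) e0) => n; apply: le_lt_trans; rewrite distrC.
    apply: le_trans (normc_re_le _); rewrite ReD ReN.
    by rewrite Re_sum.
  - by rewrite nunull.
have [uI [iI nuI]] : exists u : V -> R, mu.-integrable setT (EFin \o u) /\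
    forall A, measurable A -> Im (L (WA A)) = Rintegral mu A u.
  apply: radon_nikodym_real => [|F mF tF|A mA A0].
  - by rewrite nu0.
  - apply/cvgrPdist_lt => e e0.
    apply: filterS (cvgr0_near (nuS F mF tF) e0) => n; apply: le_lt_trans; rewrite distrC.
    apply: le_trans (normc_im_le _); rewrite ImD ImN.
    by rewrite Im_sum.
  - by rewrite nunull.
pose u x := (uR x +i* uI x)%C.
have iu : cintegrable u by split.
have Wg x : W x * (((w x)^-1)%:C%C * u x) = u x.
  by rewrite mulrA -rmorphM/= mulfV ?gt_eqF// mul1r.
exists (fun x => ((w x)^-1)%:C%C * u x); split.
- apply: cmeasurableM; last exact: cintegrable_meas.
  apply: cmeasurable_real; under eq_fun do rewrite -powR_inv1 ?(ltW (w0 _))//.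
  exact: measurableT_comp (measurable_powR _) mw.
- by under eq_fun do rewrite Wg.
- move=> A mA.
  have E x : WA A x * (((w x)^-1)%:C%C * u x) = (\1_A x)%:C%C * u x.
    by rewrite /WA mulrAC Wg mulrC.
  under eq_fun do rewrite E.
  apply: complex_eqP.
    rewrite nuR// Rintegral_mkcond; apply: eq_Rintegral => x _.
    rewrite ReM /= mul0r subr0 patchE indicE.
    by case: ifP => _; rewrite ?mul1r ?mul0r.
  rewrite nuI// Rintegral_mkcond; apply: eq_Rintegral => x _.
  rewrite ImM /= mul0r addr0 patchE indicE.
  by case: ifP => _; rewrite ?mul1r ?mul0r.
Qed.

Section representation.
Context (L : (V -> R[i]) -> R[i]) (dL : H_dual q p alpha L) (g : V -> R[i]).
Context (mg : cmeasurable g) (iWg : cintegrable (fun x => W x * g x)).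
Context (LWA : forall A, measurable A -> L (WA A) = cintegral (fun x => WA A x * g x)).

Let iWAg A : measurable A -> cintegrable (fun x => WA A x * g x).
Proof.
move=> mA; apply: (cintegrable_le _ _ _ iWg).
- by apply: cmeasurableM => //; exact: mWA.
- exact: cmeasurableM.
- move=> x; rewrite Normc.normcM [leRHS]Normc.normcM.
  by apply: ler_wpM2r; [exact: normc_ge0|exact: WA_le].
Qed.

(** Simple functions below [v / w] and converging to it give, after multiplication by the weight,
    combinations of the functions on which [L] is known, dominated by [v]. *)
Let represents_nonneg (v : V -> R) : measurable_fun setT v -> (forall x, 0 <= v x) ->
  (am (fun x => (v x)%:C%C) < +oo)%E -> cintegrable (fun x => (v x)%:C%C * g x) ->
  L (fun x => (v x)%:C%C) = cintegral (fun x => (v x)%:C%C * g x).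
Proof.
move=> mv v0 voo ivg.
pose u x := v x / w x.
have wu x : w x * u x = v x by rewrite mulrC /u divfK// gt_eqF.
have mu_ : measurable_fun setT u.
  rewrite /u; apply: measurable_funM => //.
  under eq_fun do rewrite -powR_inv1 ?(ltW (w0 _))//.
  exact: measurableT_comp (measurable_powR _) mw.
have u0 x : 0 <= u x by rewrite divr_ge0// ltW.
have [b [mb bu bcv bl]] := simple_approximation mu_ u0.
have mcv : cmeasurable (fun x => (v x)%:C%C : R[i]) by exact: cmeasurable_real.
pose F n x := W x * (b n x)%:C%C.
have mF n : cmeasurable (F n) by apply: cmeasurableM => //; exact: cmeasurable_real.
have FE n x : F n x = (w x * b n x)%:C%C by rewrite rmorphM.
have Fv n x : normc (F n x) <= normc ((v x)%:C%C : R[i]).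
  case/andP: (bu n x) => b0 bux.
  rewrite FE !normc_real !ger0_norm ?mulr_ge0 ?(ltW (w0 x))//.
  by rewrite -(wu x) ler_wpM2l// ltW.
have Fcv x : (fun n => normc (F n x - (v x)%:C%C)) @ \oo --> (0 : R).
  have -> : (fun n => normc (F n x - (v x)%:C%C)) = (fun n => w x * `|b n x - u x|).
    apply/funext => n.
    have -> : F n x - (v x)%:C%C = (w x * b n x - v x)%:C%C by rewrite FE rmorphB.
    by rewrite normc_real -(wu x) -mulrBr normrM (gtr0_norm (w0 x)).
  rewrite -(mulr0 (w x)); apply: cvgMr.
  rewrite -(normr0 R) -(subrr (u x)); apply: cvg_norm; apply: cvgB => //.
  exact: cvg_cst.
have LF n : L (F n) = cintegral (fun x => F n x * g x).
  have [l [A [mA bE]]] := bl n.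
  have FWA : F n = (fun x => \sum_(y <- l) y%:C%C * WA (A y) x).
    apply/funext => x; rewrite /F bE rmorph_sum mulr_sumr; apply: eq_bigr => y _.
    by rewrite /WA rmorphM/= mulrCA.
  rewrite FWA (dual_sum l (fun y : R => y%:C%C) dL mW woo) => [|y|y x]; last 2 first.
  - exact: mWA.
  - exact: WA_le.
  rewrite (_ : (fun x => _) = (fun x => \sum_(y <- l) y%:C%C * (WA (A y) x * g x))).
    rewrite cintegral_sum; last by move=> y; apply: cintegrableZ; exact: iWAg.
    by apply: eq_bigr => y _; rewrite LWA// cintegralZ//; exact: iWAg.
  by apply/funext => x; rewrite mulr_suml; apply: eq_bigr => y _; rewrite mulrA.
apply: (@cvg_normc_unique _ (fun n => L (F n))).
  exact: (amalgam_dual_dct dL mF mcv mcv Fv Fcv voo).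
under eq_fun do rewrite LF.
apply: (cintegral_dct (g := fun x => (v x)%:C%C * g x)) => //.
- by move=> n; exact: cmeasurableM.
- exact: cmeasurableM.
- move=> x; under eq_fun do rewrite -mulrBl Normc.normcM.
  rewrite -(mul0r (normc (g x))); apply: cvgMl; exact: Fcv.
- move=> n x; rewrite Normc.normcM [leRHS]Normc.normcM.
  by apply: ler_wpM2r; [exact: normc_ge0|exact: Fv].
Qed.

(** Positive and negative parts of the real and imaginary parts are dominated by
    the modulus, hence stay in the amalgam space. *)
Lemma dual_represents f : cmeasurable f -> (am f < +oo)%E ->
  cintegrable (fun x => f x * g x) -> L f = cintegral (fun x => f x * g x).
Proof.
move=> mf foo ifg.
have dom (u : V -> R) : measurable_fun setT u -> (forall x, `|u x| <= normc (f x)) ->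
    [/\ cmeasurable (fun x => (u x)%:C%C : R[i]), H (fun x => (u x)%:C%C),
      (am (fun x => (u x)%:C%C) < +oo)%E & cintegrable (fun x => (u x)%:C%C * g x)].
  move=> mu_ uf; have mcu : cmeasurable (fun x => (u x)%:C%C : R[i]) by exact: cmeasurable_real.
  have uoo : (am (fun x => (u x)%:C%C) < +oo)%E.
    by apply: (am_dominated mcu mf _ foo) => x; rewrite normc_real.
  split => //; first exact: H_amalgam.
  apply: (cintegrable_le _ _ _ ifg); [exact: cmeasurableM|exact: cmeasurableM|].
  by move=> x; rewrite !Normc.normcM normc_real ler_wpM2r ?normc_ge0.
have real_case (u : V -> R) : measurable_fun setT u -> (forall x, `|u x| <= normc (f x)) ->
    L (fun x => (u x)%:C%C) = cintegral (fun x => (u x)%:C%C * g x).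
  move=> mu_ uf; pose u1 x := Num.max (u x) 0; pose u2 x := Num.max (- u x) 0.
  have uE x : u x = u1 x - u2 x.
    by rewrite /u1 /u2; case: (leP (u x) 0) => u0; case: (leP (- u x) 0) => u0'; lra.
  have m1 : measurable_fun setT u1 by exact: measurable_maxr.
  have m2 : measurable_fun setT u2.
    by apply: measurable_maxr => //; exact: measurableT_comp.
  have u10 x : 0 <= u1 x by rewrite /u1 le_max lexx orbT.
  have u20 x : 0 <= u2 x by rewrite /u2 le_max lexx orbT.
  have u1f x : `|u1 x| <= normc (f x).
    rewrite ger0_norm// (le_trans _ (uf x))// /u1 ge_max ler_norm/=.
    exact: normr_ge0.
  have u2f x : `|u2 x| <= normc (f x).
    by rewrite ger0_norm// (le_trans _ (uf x))// /u2 ge_max -normrN ler_norm/= normr_ge0.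
  have [_ H1 oo1 i1] := dom _ m1 u1f; have [_ H2 oo2 i2] := dom _ m2 u2f.
  rewrite (_ : (fun x => (u x)%:C%C) = (fun x => (u1 x)%:C%C - (u2 x)%:C%C)); last first.
    by apply/funext => x; rewrite -rmorphB/= -uE.
  rewrite (dualB dL H1 H2) (represents_nonneg m1 u10 oo1 i1).
  rewrite (represents_nonneg m2 u20 oo2 i2) -cintegralB//; congr cintegral.
  by apply/funext => x; rewrite -mulrBl -rmorphB/= -uE.
have [mRe mIm] := mf.
have [_ HR _ iR] := dom _ mRe (fun x => normc_re_le (f x)).
have [_ HI _ iI] := dom _ mIm (fun x => normc_im_le (f x)).
have fE x : f x = 'i%C * (Im (f x))%:C%C + (Re (f x))%:C%C.
  by rewrite [LHS]complexE addrC.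
have -> : L f = L (fun x => 'i%C * (Im (f x))%:C%C + (Re (f x))%:C%C).
  by congr L; apply/funext => x; exact: fE.
rewrite (dual_linear _ dL HI HR).
rewrite (real_case _ mRe (fun x => normc_re_le (f x))).
rewrite (real_case _ mIm (fun x => normc_im_le (f x))) -cintegralZ// -cintegralD//.
  by congr cintegral; apply/funext => x; rewrite mulrA -mulrDl -fE.
exact: cintegrableZ.
Qed.

End representation.
End density.

(** The supremum over dilations includes the ratio one, and the amalgam norm controls
    the integral over each cube by Hoelder's inequality against the constant [1]. *)
Lemma L1loc_fofana g : cmeasurable g -> (fof g < +oo)%E -> L1loc g.
Proof.
move=> mg goo.
have g1 : dilation alpha 1 g = g.
  by apply/funext => x; rewrite /dilation powR1 invr1 scale1r mul1r.
have := fofana_norm_ge g ltr01; rewrite g1 => /le_lt_trans /(_ goo) {}goo.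
have p0 : (0 < p)%E by case: ps => // ? ? /(lt_trans ltr01).
have one_fin k : (cLnorm r%:E (fun x => 1 * (\1_(unit_cube k) x)%:C%C)%R < +oo)%E.
  rewrite cLnorm_cube// /cube_int (_ : (fun x => _) = (fun=> 1%E)); last first.
    by apply/funext => x; rewrite Normc.normc1 powR1.
  rewrite integral_cst; last exact: measurable_cube.
  by rewrite mul1e [X in (X `^ _)%E](lebesgue_cube k) poweR_lty// ltry.
apply: L1loc_cubes => // k.
have := cube_hoelder k qr (cmeasurable_cst 1) mg.
under eq_integral do rewrite mul1r.
move=> /le_lt_trans; apply.
have gk : (cLnorm q (fun x => g x * (\1_(unit_cube k) x)%:C%C)%R < +oo)%E.
  apply: le_lt_trans goo.
  by apply: (@seq_norm_ge _ _ _ (fun k => cLnorm q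
    (fun x => g x * (\1_(unit_cube k) x)%:C%C)%R)) => // l; exact: cLnorm_ge0.
by rewrite ltey_eq fin_numM ?ge0_fin_numE ?cLnorm_ge0.
Qed.

(** A bound for the pairings with dilated tame functions suffices, because the
    norm of every dilation of [g] is tested by tame functions and the dilation can
    be moved to the other factor. *)
Lemma fofana_norm_le g (C : R) : 0 <= C -> cmeasurable g ->
  (forall (l : R) f, 0 < l -> tame f -> cintegrable (fun x => dil l f x * g x) ->
    (am f <= 1)%E -> normc (cintegral (fun x => dil l f x * g x)) <= C) ->
  (fof g <= C%:E)%E.
Proof.
move=> C0 mg HC; apply: ge_ereal_sup => _ [l l0 <-].
have li0 : 0 < l^-1 by rewrite invr_gt0.
apply: (amalgam_converse qr ps C0); first exact: cmeasurable_dilation.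
move=> f tf tfg f1.
have ifg : cintegrable (fun x => f x * dilation alpha l^-1^-1 g x).
  by rewrite invrK; exact: tame_cintegrable.
have := cintegral_dilation li0 conj_exp_fineV ifg; rewrite invrK => <-.
by apply: HC => //; exact: cintegrable_dilation conj_exp_fineV ifg.
Qed.

Lemma fofana_norm_le_dual g : fofana q p alpha g ->
  (fof g <= H_dual_norm q p alpha (pairing g))%E.
Proof.
move=> fg; have [mg goo] := fofana_meas fg.
set N := H_dual_norm _ _ _ _.
have Ngoo : (N <= fof g)%E by exact: pairing_dual_norm_le.
have Nge f : H f -> (Hnorm f <= 1)%E -> ((normc (pairing g f))%:E <= N)%E.
  by move=> Hf f1; apply: ereal_sup_ubound; exists f.
have atom (l : R) f : 0 < l -> cmeasurable f -> (am f <= 1)%E ->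
    ((normc (pairing g (dil l f)))%:E <= N)%E.
  move=> l0 mf f1.
  have E : dil l f = (fun x => 1 * dil l f x) by apply/funext => x; rewrite mul1r.
  rewrite E; apply: Nge; first exact: H_atom.
  by rewrite -(@Normc.normc1 R); exact: H_norm_atom.
have N0 : (0 <= N)%E.
  apply: le_trans (atom 1 (fun=> 0) ltr01 (cmeasurable_cst _) _); first by rewrite lee_fin normc_ge0.
  by rewrite am0.
have Nfin : N \is a fin_num by rewrite ge0_fin_numE// (le_lt_trans Ngoo).
rewrite -(fineK Nfin); apply: fofana_norm_le => //; first exact: fine_ge0.
move=> l f l0 [mf _] _ f1; rewrite -lee_fin fineK//; exact: atom.
Qed.

Lemma pairing_isometry g : fofana q p alpha g ->
  H_dual_norm q p alpha (pairing g) = fof g.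
Proof.
by move=> fg; apply/eqP; rewrite eq_le pairing_dual_norm_le// fofana_norm_le_dual.
Qed.

(** The representing function is first only known to be measurable and integrable
    against the weight.  Testing with tame functions bounds its Fofana norm; from
    then on its pairing is continuous on H, and truncation removes the integrability
    condition of [dual_represents]. *)
Lemma pairing_onto L : H_dual q p alpha L ->
  exists2 g, fofana q p alpha g & forall f, H f -> L f = pairing g f.
Proof.
move=> dL; have [w [mw w0 woo]] := weight_exists (d := d) r0 (conj_exp_ge1 ps).
have [g [mg iWg LWA]] := dual_weighted_density mw w0 woo dL.
have rep := dual_represents mw w0 woo dL mg iWg LWA.
have [C C0 HC] := dual_bound dL.
have repdil (l : R) f : 0 < l -> tame f -> cintegrable (fun x => dil l f x * g x) ->
    L (dil l f) = pairing g (dil l f).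
  move=> l0 tf ifg; have td := tame_dilation t%:E l0 tf.
  by apply: rep => //; [case: td|exact: tame_amalgam].
have gC : (fof g <= C%:E)%E.
  apply: fofana_norm_le => // l f l0 tf ifg f1.
  rewrite -[cintegral _]/(pairing g (dil l f)) -repdil// -[C]mulr1.
  by apply: HC => //; case: tf.
have goo : (fof g < +oo)%E by exact: le_lt_trans gC (ltry _).
have fg : fofana q p alpha g by split => //; exact: L1loc_fofana.
have dg := pairing_H_dual fg.
exists g => //; apply: (dual_ext dL dg) => l k l0 mk koo.
have [F [tF Fk Fcv]] := tame_truncation mk.
have mF n : cmeasurable (F n) by case: (tF n).
have HF n : H (dil l (F n)) by apply: H_dil => //; exact: am_dominated koo.
apply: (@cvg_normc_unique _ (fun n => L (dil l (F n)))).
  exact: (dual_dct dL l0 mF mk mk Fk _ Fcv koo).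
have E n : L (dil l (F n)) = pairing g (dil l (F n)).
  by apply: repdil => //; exact: pairing_integrable.
under eq_fun do rewrite E.
exact: (dual_dct dg l0 mF mk mk Fk _ Fcv koo).
Qed.

Lemma pairing_linear (a : R[i]) g1 g2 f : fofana q p alpha g1 -> fofana q p alpha g2 -> H f ->
  pairing (fun x => a * g1 x + g2 x) f = a * pairing g1 f + pairing g2 f.
Proof.
move=> fg fh Hf.
have i1 := pairing_integrable fg Hf; have i2 := pairing_integrable fh Hf.
rewrite /pairing -cintegralZ// -cintegralD//; last exact: cintegrableZ.
by congr cintegral; apply/funext => x; rewrite mulrDr mulrCA.
Qed.

Lemma pairing_injective g1 g2 : fofana q p alpha g1 -> fofana q p alpha g2 ->
  (forall f, H f -> pairing g1 f = pairing g2 f) <-> g1 = g2 %[ae mu].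
Proof.
move=> fg fh; split=> [gg|gg f /H_meas mf].
  apply: tame_separating; [by case: fg|by case: fh|] => f tf.
  by apply: gg; apply: H_amalgam; [case: tf|exact: tame_amalgam].
have [mg _] := fofana_meas fg; have [mh _] := fofana_meas fh.
apply: cintegral_ae_eq; [exact: cmeasurableM|exact: cmeasurableM|].
by apply: filterS gg => x /(_ I) ->.
Qed.

End space_H_facts.

(** * The duality theorem *)

Theorem theorem3p4 (R : realType) (d : nat) (q alpha p : \bar R)
    (d_gt0 : (0 < d)%N) (q_gt1 : (1 < q)%E)
    (q_le_alpha : (q <= alpha)%E) (alpha_le_p : (alpha <= p)%E) :
  [/\ (* T_g is a well-defined element of the dual, with the norm of g *)
      forall g : 'rV[R]_d -> R[i], fofana q p alpha g ->
        [/\ forall f, H_space q p alpha f -> cintegrable (fun x => f x * g x),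
            H_dual q p alpha (pairing g) &
            H_dual_norm q p alpha (pairing g) = fofana_norm q p alpha g],
      (* g |-> T_g is linear *)
      forall (a : R[i]) (g h : 'rV[R]_d -> R[i]),
        fofana q p alpha g -> fofana q p alpha h ->
        forall f, H_space q p alpha f ->
          pairing (fun x => a * g x + h x) f = a * pairing g f + pairing h f,
      (* it is well defined on classes and injective *)
      forall g h : 'rV[R]_d -> R[i],
        fofana q p alpha g -> fofana q p alpha h ->
        (forall f, H_space q p alpha f -> pairing g f = pairing h f) <->
        g = h %[ae lebesgue_rV d] &
      (* it is onto *)
      forall L : ('rV[R]_d -> R[i]) -> R[i], H_dual q p alpha L ->
        exists2 g, fofana q p alpha g &
          forall f, H_space q p alpha f -> L f = pairing g f].
Proof.
have alpha_gt1 : (1 < alpha)%E := lt_le_trans q_gt1 q_le_alpha.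
have [r hq qr] := conj_expP q_gt1.
have [t ha alt] := conj_expP alpha_gt1.
have [s hp ps] := conj_expP (lt_le_trans alpha_gt1 alpha_le_p).
split.
- move=> g fg; split; last exact: (pairing_isometry qr ps alt hq hp ha fg).
    by move=> f Hf; exact: (pairing_integrable qr ps alt hq hp ha fg Hf).
  exact: (pairing_H_dual qr ps alt hq hp ha fg).
- move=> a g h fg fh f Hf; exact: (pairing_linear qr ps alt hq hp ha a fg fh Hf).
- by move=> g h fg fh; exact: (pairing_injective qr ps hq hp ha fg fh).
- by move=> L dL; exact: (pairing_onto qr ps alt hq hp ha dL).
Qed.
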